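(* Let $\psi:\mathbb{R}\to\mathbb{R}$ be a measurable function such that $E_\psi=E_c$, and let $\mathcal{C}$ be a contour which encloses the eigenvalues of $M_\psi$ different from $\lambda^{\ast}_\psi$ and does not enclose $\lambda^{\ast}_\psi$. Set $$\widehat M_\psi=\frac1n\sum_{i=1}^nZ_iZ_i^T\psi(Y_i),\qquad \widehat P_n=\frac{1}{2\pi i}\oint_{\mathcal{C}}(Iz-\widehat M_\psi)^{-1}\,dz.$$ Let $W_\psi$ be the limit in law, as $n\to\infty$, of the random variable $n\operatorname{tr}(Q_c\widehat P_n)$. Then $$\mathbb{E}[W_\psi]=\operatorname{tr}\left(\mathbb{E}\left[ZZ^T\|Q_cZ\|^2\psi(Y)^2\right]P_c\,(P_cM_\psi-I\lambda^{\ast}_\psi)^{-2}\right).$$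
   Context: $Y$ is a real random variable, $X$ a random vector in $\mathbb{R}^p$ with invertible covariance matrix $\Sigma$, and $Z=\Sigma^{-1/2}(X-\mathbb{E}[X])$, so $\mathbb{E}[Z]=0$ and $\operatorname{var}(Z)=I$; $(Z_i,Y_i)_{i\ge1}$ are i.i.d. copies of $(Z,Y)$. A dimension reduction subspace (DRS) for $Z$ is a linear subspace $E\subset\mathbb{R}^p$ such that $Y$ and $Z$ are conditionally independent given $PZ$, $P$ being the orthogonal projection on $E$. The (standardized) central subspace $E_c$ is the unique DRS of minimal dimension, equal to the intersection of all DRS. $P_c$ is the orthogonal projection on $E_c$, $Q_c=I-P_c$, $d=\dim E_c<p$. Standing assumptions: $X$ has a density whose support has a boundary of Lebesgue measure $0$, and $E_c$ exists; the linearity condition $Q_c\mathbb{E}[Z|P_cZ]=0$ a.s. and the diagonal conditional variance condition $\operatorname{var}(Z|P_cZ)=\lambda^{\ast}_\omega Q_c$ a.s. (for some real random variable $\lambda^{\ast}_\omega$) hold. $M_\psi=\mathbb{E}[ZZ^T\psi(Y)]$, $\lambda^{\ast}_\psi=\frac{1}{p-d}\mathbb{E}[\|Q_cZ\|^2\psi(Y)]$, and $E_\psi=\operatorname{span}(M_\psi-\lambda^{\ast}_\psi I)$ (column space); under the standing assumptions $E_c^\perp$ is contained in the eigenspace of $M_\psi$ for $\lambda^{\ast}_\psi$. All expectations appearing are assumed finite. If $\lambda_\psi^{\ast}=0$, the inverse in the formula is understood on $E_c$. The contour is positively oriented; $\widehat P_n$ is well defined when no eigenvalue of $\widehat M_\psi$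 lies on $\mathcal{C}$, which holds with probability tending to $1$. *)

(* Defs.v *)
From HB Require Import structures.
From mathcomp Require Export all_boot all_order all_algebra.
From mathcomp Require Export complex.
From mathcomp Require Export all_classical all_reals all_analysis.
Export numFieldNormedType.Exports.

Set Implicit Arguments.
Unset Strict Implicit.
Unset Printing Implicit Defensive.

Import Order.TTheory GRing.Theory Num.Theory.

Local Open Scope classical_set_scope.
Local Open Scope ring_scope.

(* R^p with its Borel sigma-algebra; it is convertible to 'cV[R]_p. *)
Definition rvec (R : realType) (p : nat) :=
  g_sigma_algebraType (@open 'cV[R]_p).

Definition normsq (R : realType) (p : nat) (v : 'cV[R]_p) : R :=
  \sum_(i < p) v i ord0 ^+ 2.

Section LinearAlgebra.
Context {R : realType} {p : nat}.
Implicit Types (A P S : 'M[R]_p) (E : {vspace 'cV[R]_p}).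

Definition colspace A : {vspace 'cV[R]_p} :=
  <<[seq col j A | j <- enum 'I_p]>>%VS.

Definition orth_proj E P : Prop :=
  forall v : 'cV[R]_p, P *m v \in E /\
    forall w, w \in E -> w^T *m (v - P *m v) = 0.

(* S is the positive definite square root of the inverse of A. *)
Definition inv_sqrtmx A S : Prop :=
  [/\ S^T = S,
      forall v : 'cV[R]_p, v != 0 -> 0 < (v^T *m S *m v) ord0 ord0
    & S *m S = invmx A].

(* Inverse on the range of the projection P of an A leaving this range
   invariant, extended by 0 on the kernel: P A P + (1 - P) acts as A on the
   range and as the identity on the kernel. *)
Definition inv_on P A : 'M[R]_p := P *m invmx (P *m A *m P + (1%:M - P)).

End LinearAlgebra.

Section Probability.
Context {d : measure_display} {T : measurableType d} {R : realType}.
Variable P : probability T R.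

Definition integrable_mx m n (F : T -> 'M[R]_(m, n)) : Prop :=
  forall i j, P.-integrable setT (fun w => (F w i j)%:E).

Definition mean_mx m n (F : T -> 'M[R]_(m, n)) : 'M[R]_(m, n) :=
  \matrix_(i, j) fine 'E_P[fun w => F w i j]%E.

Definition cov_mx p (X : T -> 'cV[R]_p) : 'M[R]_p :=
  \matrix_(i, j) fine (covariance P (fun w => X w i ord0)
                                    (fun w => X w j ord0)).

(* g is a version of E[f | G], G being a sub-sigma-algebra. *)
Definition is_cond_exp (G : set (set T)) (f g : T -> R) : Prop :=
  [/\ P.-integrable setT (fun w => (f w)%:E),
      P.-integrable setT (fun w => (g w)%:E),
      forall B : set R, measurable B -> G (g @^-1` B)
    & forall A, G A ->
        (\int[P]_(w in A) (f w)%:E = \int[P]_(w in A) (g w)%:E)%E].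

Definition is_cond_exp_mx (G : set (set T)) m n (F H : T -> 'M[R]_(m, n)) :=
  forall i j, is_cond_exp G (fun w => F w i j) (fun w => H w i j).

(* V is a version of var(Z | G). *)
Definition is_cond_var (G : set (set T)) p
    (Z : T -> 'cV[R]_p) (V : T -> 'M[R]_p) : Prop :=
  exists m : T -> 'cV[R]_p, is_cond_exp_mx G Z m /\
    is_cond_exp_mx G (fun w => (Z w - m w) *m (Z w - m w)^T) V.

Definition sigma_of p (U : T -> 'cV[R]_p) : set (set T) :=
  g_sigma_algebra_preimage (U : T -> rvec R p).

Definition cond_indep (G : set (set T)) p
    (Y : T -> R) (Z : T -> 'cV[R]_p) : Prop :=
  forall (A : set R) (B : set (rvec R p)), measurable A -> measurable B ->
  exists gA gB : T -> R,
    [/\ is_cond_exp G (\1_(Y @^-1` A)) gA,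
        is_cond_exp G (\1_(Z @^-1` B)) gB
      & is_cond_exp G (\1_(Y @^-1` A `&` Z @^-1` B)) (gA \* gB)].

Definition is_DRS p (Y : T -> R) (Z : T -> 'cV[R]_p)
    (E : {vspace 'cV[R]_p}) : Prop :=
  exists Q, orth_proj E Q /\
    cond_indep (sigma_of (fun w => Q *m Z w)) Y Z.

Definition is_central_subspace p (Y : T -> R) (Z : T -> 'cV[R]_p)
    (Ec : {vspace 'cV[R]_p}) : Prop :=
  [/\ is_DRS Y Z Ec,
      forall E, is_DRS Y Z E -> (\dim Ec <= \dim E)%N,
      forall E, is_DRS Y Z E -> \dim E = \dim Ec -> E = Ec
    & forall v, (v \in Ec) <-> (forall E, is_DRS Y Z E -> v \in E)].

Definition linearity_condition p (Pc : 'M[R]_p) (Z : T -> 'cV[R]_p) : Prop :=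
  exists m : T -> 'cV[R]_p,
    is_cond_exp_mx (sigma_of (fun w => Pc *m Z w)) Z m /\
    {ae P, forall w, (1%:M - Pc) *m m w = 0}.

Definition diagonal_cond_var p (Pc : 'M[R]_p) (Z : T -> 'cV[R]_p) : Prop :=
  exists (V : T -> 'M[R]_p) (lam : T -> R),
    [/\ is_cond_var (sigma_of (fun w => Pc *m Z w)) Z V,
        measurable_fun setT lam
      & {ae P, forall w, V w = lam w *: (1%:M - Pc)}].

(* Lebesgue measure on R^p is the only Borel measure satisfying this. *)
Definition is_lebesgue p (leb : {measure set (rvec R p) -> \bar R}) : Prop :=
  forall a b : 'cV[R]_p, (forall i, a i ord0 <= b i ord0) ->
  leb [set x : 'cV[R]_p | forall i, a i ord0 <= x i ord0 <= b i ord0]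
    = (\prod_(i < p) (b i ord0 - a i ord0))%:E.

(* A density is only defined up to null sets, so its support is taken to be
   that of the law it defines: the smallest closed set of full probability.
   (The closure of {f <> 0} depends on the version f; f can always be altered
   on a countable dense set to make this closure all of R^p.) *)
Definition law_support p (X : T -> 'cV[R]_p) : set 'cV[R]_p :=
  [set x | forall U, open U -> U x -> (0 < P (X @^-1` U))%E].

Definition density_null_boundary p (X : T -> 'cV[R]_p) : Prop :=
  exists leb : {measure set (rvec R p) -> \bar R}, is_lebesgue leb /\
  (exists f : rvec R p -> R,
    [/\ measurable_fun setT f, forall x, 0 <= f x
      & forall A : set (rvec R p), measurable A ->
          (P (X @^-1` A) = \int[leb]_(x in A) (f x)%:E)%E]) /\
  leb (closure (law_support X) `\` (law_support X)°) = 0%E.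

Definition iid_copies d' (U : measurableType d') (V : T -> U)
    (Vs : nat -> T -> U) : Prop :=
  [/\ forall i, measurable_fun setT (Vs i),
      forall i A, measurable A -> P (Vs i @^-1` A) = P (V @^-1` A)
    & forall (s : seq nat) (A : nat -> set U), uniq s ->
        (forall i, measurable (A i)) ->
        P (\bigcap_(i in [set` s]) Vs i @^-1` A i)
          = (\prod_(i <- s) P (Vs i @^-1` A i))%E].

Definition cvg_in_law (U : nat -> T -> R) d' (T' : measurableType d')
    (P' : probability T' R) (W : T' -> R) : Prop :=
  forall f : R -> R, continuous f -> (exists M : R, forall x, `|f x| <= M) ->
    ('E_P[f \o U n] @[n --> \oo] --> 'E_P'[f \o W])%E.

End Probability.

(* Contours are parametrized by [0, 1]; real and imaginary parts are handled
   separately since R[i] is not a normed module over R in the library. *)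
Section Contour.
Context {R : realType}.
Local Open Scope complex_scope.
Implicit Types (gamma : R -> R[i]) (z : R[i]).

Definition C1_on (a b : R) (f : R -> R) : Prop :=
  exists g : R -> R, [/\ forall t, derivable g t 1,
    continuous (derive1 g) & forall t, a <= t <= b -> f t = g t].

Definition piecewise_C1 gamma : Prop :=
  exists s : seq R, [/\ path <%R 0 s, last 0 s = 1
    & forall k, (k < size s)%N ->
      let a := nth 0 (0 :: s) k in let b := nth 0 s k in
      C1_on a b (fun t => complex.Re (gamma t)) /\
      C1_on a b (fun t => complex.Im (gamma t))].

(* The values of the derivative at the finitely many break points do not
   matter in the integral. *)
Definition velocity gamma (t : R) : R[i] :=
  derive1 (fun t => complex.Re (gamma t)) t +i*
  derive1 (fun t => complex.Im (gamma t)) t.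

Definition contour_integral gamma (f : R[i] -> R[i]) : R[i] :=
  let h := fun t => f (gamma t) * velocity gamma t in
  (\int[@lebesgue_measure R]_(t in `[0, 1]) complex.Re (h t)) +i*
  (\int[@lebesgue_measure R]_(t in `[0, 1]) complex.Im (h t)).

Definition on_contour gamma z : Prop :=
  exists2 t : R, 0 <= t <= 1 & gamma t = z.

Definition two_pi_i : R[i] := 0 +i* (2 * pi).

Definition winding gamma z : R[i] :=
  two_pi_i^-1 * contour_integral gamma (fun w => (w - z)^-1).

Definition encloses gamma z : Prop :=
  ~ on_contour gamma z /\ winding gamma z = 1.

Definition leaves_outside gamma z : Prop :=
  ~ on_contour gamma z /\ winding gamma z = 0.

(* A closed piecewise C1 curve having an interior (points of winding number 1)
   and an exterior (points of winding number 0); this includes all positively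
   oriented piecewise C1 Jordan curves. *)
Definition positive_contour gamma : Prop :=
  [/\ piecewise_C1 gamma, gamma 0 = gamma 1
    & forall z, ~ on_contour gamma z ->
        encloses gamma z \/ leaves_outside gamma z].

Definition cmx m n (M : 'M[R]_(m, n)) : 'M[R[i]]_(m, n) :=
  map_mx (real_complex R) M.

(* (2 i pi)^-1 * contour integral of (z I - M)^-1, entrywise; set to 0 when
   an eigenvalue of M lies on the contour, where the integral is undefined.
   For a symmetric M the result has real entries (a sum of real spectral
   projections), whence the harmless real parts taken of its traces. *)
Definition riesz_proj p gamma (M : 'M[R]_p) : 'M[R[i]]_p :=
  if `[< exists2 z, on_contour gamma z & eigenvalue (cmx M) z >] then 0
  else two_pi_i^-1 *:
    \matrix_(i, j) contour_integral gamma
                     (fun z => invmx (z%:M - cmx M) i j).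

End Contour.

(* Main.v *)
(* Write N = M - lam, D = Mhat - M, and G for the inverse of N on E_c extended by
   0 on the orthogonal of E_c. Diagonalizing the symmetric matrix Mhat shows that
   Phat is the spectral projection on the eigenvalues inside the contour; if Ghat
   denotes the inverse of Mhat - lam on the range of Phat, then multiplying
   (N + D) Ghat = Phat by Q_c, which kills N, gives Q_c Phat = Q_c D Ghat, whence
     tr (Q_c Phat) = || Q_c D Ghat ||^2,  Ghat - G = O(D).
   By the law of large numbers D tends to 0 in L^1, while n E || Q_c D ||^2 is
   bounded: so n tr (Q_c Phat) is close in probability to V_n = n || Q_c D G ||^2.
   The entries of Q_c D G are means of n i.i.d. centered square integrable
   variables, so E V_n does not depend on n (for n > 0) and is the trace of the
   statement. No central limit theorem is needed: (V_n) is uniformly integrable, hence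
   the expectation of its limit in law is this constant. *)
Require Import Defs.
From mathcomp Require Import ring lra measurable_realfun.

Set Implicit Arguments.
Unset Strict Implicit.
Unset Printing Implicit Defensive.

Import Order.TTheory GRing.Theory Num.Theory.

Local Open Scope classical_set_scope.
Local Open Scope ring_scope.
Local Open Scope complex_scope.

(** * The spectral theorem for real symmetric matrices *)

Section SymmetricMatrices.
Context {R : realType}.

(** Three obstacles shape the proof. The expansion of the trace holds only where [Mhat] is close to
    [M]; elsewhere an eigenvalue may cross the contour and the expansion says nothing. The variables
    U_n of the statement are therefore compared with V_n through min (|U_n - V_n|, K), and only
    bounded test functions see them. Second, the moment assumption carries the factor |Qc Z|^2 and
    bounds no fourth moment of Z: n E |D|^2 may be infinite, so the error of the expansion has to be
    measured by |Qc D|^2, while D itself is controlled in L^1 only. Third, the uniform integrability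
    of V_n must come from second moments alone: the summands are truncated, the bounded part having
    normalized sums with fourth moments bounded in n, through exponential moments, and the rest a
    small variance. On the analytic side, symmetry turns the contour integral into a finite sum of
    rank one projections weighted by winding numbers, so that the only complex analysis left is that
    winding numbers do not jump away from the contour. *)

Lemma row_mul_tr_eq0 n (v : 'rV[R]_n) : v *m v^T = 0 -> v = 0.
Proof.
move=> /matrixP /(_ 0 0); rewrite !mxE => /eqP.
rewrite psumr_eq0; last by move=> i _; rewrite mxE -expr2 sqr_ge0.
move=> /allP v0; apply/rowP => i; have := v0 i (mem_index_enum i).
by rewrite !mxE mulf_eq0 orbb => /eqP.
Qed.

Lemma cmx_eigenvalue n (A : 'M[R]_n) (x : R) :
  eigenvalue (cmx A) x%:C = eigenvalue A x.
Proof. by rewrite !eigenvalue_root_char /cmx -map_char_poly fmorph_root. Qed.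

(** Complexified, the matrix is hermitian, hence unitarily diagonalizable with a real diagonal; a
    real eigenvalue passes back to [A] because both matrices have the same characteristic
    polynomial. *)
Lemma symmetric_eigenvalue n (A : 'M[R]_n.+1) :
  A^T = A -> exists a, eigenvalue A a.
Proof.
move=> Asym; pose B := cmx A.
have Bh : B \is hermsymmx.
  apply: realsym_hermsym.
    apply/is_hermitianmxP; rewrite expr0 scale1r map_mx_id //.
    by apply/matrixP => i j; rewrite !mxE -[in LHS]Asym mxE.
  by apply/mxOverP => i j; rewrite mxE complex_real.
have /mxOverP/(_ 0 0)/complex_realP[a sa] := hermitian_spectral_diag_real Bh.
have /orthomx_spectralP := hermitian_normalmx Bh.
set Q := spectralmx B; have Qu : Q \in unitmx := spectral_unit B.
move=> /(congr1 (mulmx Q)); rewrite !mulmxA mulmxV // mul1mx => QB.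
exists a; rewrite -cmx_eigenvalue; apply/eigenvalueP; exists (row 0 Q).
  by rewrite -row_mul QB -sa row_mul row_diag_mx -scalemxAl -rowE.
apply/eqP => /(congr1 (mulmx^~ (invmx Q))).
rewrite -row_mul mulmxV // mul0mx => /rowP /(_ 0).
by rewrite !mxE eqxx => /eqP; rewrite oner_eq0.
Qed.

(* The Householder reflection exchanging e_0 and v. *)
Lemma householder n (v : 'rV[R]_n.+1) : v *m v^T = 1%:M ->
  exists H : 'M[R]_n.+1, [/\ H^T = H, H *m H = 1%:M & row 0 H = v].
Proof.
move=> vv; pose e : 'rV[R]_n.+1 := delta_mx 0 0.
have [ve|vne] := eqVneq v e.
  by exists 1%:M; rewrite trmx1 mulmx1 row1 ve.
pose w := e - v; pose c := 1 - v 0 0.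
have ev : e *m v^T = (v 0 0)%:M.
  by apply/matrixP => i j; rewrite !ord1 -rowE !mxE.
have ve : v *m e^T = (v 0 0)%:M.
  by rewrite -[LHS]trmxK trmx_mul trmxK ev tr_scalar_mx.
have ee : e *m e^T = 1%:M.
  by rewrite -rowE; apply/matrixP => i j; rewrite !ord1 !mxE !eqxx.
have ww : w *m w^T = (2 * c)%:M.
  rewrite /w linearB /= mulmxBl !mulmxBr ee vv ev ve -!raddfB /=.
  by congr (_%:M); rewrite /c; ring.
have c0 : c != 0.
  apply: contra vne => /eqP c0; rewrite eq_sym -subr_eq0 -/w; apply/eqP.
  by apply: row_mul_tr_eq0; rewrite ww c0 mulr0 raddf0.
have wT : w^T *m w *m (w^T *m w) = (2 * c) *: (w^T *m w).
  by rewrite -mulmxA [w *m _]mulmxA ww mul_scalar_mx scalemxAr.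
exists (1%:M - c^-1 *: (w^T *m w)); split.
- by rewrite linearB /= linearZ /= trmx_mul trmxK trmx1.
- move: (w^T *m w) wT => X wT.
  rewrite mulmxBl mul1mx mulmxBr mulmx1 -scalemxAl -scalemxAr wT !scalerA.
  have -> : c^-1 * c^-1 * (2 * c) = c^-1 + c^-1 by field.
  by rewrite scalerDl opprB addrK subrK.
- rewrite rowE mulmxBr mulmx1 -scalemxAr mulmxA -/e.
  have -> : e *m w^T = c%:M.
    by rewrite /w linearB /= mulmxBr ee ev /c raddfB.
  by rewrite mul_scalar_mx scalerA mulVf // scale1r /w opprB addrCA subrr addr0.
Qed.

(** Deflation: a reflection carries a unit eigenvector to the first basis vector, and symmetry then
    kills the rest of the first row and column, leaving a smaller symmetric block for the
    induction. *)
Lemma symmetric_spectral n (A : 'M[R]_n) : A^T = A ->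
  exists (U : 'M[R]_n) (m : 'rV[R]_n),
    [/\ U *m U^T = 1%:M, U^T *m U = 1%:M & A = U^T *m diag_mx m *m U].
Proof.
elim: n A => [|n IH] A Asym.
  by exists 1%:M, 0; split; apply/matrixP => -[].
have [a /eigenvalueP[v0 vA v00]] := symmetric_eigenvalue Asym.
pose s := \sum_j v0 0 j ^+ 2.
have s0 : 0 < s.
  rewrite lt_neqAle sumr_ge0 ?andbT; last by move=> j _; exact: sqr_ge0.
  apply: contraNneq v00 => s0; apply/eqP/row_mul_tr_eq0.
  apply/matrixP => i j; rewrite !ord1 !mxE [RHS]s0.
  by apply: eq_bigr => k _; rewrite mxE expr2.
pose v := (Num.sqrt s)^-1 *: v0.
have vv : v *m v^T = 1%:M.
  rewrite /v linearZ /= -scalemxAl -scalemxAr scalerA -expr2 exprVn.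
  rewrite sqr_sqrtr ?ltW //; apply/matrixP => i j; rewrite !ord1 !mxE eqxx.
  rewrite (_ : \sum_k _ = s) ?mulVf ?gt_eqF //.
  by apply: eq_bigr => k _; rewrite mxE expr2.
have {vA} vA : v *m A = a *: v by rewrite -scalemxAl vA scalerA mulrC -scalerA.
have [H [Hsym HH rH]] := householder vv.
(* The size is written [1 + n] so that the block decomposition applies to [B]. *)
have [B BE] : exists B : 'M[R]_(1 + n), B = H *m A *m H by eexists.
have Bsym : B^T = B by rewrite BE !trmx_mul Asym Hsym mulmxA.
have rB : row 0 B = a *: row 0 1%:M.
  by rewrite BE !row_mul rH vA -scalemxAl -rH -row_mul HH.
have Bur : ursubmx B = 0.
  apply/matrixP => i j; rewrite !ord1 !mxE.
  have /rowP /(_ (rshift 1 j)) := rB; rewrite !mxE /=.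
  by rewrite mulr0 => <-; congr (B _ _); apply: val_inj.
have Bul : ulsubmx B = a%:M.
  apply/matrixP => i j; rewrite !ord1 !mxE.
  have /rowP /(_ 0) := rB; rewrite !mxE /= mulr1n mulr1 => <-.
  by congr (B _ _); apply: val_inj.
have Bdl : dlsubmx B = 0.
  by rewrite -Bsym -trmx_ursub Bur trmx0.
have Bdrs : (drsubmx B)^T = drsubmx B by rewrite trmx_drsub Bsym.
have [V [m [VVt VtV Bdr]]] := IH _ Bdrs.
pose W : 'M[R]_(1 + n) := block_mx 1%:M 0 0 V.
have WT : W^T = block_mx 1%:M 0 0 V^T.
  by rewrite tr_block_mx trmx1 !trmx0.
have WWt : W *m W^T = 1%:M.
  rewrite WT mulmx_block !mul0mx !mulmx0 !addr0 !add0r VVt mulmx1.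
  by rewrite -scalar_mx_block.
have WtW : W^T *m W = 1%:M.
  rewrite WT mulmx_block !mul0mx !mulmx0 !addr0 !add0r VtV mulmx1.
  by rewrite -scalar_mx_block.
have BW : B = W^T *m diag_mx (row_mx a%:M m) *m W.
  rewrite -[LHS]submxK Bur Bul Bdl Bdr diag_mx_row WT !mulmx_block.
  rewrite !mul0mx !mulmx0 !addr0 !add0r !mul1mx !mul0mx !mulmx1.
  by congr block_mx; apply/matrixP => i j; rewrite !ord1 !mxE eqxx.
have AB : A = H *m B *m H.
  by rewrite BE !mulmxA HH mul1mx -mulmxA HH mulmx1.
move: {WT} W WWt WtW BW => W WWt WtW BW.
exists (W *m H), (row_mx a%:M m); split.
- by rewrite trmx_mul Hsym mulmxA -[W *m H *m H]mulmxA HH mulmx1.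
- by rewrite trmx_mul Hsym mulmxA -[H *m _ *m W]mulmxA WtW mulmx1.
- by rewrite AB BW trmx_mul Hsym !mulmxA.
Qed.

End SymmetricMatrices.

(** * Perturbation of spectral projections *)

Section EntrywiseNorm.
Context {R : realType}.

(** This norm is submultiplicative, invariant under transposition and bounds the trace, which is all
    that the perturbation estimates use; their constants need not be sharp. *)
Definition norm1 m n (A : 'M[R]_(m, n)) : R := \sum_i \sum_j `|A i j|.

Lemma norm1_ge0 m n (A : 'M[R]_(m, n)) : 0 <= norm1 A.
Proof. by apply: sumr_ge0 => i _; apply: sumr_ge0. Qed.

Lemma norm1D m n (A B : 'M[R]_(m, n)) : norm1 (A + B) <= norm1 A + norm1 B.
Proof.
rewrite /norm1 -big_split /=; apply: ler_sum => i _.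
rewrite -big_split /=; apply: ler_sum => j _.
by rewrite mxE ler_normD.
Qed.

Lemma norm1N m n (A : 'M[R]_(m, n)) : norm1 (- A) = norm1 A.
Proof. by apply: eq_bigr => i _; apply: eq_bigr => j _; rewrite mxE normrN. Qed.

Lemma norm1B m n (A B : 'M[R]_(m, n)) : norm1 (A - B) <= norm1 A + norm1 B.
Proof. by rewrite (le_trans (norm1D _ _)) // norm1N. Qed.

Lemma norm1_tr m n (A : 'M[R]_(m, n)) : norm1 A^T = norm1 A.
Proof.
rewrite /norm1 exchange_big /=; apply: eq_bigr => i _.
by apply: eq_bigr => j _; rewrite mxE.
Qed.

Lemma norm1_row m n (A : 'M[R]_(m, n)) i : \sum_j `|A i j| <= norm1 A.
Proof.
rewrite /norm1 (bigD1 i) //= lerDl.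
by apply: sumr_ge0 => k _; apply: sumr_ge0.
Qed.

Lemma norm1_entry m n (A : 'M[R]_(m, n)) i j : `|A i j| <= norm1 A.
Proof.
apply: le_trans (norm1_row A i).
by rewrite (bigD1 j) //= lerDl sumr_ge0.
Qed.

Lemma norm1M m n k (A : 'M[R]_(m, n)) (B : 'M[R]_(n, k)) :
  norm1 (A *m B) <= norm1 A * norm1 B.
Proof.
rewrite /norm1 mulr_suml; apply: ler_sum => i _.
apply: (@le_trans _ _ (\sum_j \sum_l `|A i l| * `|B l j|)).
  apply: ler_sum => j _; rewrite mxE (le_trans (ler_norm_sum _ _ _)) //.
  by apply: ler_sum => l _; rewrite normrM.
rewrite exchange_big /= mulr_suml; apply: ler_sum => l _.
by rewrite -mulr_sumr ler_wpM2l // (norm1_row B l).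
Qed.

Lemma norm1M_le m n k (A : 'M[R]_(m, n)) (B : 'M[R]_(n, k)) a b :
  norm1 A <= a -> norm1 B <= b -> norm1 (A *m B) <= a * b.
Proof. by move=> Aa Bb; rewrite (le_trans (norm1M _ _)) // ler_pM ?norm1_ge0. Qed.

Lemma norm1_gt0 m n (A : 'M[R]_(m, n)) : A != 0 -> 0 < norm1 A.
Proof.
move=> A0; rewrite lt_neqAle norm1_ge0 andbT; apply: contra A0 => /eqP A0.
apply/eqP/matrixP => i j; rewrite mxE; apply/eqP; rewrite -normr_le0 [leRHS]A0.
exact: norm1_entry.
Qed.

Lemma mxtrace_norm1 n (A : 'M[R]_n) : `|\tr A| <= norm1 A.
Proof.
rewrite /mxtrace (le_trans (ler_norm_sum _ _ _)) //.
by apply: ler_sum => i _; rewrite (bigD1 i) //= lerDl sumr_ge0.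
Qed.

Lemma norm1_diag n (d : 'rV[R]_n) : norm1 (diag_mx d) = norm1 d.
Proof.
rewrite [RHS]/norm1 big_ord1; apply: eq_bigr => i _.
rewrite (bigD1 i) //= mxE eqxx mulr1n big1 ?addr0 // => j ji.
by rewrite mxE eq_sym (negbTE ji) normr0.
Qed.

Lemma norm1_diag_le n (d : 'rV[R]_n) b : (forall i, `|d 0 i| <= b) ->
  norm1 (diag_mx d) <= n%:R * b.
Proof.
move=> db; rewrite norm1_diag /norm1 big_ord1.
rewrite (le_trans (ler_sum _ (fun i _ => db i))) //.
by rewrite sumr_const card_ord mulr_natl.
Qed.

Lemma norm1_orth n (U : 'M[R]_n) : U *m U^T = 1%:M -> norm1 U <= n%:R * n%:R.
Proof.
move=> UU; rewrite /norm1.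
have Ule i j : `|U i j| <= 1.
  rewrite -(ler_pXn2r (n := 2)) ?nnegrE // expr1n real_normK ?num_real //.
  have /matrixP /(_ i i) := UU; rewrite !mxE eqxx mulr1n => <-.
  rewrite (bigD1 j) //= mxE -expr2 lerDl sumr_ge0 // => k _.
  by rewrite mxE -expr2 sqr_ge0.
rewrite (le_trans (ler_sum _ (fun i _ => ler_sum _ (fun j _ => Ule i j)))) //.
by rewrite !sumr_const !card_ord mulr_natr.
Qed.

(** The power 5 collects [n ^ 2] for each orthogonal factor, whose entries are at most 1, and [n]
    for the diagonal one; what matters is a constant free of [U]. *)
Lemma norm1_conj_diag n (U : 'M[R]_n) (d : 'rV[R]_n) b : U *m U^T = 1%:M ->
  (forall i, `|d 0 i| <= b) ->
  norm1 (U^T *m diag_mx d *m U) <= n%:R ^+ 5 * b.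
Proof.
move=> UU db; have Un := norm1_orth UU.
have Utn : norm1 U^T <= n%:R * n%:R by rewrite norm1_tr.
have := norm1M_le (norm1M_le Utn (norm1_diag_le db)) Un.
by rewrite [X in _ <= X](_ : _ = n%:R ^+ 5 * b) //; ring.
Qed.

End EntrywiseNorm.

Section Perturbation.
Context {R : realType} {p : nat}.
Implicit Types (U V M : 'M[R]_p).

(** A Bauer-Fike bound. Let [w] be the eigenvector [u] of [M'] written in the eigenbasis of [M]: the
    coordinates of [u (M - M') V^T] are [w_j (mu_j - m_k)], and if every gap exceeded the bound,
    this vector would be longer than its norm estimate allows. *)
Lemma eigenvalue_perturbation M M' V U (mu m : 'rV[R]_p) :
  V *m V^T = 1%:M -> V^T *m V = 1%:M -> M = V^T *m diag_mx mu *m V ->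
  U *m U^T = 1%:M -> M' = U^T *m diag_mx m *m U ->
  forall k, exists j, `|mu 0 j - m 0 k| <= norm1 V * norm1 V * norm1 (M' - M).
Proof.
move=> VV VtV ME UU M'E k; set c := (_ * norm1 (M' - M)).
pose u := row k U.
have u0 : u != 0.
  apply/eqP => u0; have /rowP /(_ k) : row k 1%:M = 0 :> 'rV[R]_p.
    by rewrite -UU row_mul -/u u0 mul0mx.
  by rewrite !mxE eqxx => /eqP; rewrite oner_eq0.
have uM' : u *m M' = m 0 k *: u.
  rewrite M'E !mulmxA -row_mul UU -row_mul mul1mx.
  by rewrite row_diag_mx -scalemxAl -rowE.
pose w := u *m V^T.
have uw : u = w *m V by rewrite -mulmxA VtV mulmx1.
have w0 : 0 < norm1 w.
  by apply: norm1_gt0; apply: contra u0 => /eqP w0; rewrite uw w0 mul0mx.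
pose y := u *m (M - M') *m V^T.
have yE j : y 0 j = w 0 j * (mu 0 j - m 0 k).
  rewrite /y mulmxBr uM' mulmxBl -scalemxAl -/w ME !mulmxA.
  rewrite -[_ *m V *m V^T]mulmxA VV mulmx1 -/w mul_mx_diag.
  by move: (w) => z; rewrite !mxE; ring.
have yn : norm1 y <= norm1 w * c.
  have := norm1M_le (norm1M_le (norm1M w V) (lexx (norm1 (M - M'))))
                    (lexx (norm1 V^T)).
  rewrite -uw -/y norm1_tr -(norm1N (M - M')) opprB => /le_trans; apply.
  by rewrite le_eqVlt /c; apply/orP; left; apply/eqP; ring.
apply: contrapT => /forallNP far.
have {}far j : c < `|mu 0 j - m 0 k| by rewrite ltNge; apply/negP/far.
have : norm1 y > norm1 w * c.
  rewrite /norm1 !big_ord1 mulr_suml.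
  (* A nonzero coordinate of [w] makes the comparison of the two sums strict. *)
  have [j wj] : exists j, w 0 j != 0.
    apply: contrapT => /forallNP wj; have : norm1 w = 0.
      rewrite /norm1 big_ord1 big1 // => j _.
      by have /negP := wj j; rewrite negbK => /eqP ->; rewrite normr0.
    by move=> wn; rewrite wn ltxx in w0.
  rewrite (bigD1 j) //= [ltRHS](bigD1 j) //= ltr_leD //.
    by rewrite yE normrM ltr_pM2l ?normr_gt0.
  by apply: ler_sum => i _; rewrite yE normrM ler_wpM2l // ltW.
by rewrite ltNge yn.
Qed.

Variables (Pc N G : 'M[R]_p).
Let Qc := 1%:M - Pc.
Hypotheses (Gsym : G^T = G) (Qsym : Qc^T = Qc) (QQ : Qc *m Qc = Qc).
Hypotheses (GN : G *m N = Pc) (GPc : G *m Pc = G) (QN : Qc *m N = 0).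

Section Resolvent.
Variables (D P' G' : 'M[R]_p).
Hypotheses (Dsym : D^T = D) (G'sym : G'^T = G') (P'sym : P'^T = P').
Hypotheses (NG' : (N + D) *m G' = P').
Hypotheses (P'P' : P' *m P' = P') (P'G' : P' *m G' = G').

(* Qc kills N, so multiplying (N + D) G' = P' by Qc gives Qc P' = Qc D G': the
   trace is of second order in D. *)
Lemma mxtrace_spectral_projection :
  \tr (Qc *m P') = \tr (Qc *m D *m (G' *m G') *m (D *m Qc)).
Proof.
have QP : Qc *m P' = Qc *m D *m G'.
  by rewrite -NG' mulmxA mulmxDr QN add0r.
have PQ : P' *m Qc = G' *m (D *m Qc).
  have /(congr1 trmx) := QP.
  by rewrite !trmx_mul P'sym G'sym Dsym Qsym.
have -> : \tr (Qc *m P') = \tr (Qc *m P' *m (P' *m Qc)).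
  by rewrite mulmxA -[Qc *m P' *m P']mulmxA P'P' [RHS]mxtrace_mulC mulmxA QQ.
by rewrite QP PQ !mulmxA.
Qed.

(** Each term on the right has a small factor, [D] or [(N + D) (1 - P')], the latter seeing, in the
    application, only the eigenvalues of [N + D] near 0. The identity comes from
    [G' = Pc G' + Qc G'], with [Pc = G N] in the first part and [G' = P' G' = (N + D) G' G'] in the
    second; eigenvectors of the two matrices are never matched. *)
Lemma reduced_resolvent_sub : G' - G =
  - (G *m G *m ((N + D) *m (1%:M - P'))) + G *m G *m (D *m (1%:M - P'))
  - G *m D *m G' + Qc *m D *m G' *m G'.
Proof.
have PG : Pc *m G' = G *m P' - G *m D *m G'.
  by rewrite -GN -NG' mulmxDl !mulmxDr !mulmxA addrK.
have GP : G *m P' = G - G *m G *m ((N + D) *m (1%:M - P'))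
                     + G *m G *m (D *m (1%:M - P')).
  rewrite [(N + D) *m _]mulmxDl mulmxDr opprD addrA subrK.
  rewrite mulmxA -[G *m G *m N]mulmxA GN GPc mulmxBr mulmx1.
  by rewrite opprB addrC subrK.
have QG : Qc *m G' = Qc *m D *m G' *m G'.
  by rewrite -{1}P'G' -NG' !mulmxA mulmxDr QN add0r.
have {1}-> : G' = Pc *m G' + Qc *m G' by rewrite -mulmxDl addrC subrK mul1mx.
by rewrite PG GP QG; apply/eqP; rewrite subr_eq [eqbRHS]addrC !addrA.
Qed.

End Resolvent.
Lemma reduced_resolvent_bound (D P' G' : 'M[R]_p) b e :
    (N + D) *m G' = P' -> P' *m G' = G' ->
    norm1 G' <= b -> norm1 (1%:M - P') <= b ->
    norm1 ((N + D) *m (1%:M - P')) <= b * e -> norm1 D <= e ->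
  norm1 (G' - G) <=
    (2 * (norm1 G * norm1 G * b) + norm1 G * b + norm1 Qc * b * b) * e.
Proof.
move=> NG' P'G' G'b P'b Nb De; rewrite (reduced_resolvent_sub NG' P'G').
have GG := norm1M G G.
have h1 := norm1M_le GG Nb.
have h2 := norm1M_le GG (norm1M_le De P'b).
have h3 := norm1M_le (norm1M_le (lexx (norm1 G)) De) G'b.
have h4 := norm1M_le (norm1M_le (norm1M_le (lexx (norm1 Qc)) De) G'b) G'b.
apply: le_trans (norm1D _ _) _; apply: le_trans (lerD (norm1B _ _) h4) _.
apply: le_trans (lerD (lerD (norm1D _ _) h3) (lexx _)) _.
apply: le_trans (lerD (lerD (lerD _ h2) (lexx _)) (lexx _)) _.
  by rewrite norm1N; exact: h1.
by rewrite le_eqVlt; apply/orP; left; apply/eqP; ring.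
Qed.

End Perturbation.

(** * Functional calculus in an orthonormal eigenbasis *)

Section DiagonalCalculus.
Context {R : realType} {p : nat}.
Variable U : 'M[R]_p.
Hypotheses (UUt : U *m U^T = 1%:M) (UtU : U^T *m U = 1%:M).

(** The rows of [U] being orthonormal eigenvectors, identities between functions of one symmetric
    matrix become pointwise identities in the index [k]. *)
Definition conj_diag (f : 'I_p -> R) : 'M[R]_p :=
  U^T *m diag_mx (\row_k f k) *m U.

Lemma conj_diagM f g : conj_diag f *m conj_diag g = conj_diag (fun k => f k * g k).
Proof.
rewrite /conj_diag !mulmxA -[_ *m U *m U^T]mulmxA UUt mulmx1.
rewrite -[_ *m diag_mx _ *m diag_mx _]mulmxA mulmx_diag.
by congr (_ *m diag_mx _ *m _); apply/rowP => k; rewrite !mxE.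
Qed.

Lemma conj_diag_cst c : conj_diag (fun=> c) = c%:M.
Proof.
rewrite /conj_diag (_ : diag_mx _ = c%:M).
  by rewrite mul_mx_scalar -scalemxAl UtU scalemx1.
by apply/matrixP => i j; rewrite !mxE.
Qed.

Lemma conj_diagB f g : conj_diag f - conj_diag g = conj_diag (fun k => f k - g k).
Proof.
rewrite /conj_diag -mulmxBl -mulmxBr -raddfB /=.
by congr (_ *m diag_mx _ *m _); apply/rowP => k; rewrite !mxE.
Qed.

Lemma conj_diag_tr f : (conj_diag f)^T = conj_diag f.
Proof. by rewrite /conj_diag !trmx_mul trmxK tr_diag_mx mulmxA. Qed.

Lemma conj_diag_norm1 f b : (forall k, `|f k| <= b) ->
  norm1 (conj_diag f) <= p%:R ^+ 5 * b.
Proof. by move=> fb; apply: norm1_conj_diag => // k; rewrite mxE. Qed.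

End DiagonalCalculus.

(** [inside] stands for enclosure by the contour, which matters only near the spectrum of [M]. The
    error is relative to the square of [Qc (M' - M)], not of [M' - M]: this is possible because [Qc]
    stands at both ends of the exact trace formula. The localization of the eigenvalues is returned
    too, to keep them off the contour. *)
Lemma spectral_projection_expansion (R : realType) (p : nat)
    (M V Pc G : 'M[R]_p) (mu : 'rV[R]_p) (lam r : R) (inside : R -> Prop) :
  let Qc := 1%:M - Pc in let N := M - lam%:M in
  V *m V^T = 1%:M -> V^T *m V = 1%:M -> M = V^T *m diag_mx mu *m V ->
  G^T = G -> Qc^T = Qc -> Qc *m Qc = Qc -> G *m N = Pc -> G *m Pc = G ->
  Qc *m N = 0 -> 0 < r ->
  (forall j x, mu 0 j != lam -> `|x - mu 0 j| <= r -> inside x) ->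
  (forall x, `|x - lam| <= r -> ~ inside x) ->
  forall eta, 0 < eta -> exists delta, 0 < delta /\
  forall M' : 'M[R]_p, M'^T = M' -> norm1 (M' - M) <= delta ->
  exists (U : 'M[R]_p) (m : 'rV[R]_p),
  [/\ U *m U^T = 1%:M, U^T *m U = 1%:M, M' = U^T *m diag_mx m *m U,
      forall k, exists j, `|m 0 k - mu 0 j| <= r &
      `| \tr (Qc *m conj_diag U (fun k => if `[< inside (m 0 k) >] then 1 else 0))
         - \tr (Qc *m (M' - M) *m (G *m G) *m ((M' - M) *m Qc)) |
       <= eta * norm1 (Qc *m (M' - M)) ^+ 2].
Proof.
move=> Qc N VVt VtV ME Gsym Qsym QQ GN GPc QN r0 ins outs eta eta0.
set g := norm1 G; have g0 : 0 <= g := norm1_ge0 G.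
set c := norm1 V * norm1 V; have c0 : 0 <= c by rewrite mulr_ge0 ?norm1_ge0.
(* The three summands bound, in this order, the eigenvalues of [G'], those of [(N + D) (1 - P')]
   divided by [delta], and those of [1 - P']. *)
pose b := p%:R ^+ 5 * (r^-1 + c + 1).
have rc0 : 0 <= r^-1 + c + 1 by rewrite !addr_ge0 // invr_ge0 ltW.
have b0 : 0 <= b by rewrite mulr_ge0 // exprn_ge0.
set K := 2 * (g * g * b) + g * b + norm1 Qc * b * b.
have K0 : 0 <= K by rewrite !addr_ge0 // ?mulr_ge0 ?norm1_ge0.
have Kbg : 0 <= K * (b + g) := mulr_ge0 K0 (addr_ge0 b0 g0).
have Kbg0 : 0 < K * (b + g) + 1 by rewrite ltr_wpDl.
(* The first bound keeps the eigenvalues of [M'] within [r] of those of [M]; the second makes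
   [G' G' - G G] at most [eta]. *)
pose delta := Num.min (r / (c + 1)) (eta / (K * (b + g) + 1)).
have delta0 : 0 < delta by rewrite lt_min !divr_gt0 // ltr_wpDl.
have cdr : c * delta <= r.
  apply: (@le_trans _ _ (c * (r / (c + 1)))).
    by rewrite ler_wpM2l // ge_min lexx.
  by rewrite mulrCA ler_piMr ?(ltW r0) // ler_pdivrMr ?mul1r ?ltr_wpDl // lerDl.
have Kde : K * (b + g) * delta <= eta.
  apply: (@le_trans _ _ (K * (b + g) * (eta / (K * (b + g) + 1)))).
    by rewrite ler_wpM2l // ge_min lexx orbT.
  by rewrite mulrCA ler_piMr ?(ltW eta0) // ler_pdivrMr ?mul1r // lerDl.
exists delta; split => // M' M'sym M'd.
have [U [m [UUt UtU M'E]]] := symmetric_spectral M'sym.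
have loc k : exists j, `|m 0 k - mu 0 j| <= c * delta.
  have [j jk] := eigenvalue_perturbation VVt VtV ME UUt M'E k.
  by exists j; rewrite distrC (le_trans jk) // ler_wpM2l.
exists U, m; split => // [k|].
  by have [j jk] := loc k; exists j; rewrite (le_trans jk).
set iota := fun k => if _ then _ else _.
(* A spectral gap: an eigenvalue of [M'] close to some [mu_j] other than [lam] is inside, so one
   that is not inside lies within [c * delta] of [lam]. *)
have iotaP k : iota k = 1 /\ r < `|m 0 k - lam| \/
               iota k = 0 /\ `|m 0 k - lam| <= c * delta.
  rewrite /iota; case: asboolP => [im|nim]; [left|right]; split => //.
    by rewrite ltNge; apply/negP => /outs; apply.
  have [j jk] := loc k; have [<- //|mul] := eqVneq (mu 0 j) lam.
  by exfalso; apply: nim; apply: (ins j) => //; rewrite (le_trans jk).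
pose D := M' - M; pose P' := conj_diag U iota.
pose G' := conj_diag U (fun k => iota k / (m 0 k - lam)).
have ND : N + D = conj_diag U (fun k => m 0 k - lam).
  rewrite -conj_diagB conj_diag_cst // /N /D addrC addrA subrK M'E.
  by congr (_ *m diag_mx _ *m _ - _); apply/rowP => k; rewrite mxE.
have mlam k : iota k != 0 -> m 0 k - lam != 0.
  case: (iotaP k) => -[-> ml]; last by rewrite eqxx.
  by move=> _; rewrite -normr_gt0 (lt_trans r0).
have eqP' f : f =1 iota -> conj_diag U f = P'.
  by move=> fi; rewrite /P' /conj_diag; congr (_ *m diag_mx _ *m _);
     apply/rowP => k; rewrite !mxE fi.
have ii k : iota k * iota k = iota k.
  by case: (iotaP k) => -[-> _]; rewrite ?mulr1 ?mulr0.
have NG' : (N + D) *m G' = P'.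
  rewrite ND conj_diagM //; apply: eqP' => k; rewrite mulrC.
  have [->|/mlam ml0] := eqVneq (iota k) 0; first by rewrite !mul0r.
  by rewrite divfK.
have P'P' : P' *m P' = P' by rewrite conj_diagM //; exact: eqP'.
have P'G' : P' *m G' = G'.
  rewrite conj_diagM // /G' /conj_diag; congr (_ *m diag_mx _ *m _).
  by apply/rowP => k; rewrite !mxE mulrA ii.
have oP' : 1%:M - P' = conj_diag U (fun k => 1 - iota k).
  by rewrite -conj_diagB conj_diag_cst.
have p50 : (0 : R) <= p%:R ^+ 5 by rewrite exprn_ge0.
have G'b : norm1 G' <= b.
  rewrite /b; apply: conj_diag_norm1 => // k.
  case: (iotaP k) => -[-> ml]; last by rewrite mul0r normr0.
  rewrite mul1r normfV -addrA ler_wpDr //; first by rewrite addr_ge0.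
  by rewrite lef_pV2 ?posrE ?(ltW ml) // (lt_trans r0).
have P'b : norm1 (1%:M - P') <= b.
  rewrite oP' /b; apply: conj_diag_norm1 => // k.
  case: (iotaP k) => -[-> ml]; first by rewrite subrr normr0.
  by rewrite subr0 normr1 lerDr addr_ge0 // invr_ge0 ltW.
have Nb : norm1 ((N + D) *m (1%:M - P')) <= b * delta.
  rewrite oP' ND conj_diagM // /b -mulrA; apply: conj_diag_norm1 => // k.
  case: (iotaP k) => -[-> ml].
    by rewrite subrr mulr0 normr0 mulr_ge0 // ltW.
  rewrite subr0 mulr1 (le_trans ml) // ler_wpM2r ?(ltW delta0) //.
  by rewrite addrAC lerDr addr_ge0 // invr_ge0 ltW.
have G'G := reduced_resolvent_bound GN GPc QN NG' P'G' G'b P'b Nb M'd.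
rewrite -/g -/K in G'G.
have Dsym : D^T = D.
  have Msym : M^T = M by rewrite ME !trmx_mul trmxK tr_diag_mx mulmxA.
  by rewrite linearB /= M'sym Msym.
rewrite (mxtrace_spectral_projection Qsym QQ QN Dsym (conj_diag_tr _ _)
  (conj_diag_tr _ _) NG' P'P') -/D -/Qc.
rewrite -raddfB /= -mulmxBl -mulmxBr.
apply: le_trans (mxtrace_norm1 _) _.
have -> : D *m Qc = (Qc *m D)^T by rewrite trmx_mul Qsym Dsym.
set X := Qc *m D.
have GG : norm1 (G' *m G' - G *m G) <= eta.
  have -> : G' *m G' - G *m G = (G' - G) *m G' + G *m (G' - G).
    by rewrite mulmxBl mulmxBr addrA subrK.
  apply: le_trans (norm1D _ _) _.
  have := lerD (norm1M_le G'G G'b) (norm1M_le (lexx g) G'G).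
  by move/le_trans; apply; apply: le_trans Kde; rewrite le_eqVlt; apply/orP;
     left; apply/eqP; ring.
have := norm1M_le (norm1M_le (lexx (norm1 X)) GG) (lexx (norm1 X^T)).
move/le_trans; apply; rewrite norm1_tr.
by rewrite le_eqVlt; apply/orP; left; apply/eqP; ring.
Qed.

(** * Contours and winding numbers *)

Section PiecewiseC1.
Context {R : realType}.
Implicit Types (a b c x : R) (f g : R -> R).

(** Weaker than continuity on purpose: at a break point the derivative of the curve may take any
    value, yet boundedness and measurability survive gluing and give integrability. *)
Definition tame a b f : Prop := measurable_fun `[a, b] f /\
  exists B, forall t, a <= t <= b -> `|f t| <= B.

Lemma tame_cst a b k : tame a b (fun=> k).
Proof. by split; [exact: measurable_cst|exists `|k|]. Qed.

Lemma tameD a b f g : tame a b f -> tame a b g -> tame a b (fun t => f t + g t).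
Proof.
move=> [mf [Bf fB]] [mg [Bg gB]]; split; first exact: measurable_funD.
by exists (Bf + Bg) => t tab; rewrite (le_trans (ler_normD _ _)) // lerD ?fB ?gB.
Qed.

Lemma tameM a b f g : tame a b f -> tame a b g -> tame a b (fun t => f t * g t).
Proof.
move=> [mf [Bf fB]] [mg [Bg gB]]; split; first exact: measurable_funM.
by exists (Bf * Bg) => t tab; rewrite normrM ler_pM ?fB ?gB.
Qed.

Lemma tameN a b f : tame a b f -> tame a b (fun t => - f t).
Proof.
move=> [mf [Bf fB]]; split; first exact: measurableT_comp.
by exists Bf => t tab; rewrite normrN fB.
Qed.

Lemma tameV a b f rho : 0 < rho -> (forall t, a <= t <= b -> rho <= f t) ->
  tame a b f -> tame a b (fun t => (f t)^-1).
Proof.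
move=> rho0 frho [mf _]; split.
  (* As [f] is positive on the interval, its inverse is exp (- ln f), a composite of measurable
     functions. *)
  apply: (eq_measurable_fun (fun t => expR (- ln (f t)))).
    move=> t; rewrite inE /= in_itv /= => /frho ft.
    by rewrite expRN lnK // posrE (lt_le_trans rho0).
  apply: measurableT_comp => //; apply: measurableT_comp => //.
  exact: measurableT_comp.
exists rho^-1 => t /frho ft; have f0 := lt_le_trans rho0 ft.
by rewrite ger0_norm ?invr_ge0 ?(ltW f0) // lef_pV2 ?posrE.
Qed.

Lemma tame_cat a b c f : a <= b -> b <= c ->
  tame a b f -> tame b c f -> tame a c f.
Proof.
move=> ab bc [mf [Bf fB]] [mg [Bg gB]]; split.
  have -> : `[a, c]%classic = `[a, b] `|` `[b, c].
    apply/seteqP; split => t /=; rewrite !in_itv /=; last first.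
      by case=> /andP[h1 h2]; rewrite ?h1 ?h2 ?(le_trans h2) ?(le_trans _ h1).
    move=> /andP[-> ->]; rewrite andbT.
    by case: (leP t b) => [|/ltW]; [left|right].
  by apply/measurable_funU.
exists (Num.max Bf Bg) => t /andP[ta tc]; rewrite le_max.
by have [tb|/ltW bt] := leP t b; [rewrite fB ?ta|rewrite gB ?orbT ?bt].
Qed.

Lemma continuous_tame a b f g : a <= b -> continuous g ->
  (forall t, a <= t <= b -> f t = g t) -> tame a b f.
Proof.
move=> ab cg fg; split.
  apply: (eq_measurable_fun g).
    by move=> t; rewrite inE /= in_itv /= => /fg.
  apply: (@measurable_funS _ _ _ _ setT) => //.
  exact: continuous_measurable_fun.
have cng : {within `[a, b], continuous (fun t => `|g t|)}.
  apply: continuous_subspaceT => t.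
  by apply: (continuous_comp (cg t)); exact: norm_continuous.
have [c _ gc] := EVT_max ab cng.
by exists `|g c| => t tab; rewrite fg // gc // in_itv.
Qed.

Lemma C1_on_tame a b f : a < b -> C1_on a b f -> tame a b f /\ tame a b (derive1 f).
Proof.
move=> ab [g [dg cg' fg]]; split.
  apply: (continuous_tame (ltW ab) _ fg) => t.
  by apply: differentiable_continuous; apply/derivable1_diffP.
have fg' t : a < t < b -> derive1 f t = derive1 g t.
  move=> tab; rewrite !derive1E; apply: near_eq_derive.
  have : t \in `]a, b[ by rewrite in_itv.
  move/near_in_itvoo; apply: filterS => s; rewrite in_itv /= => /andP[sa sb].
  by rewrite fg // !ltW.
have [mg' [B gB]] : tame a b (derive1 g) by apply: (continuous_tame (ltW ab) cg').
split.
  (* The formula for the derivative holds in the open interval only; the endpoints do not affect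
     measurability, and their two values enter the bound through a maximum. *)
  apply/measurable_fun_itv_bndo_bndcP/measurable_fun_itv_obnd_cbndP.
  apply: (eq_measurable_fun (derive1 g)).
    by move=> t; rewrite inE /= in_itv /= => /fg'.
  apply: measurable_funS mg' => //.
  by apply: subset_itvW.
exists (Num.max B (Num.max `|derive1 f a| `|derive1 f b|)) => t /andP[].
rewrite !le_max le_eqVlt => /predU1P[<-|ta]; first by rewrite lexx orbT.
rewrite le_eqVlt => /predU1P[->|tb]; first by rewrite lexx !orbT.
by rewrite fg' ?ta // gB // !ltW.
Qed.

(** Carries facts from the pieces of a piecewise C1 curve to the whole of it; with [a] prepended to
    [s], the entries [k] of the two lists are the endpoints of piece [k]. *)
Lemma path_interval_ind (Phi : R -> R -> Prop) (a : R) (s : seq R) :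
  (0 < size s)%N -> path <%R a s ->
  (forall a b c, a < b -> b < c -> Phi a b -> Phi b c -> Phi a c) ->
  (forall k, (k < size s)%N -> nth 0 (a :: s) k < nth 0 s k ->
     Phi (nth 0 (a :: s) k) (nth 0 s k)) ->
  a < last a s /\ Phi a (last a s).
Proof.
move=> s0 ps Phicat; elim: s a s0 ps => // b s IH a _ /= /andP[ab ps] H.
have Pab : Phi a b by exact: (H 0%N).
case: s ps IH H => [|b' s] ps IH H; first by split.
have [bl Pbl] := IH b isT ps (fun k => H k.+1).
by split; [exact: lt_trans bl|exact: Phicat Pbl].
Qed.

End PiecewiseC1.

Section Contours.
Context {R : realType}.

Lemma continuous_sqr (f : R -> R) (x : R) :
  {for x, continuous f} -> {for x, continuous (fun t => f t ^+ 2)}.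
Proof.
move=> cf; apply: (@continuous_comp _ _ _ f (fun u => u ^+ 2)) => //.
exact: exprn_continuous.
Qed.

Variable gamma : R -> R[i].
Hypothesis hgamma : positive_contour gamma.

Let X t := complex.Re (gamma t).
Let Y t := complex.Im (gamma t).
Let sqdist (x t : R) := (X t - x) ^+ 2 + Y t ^+ 2.

Lemma on_contour_sqdist x t : (gamma t == x%:C) = (sqdist x t == 0).
Proof.
rewrite /sqdist /X /Y paddr_eq0 ?sqr_ge0 // !sqrf_eq0 subr_eq0.
by case: (gamma t) => u v /=; rewrite eq_complex /=.
Qed.

(** The last clause is compactness: on each closed piece [sqdist x] agrees with a continuous
    function and attains a positive minimum, and these finitely many minima are combined when the
    pieces are glued. *)
Lemma contour_tame : [/\ tame 0 1 X, tame 0 1 Y,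
  tame 0 1 (derive1 X), tame 0 1 (derive1 Y) &
  forall x, ~ on_contour gamma x%:C -> exists2 rho, 0 < rho &
    forall t, 0 <= t <= 1 -> rho <= sqdist x t].
Proof.
case: hgamma => -[s [ps ls Hs]] _ _.
pose Phi a b := [/\ tame a b X, tame a b Y,
  tame a b (derive1 X), tame a b (derive1 Y) &
  forall x, (forall t, a <= t <= b -> gamma t != x%:C) -> exists2 rho, 0 < rho &
    forall t, a <= t <= b -> rho <= sqdist x t].
have s0 : (0 < size s)%N.
  by case: s ps ls {Hs} => // _ /esym/eqP; rewrite oner_eq0.
have [|k ks ab|_] := path_interval_ind (Phi := Phi) s0 ps.
- move=> a b c /ltW ab /ltW bc [X1 Y1 X1' Y1' d1] [X2 Y2 X2' Y2' d2].
  split; [exact: tame_cat ab bc _ _..|].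
  move=> x acx.
  have [|r1 r10 h1] := d1 x.
    by move=> t /andP[ta tb]; apply: acx; rewrite ta (le_trans tb).
  have [|r2 r20 h2] := d2 x.
    by move=> t /andP[tb tc]; apply: acx; rewrite tc andbT (le_trans ab).
  exists (Num.min r1 r2); first by rewrite lt_min r10.
  move=> t /andP[ta tc]; rewrite ge_min.
  by have [tb|/ltW bt] := leP t b; [rewrite h1 ?ta|rewrite h2 ?orbT ?bt].
- have [CX CY] := Hs k ks.
  have [tX tX'] := C1_on_tame ab CX; have [tY tY'] := C1_on_tame ab CY.
  split => // x abx.
  case: CX => g [dg _ Xg]; case: CY => h [dh _ Yh].
  have cont (u : R -> R) : (forall t, derivable u t 1) -> continuous u.
    by move=> du t; apply: differentiable_continuous; apply/derivable1_diffP.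
  have cq : {within `[nth 0 (0 :: s) k, nth 0 s k],
      continuous (fun t => (g t - x) ^+ 2 + h t ^+ 2)}.
    apply: continuous_subspaceT => t.
    apply: (@continuousD _ _ _ (fun t => (g t - x) ^+ 2) (fun t => h t ^+ 2)).
      apply: continuous_sqr; apply: (@continuousB _ _ _ g (fun=> x)).
        exact: cont.
      exact: cst_continuous.
    by apply: continuous_sqr; exact: cont.
  have [c cab qc] := EVT_min (ltW ab) cq.
  have qE t : nth 0 (0 :: s) k <= t <= nth 0 s k ->
      sqdist x t = (g t - x) ^+ 2 + h t ^+ 2.
    by move=> tab; rewrite /sqdist /X /Y Xg // Yh.
  exists ((g c - x) ^+ 2 + h c ^+ 2); last first.
    by move=> t tab; rewrite qE // qc // in_itv.
  rewrite in_itv /= in cab; rewrite -qE // lt_neqAle eq_sym -on_contour_sqdist.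
  by rewrite abx // addr_ge0 // sqr_ge0.
rewrite ls => -[? ? ? ? d]; split => // x nx; apply: d => t t01.
by apply/eqP => gt; apply: nx; exists t.
Qed.

Let kRe (x t : R) :=
  ((X t - x) * derive1 X t + Y t * derive1 Y t) / sqdist x t.
Let kIm (x t : R) :=
  ((X t - x) * derive1 Y t - Y t * derive1 X t) / sqdist x t.

Lemma cauchy_kernelE x t :
  (gamma t - x%:C)^-1 * velocity gamma t = kRe x t +i* kIm x t.
Proof.
rewrite /velocity /kRe /kIm /sqdist /X /Y.
have -> : (fun t => complex.Re (gamma t)) = X by [].
have -> : (fun t => complex.Im (gamma t)) = Y by [].
case: (gamma t) => u v; move: (derive1 X t) (derive1 Y t) => a b.
have -> : u +i* v - x%:C = (u - x) +i* v.
  by apply/eqP; rewrite eq_complex /= oppr0 addr0 !eqxx.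
apply/eqP; rewrite eq_complex /=; apply/andP; split; apply/eqP; ring.
Qed.

Lemma tame_integrable f : tame 0 1 f ->
  (@lebesgue_measure R).-integrable `[0, 1] (EFin \o f).
Proof.
move=> [mf [B fB]]; apply: measurable_bounded_integrable => //.
  by rewrite /= lebesgue_measure_itv /= lte_fin ltr01 ltry.
exists B; split; first exact: num_real.
by move=> M BM t /=; rewrite in_itv /= => /fB /le_trans; apply; exact: ltW.
Qed.

Lemma kernel_tame x : ~ on_contour gamma x%:C ->
  tame 0 1 (kRe x) /\ tame 0 1 (kIm x).
Proof.
have [tX tY tX' tY' d] := contour_tame.
move=> /d[rho rho0 hrho].
have tXx : tame 0 1 (fun t => X t - x) by apply: tameD => //; exact: tame_cst.
have tV : tame 0 1 (fun t => (sqdist x t)^-1).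
  by apply: tameV rho0 hrho _; apply: tameD; apply: tameM.
by split; apply: tameM => //; apply: tameD; try apply: tameN; apply: tameM.
Qed.

(** Off the contour the winding number is 0 or 1, so the imaginary part of the Cauchy integral,
    equal to 0 or 2 pi, tells the two cases apart. *)
Let kernel_integral x : R := \int[@lebesgue_measure R]_(t in `[0, 1]) kIm x t.

Lemma winding_contour x : contour_integral gamma (fun w => (w - x%:C)^-1) =
  two_pi_i * winding gamma x%:C.
Proof.
rewrite /winding mulrA divff ?mul1r //.
by rewrite eq_complex /= negb_and mulf_neq0 ?orbT // gt_eqF // pi_gt0.
Qed.

Lemma kernel_integralE x : kernel_integral x = complex.Im (two_pi_i * winding gamma x%:C).
Proof.
rewrite -winding_contour /contour_integral /=.
by apply: eq_Rintegral => t _; rewrite cauchy_kernelE.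
Qed.

Lemma encloses_kernel x : encloses gamma x%:C -> kernel_integral x = 2 * pi.
Proof. by move=> [_ wx]; rewrite kernel_integralE wx mulr1. Qed.

Lemma outside_kernel x : leaves_outside gamma x%:C -> kernel_integral x = 0.
Proof. by move=> [_ wx]; rewrite kernel_integralE wx mulr0. Qed.

(** Continuity under the integral sign, the kernel being dominated near [x] by the constant [C]. As
    the integral takes only the values 0 and 2 pi off the contour, a variation below 2 pi already
    forbids passing from enclosed to outside. *)
Lemma kernel_integral_locally_cst x : ~ on_contour gamma x%:C ->
  exists2 r, 0 < r & forall y, `|y - x| <= r -> ~ on_contour gamma y%:C /\
    `|kernel_integral y - kernel_integral x| < 2 * pi.
Proof.
have [tX tY tX' tY' d] := contour_tame.
move=> nx; have [rho rho0 hrho] := d x nx.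
(* With h = y - x, the squared distance to y is at least half of the one to x minus h^2, and
   [s <= 1] gives h^2 <= s <= rho / 4; what remains is at least [rho / 4]. *)
pose s := Num.min 1 (rho / 4).
have s0 : 0 < s by rewrite lt_min ltr01 divr_gt0.
have srho : s ^+ 2 <= rho / 4.
  apply: (@le_trans _ _ s); last by rewrite ge_min lexx orbT.
  by rewrite expr2 ler_piMl ?(ltW s0) // ge_min lexx.
have hrho' y : `|y - x| <= s -> forall t, 0 <= t <= 1 -> rho / 4 <= sqdist y t.
  move=> yx t /hrho; rewrite /sqdist => h.
  have yx2 : (y - x) ^+ 2 <= rho / 4.
    apply: le_trans srho.
    by rewrite -(real_normK (num_real (y - x))) ler_pXn2r ?nnegrE // ltW.
  have : 0 <= (X t - x - 2 * (y - x)) ^+ 2 by rewrite sqr_ge0.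
  have := sqr_ge0 (Y t); nra.
have noc y : `|y - x| <= s -> ~ on_contour gamma y%:C.
  move=> /hrho' h [t /h ht /eqP]; rewrite on_contour_sqdist => /eqP ht0.
  by move: ht; rewrite ht0 leNgt divr_gt0.
case: tX => mX [BX hX]; case: tY => mY [BY hY].
case: tX' => mX' [BX' hX']; case: tY' => mY' [BY' hY'].
pose I := `]x - s, x + s[%classic.
have Is y : I y -> `|y - x| <= s.
  by rewrite /I /= in_itv /= ler_distl => /andP[/ltW-> /ltW->].
have int_k y : I y -> (@lebesgue_measure R).-integrable `[0, 1] (EFin \o (kIm y)).
  move=> /Is /noc /kernel_tame[_ ty]; exact: tame_integrable.
pose C := ((BX + (`|x| + s)) * BY' + BY * BX') / (rho / 4).
have kC y : I y -> {ae (@lebesgue_measure R), forall t, `[0, 1]%classic t ->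
    `|kIm y t| <= C}.
  move=> /Is yx; apply: aeW => t /=; rewrite in_itv /= => t01.
  have hq := hrho' _ yx _ t01.
  have q0 : 0 < sqdist y t by rewrite (lt_le_trans _ hq) // divr_gt0.
  rewrite /kIm normrM /C; apply: ler_pM => //; last first.
    by rewrite normfV gtr0_norm // lef_pV2 // posrE divr_gt0.
  rewrite (le_trans (ler_normB _ _)) // !normrM lerD //; apply: ler_pM => //.
  - rewrite (le_trans (ler_normB _ _)) // lerD ?hX //.
    by rewrite -[y in `|y|](subrK x) addrC (le_trans (ler_normD _ _)) // lerD.
  - exact: hY'.
  - exact: hY.
  - exact: hX'.
have kcont : {ae (@lebesgue_measure R), forall t, `[0, 1]%classic t ->
    {in I, continuous (kIm ^~ t)}}.
  apply: aeW => t /=; rewrite in_itv /= => t01 y /set_mem /Is yx.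
  have cXy : {for y, continuous (fun z => X t - z)}.
    by apply: continuousB; [exact: cst_continuous|exact: cvg_id].
  apply: (@continuousM _ _ (fun z => (X t - z) * derive1 Y t - Y t * derive1 X t)
           (fun z => (sqdist z t)^-1)).
    apply: (@continuousB _ _ _ (fun z => (X t - z) * derive1 Y t)
             (fun=> Y t * derive1 X t)); last exact: cst_continuous.
    by apply: (@continuousM _ _ (fun z => X t - z) (fun=> derive1 Y t)) => //;
       exact: cst_continuous.
  apply: (@continuousV _ _ (sqdist ^~ t)).
    by rewrite gt_eqF // (lt_le_trans _ (hrho' _ yx _ t01)) // divr_gt0.
  apply: (@continuousD _ _ _ (fun z => (X t - z) ^+ 2) (fun=> Y t ^+ 2)).
    exact: continuous_sqr.
  exact: cst_continuous.
have int_C : (@lebesgue_measure R).-integrable `[0, 1] (EFin \o (fun=> C)).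
  exact/tame_integrable/tame_cst.
have Ix : x \in I by rewrite inE /I /= in_itv /= ltrBlDr ltrDl s0.
have mI : measurable (`[0, 1]%classic : set (measurableTypeR R)) by [].
have := continuity_under_integral mI int_k kcont int_C kC Ix.
move=> /cvgrPdist_lt /(_ (2 * pi)); rewrite mulr_gt0 ?pi_gt0 // => /(_ isT).
case=> /= e e0 he.
(* Halving passes from the open ball given by continuity to a closed one. *)
exists (Num.min s (e / 2)); first by rewrite lt_min s0 divr_gt0.
move=> y; rewrite le_min => /andP[ys ye]; split; first exact: noc.
rewrite distrC; apply: he => /=; rewrite distrC (le_lt_trans ye) //.
by rewrite ltr_pdivrMr // ltr_pMr // ltr1n.
Qed.

Lemma encloses_open (x : R) : encloses gamma x%:C ->
  exists2 r, 0 < r & forall y : R, `|y - x| <= r -> encloses gamma y%:C.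
Proof.
move=> ex; have [r r0 hr] := kernel_integral_locally_cst ex.1.
exists r => // y /hr[ny]; have [_ _ /(_ _ ny)[//|oy]] := hgamma.
by rewrite (encloses_kernel ex) (outside_kernel oy) sub0r normrN ger0_norm
   ?ltxx // mulr_ge0 // ltW // pi_gt0.
Qed.

Lemma leaves_outside_open (x : R) : leaves_outside gamma x%:C ->
  exists2 r, 0 < r & forall y : R, `|y - x| <= r -> leaves_outside gamma y%:C.
Proof.
move=> ox; have [r r0 hr] := kernel_integral_locally_cst ox.1.
exists r => // y /hr[ny]; have [_ _ /(_ _ ny)[ey|//]] := hgamma.
by rewrite (encloses_kernel ey) (outside_kernel ox) subr0 ger0_norm
   ?ltxx // mulr_ge0 // ltW // pi_gt0.
Qed.

End Contours.

Section RintegralSum.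
Context {d} {T : measurableType d} {R : realType}.
Variables (mu : {measure set T -> \bar R}) (D : set T).
Hypothesis mD : measurable D.

Lemma integrable_fin_sum I (s : seq I) (F : I -> T -> R) :
  (forall i, mu.-integrable D (EFin \o F i)) ->
  mu.-integrable D (EFin \o (fun t => \sum_(i <- s) F i t)).
Proof.
move=> iF; rewrite (_ : _ \o _ = fun t => (\sum_(i <- s) (F i t)%:E)%E).
  by apply: integrable_sum => // i _; exact: iF.
by apply/funext => t /=; rewrite sumEFin.
Qed.

Lemma Rintegral_sum I (s : seq I) (F : I -> T -> R) :
  (forall i, mu.-integrable D (EFin \o F i)) ->
  \int[mu]_(t in D) (\sum_(i <- s) F i t) = \sum_(i <- s) \int[mu]_(t in D) F i t.
Proof.
move=> iF; elim: s => [|i s IH].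
  rewrite big_nil (@eq_Rintegral _ _ _ _ _ (fun=> 0)).
    by rewrite /Rintegral integral0.
  by move=> t _; rewrite big_nil.
rewrite big_cons -IH -RintegralD //; last exact: integrable_fin_sum.
by apply: eq_Rintegral => t _; rewrite big_cons.
Qed.

End RintegralSum.

(** * Riesz projections of orthogonally diagonalized matrices *)

Section RieszProjection.
Context {R : realType}.
Variable gamma : R -> R[i].
Hypothesis hgamma : positive_contour gamma.

Lemma contour_integral_sum n (c x : 'I_n -> R) (f : R[i] -> R[i]) :
  (forall k, ~ on_contour gamma (x k)%:C) ->
  (forall t, 0 <= t <= 1 ->
     f (gamma t) = \sum_k (c k)%:C * (gamma t - (x k)%:C)^-1) ->
  contour_integral gamma f =
  \sum_k (c k)%:C * contour_integral gamma (fun w => (w - (x k)%:C)^-1).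
Proof.
move=> xoff fE; pose h k t := (gamma t - (x k)%:C)^-1 * velocity gamma t.
have fh t : t \in `[0, 1]%classic -> f (gamma t) * velocity gamma t =
    \sum_k (c k)%:C * h k t.
  rewrite inE /= in_itv /= => /fE ->; rewrite mulr_suml.
  by apply: eq_bigr => k _; rewrite mulrA.
have mI : measurable (`[0, 1]%classic : set (measurableTypeR R)) by [].
have iRe k : (@lebesgue_measure R).-integrable `[0, 1]
    (EFin \o (fun t => complex.Re (h k t))).
  have [tR _] := kernel_tame hgamma (xoff k).
  have := tame_integrable tR; apply: eq_integrable => // t _.
  by rewrite /= /h cauchy_kernelE.
have iIm k : (@lebesgue_measure R).-integrable `[0, 1]
    (EFin \o (fun t => complex.Im (h k t))).
  have [_ tI] := kernel_tame hgamma (xoff k).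
  have := tame_integrable tI; apply: eq_integrable => // t _.
  by rewrite /= /h cauchy_kernelE.
have iZ (g : 'I_n -> R -> R) :
    (forall k, (@lebesgue_measure R).-integrable `[0, 1] (EFin \o g k)) ->
    forall k, (@lebesgue_measure R).-integrable `[0, 1]
      (EFin \o (fun t => c k * g k t)).
  move=> ig k; have := integrableZl mI (c k) (ig k).
  by apply: eq_integrable => // t _; rewrite /= EFinM.
have ReIm (s : seq 'I_n) (z : 'I_n -> R[i]) :
    \sum_(k <- s) (c k)%:C * z k = (\sum_(k <- s) c k * complex.Re (z k)) +i*
                                   (\sum_(k <- s) c k * complex.Im (z k)).
  elim: s => [|k s IH]; first by rewrite !big_nil.
  rewrite !big_cons IH; case: (z k) => u v /=; apply/eqP.
  by rewrite eq_complex /= !mul0r subr0 addr0 !eqxx.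
rewrite ReIm /contour_integral /=; congr (_ +i* _).
  transitivity (\int[@lebesgue_measure R]_(t in `[0, 1])
      (\sum_k c k * complex.Re (h k t))).
    by apply: eq_Rintegral => t /fh /= ->; rewrite ReIm.
  rewrite (Rintegral_sum mI _ (iZ _ iRe)); apply: eq_bigr => k _.
  by rewrite RintegralZl.
transitivity (\int[@lebesgue_measure R]_(t in `[0, 1])
      (\sum_k c k * complex.Im (h k t))).
    by apply: eq_Rintegral => t /fh /= ->; rewrite ReIm.
rewrite (Rintegral_sum mI _ (iZ _ iIm)); apply: eq_bigr => k _.
by rewrite RintegralZl.
Qed.

Lemma eigenvalue_conj_diag n (U : 'M[R]_n) (f : 'I_n -> R) (z : R[i]) :
  U *m U^T = 1%:M -> U^T *m U = 1%:M -> eigenvalue (cmx (conj_diag U f)) z ->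
  exists k, z = (f k)%:C.
Proof.
move=> UUt UtU /eigenvalueP[v vM v0]; apply: contrapT => /forallNP zf.
have cUUt : cmx U *m cmx U^T = 1%:M by rewrite -map_mxM UUt map_mx1.
have cUtU : cmx U^T *m cmx U = 1%:M by rewrite -map_mxM UtU map_mx1.
pose w := v *m cmx U^T.
have wD : w *m cmx (diag_mx (\row_k f k)) = z *: w.
  rewrite /w scalemxAl -vM /conj_diag /cmx !map_mxM -!mulmxA.
  by rewrite -/(cmx U) -/(cmx U^T) cUUt mulmx1.
have w0 : w = 0.
  apply/rowP => k; rewrite [RHS]mxE; have /rowP/(_ k) := wD.
  rewrite /cmx map_diag_mx mul_mx_diag; move: (w) => y; rewrite !mxE.
  move/eqP; rewrite mulrC -subr_eq0 -mulrBl mulf_eq0 subr_eq0 => /orP[|/eqP //].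
  by move=> /eqP /esym /(zf k).
by move/eqP: v0; apply; rewrite -[v]mulmx1 -cUtU mulmxA -/w w0 mul0mx.
Qed.

Lemma resolvent_conj_diag n (U : 'M[R]_n) (f : 'I_n -> R) (z : R[i]) i j :
  U *m U^T = 1%:M -> U^T *m U = 1%:M -> (forall k, z != (f k)%:C) ->
  invmx (z%:M - cmx (conj_diag U f)) i j =
  \sum_k (U k i * U k j)%:C * (z - (f k)%:C)^-1.
Proof.
move=> UUt UtU zf.
have cUUt : cmx U *m cmx U^T = 1%:M by rewrite -map_mxM UUt map_mx1.
have cUtU : cmx U^T *m cmx U = 1%:M by rewrite -map_mxM UtU map_mx1.
pose B := cmx U^T *m diag_mx (\row_k (z - (f k)%:C)^-1) *m cmx U.
have AE : z%:M - cmx (conj_diag U f) =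
    cmx U^T *m diag_mx (\row_k (z - (f k)%:C)) *m cmx U.
  have -> : diag_mx (\row_k (z - (f k)%:C)) = z%:M - cmx (diag_mx (\row_k f k)).
    apply/matrixP => a b; rewrite !mxE; case: eqP => _; rewrite ?mulr1n // !mulr0n.
    by rewrite subrr.
  rewrite mulmxBr mulmxBl -!map_mxM; congr (_ - _).
  by rewrite mul_mx_scalar -scalemxAl cUtU scalemx1.
have AB : (z%:M - cmx (conj_diag U f)) *m B = 1%:M.
  rewrite AE /B !mulmxA -[_ *m cmx U *m cmx U^T]mulmxA cUUt mulmx1.
  rewrite -[_ *m diag_mx _ *m diag_mx _]mulmxA mulmx_diag.
  rewrite (_ : diag_mx _ = 1%:M) ?mulmx1 //.
  apply/matrixP => a b; rewrite !mxE; case: eqP => [->|_]; last by rewrite mulr0n.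
  by rewrite divff // subr_eq0.
have -> : invmx (z%:M - cmx (conj_diag U f)) = B.
  move: (_ - _) (B) AB => A C AC; have [Au _] := mulmx1_unit AC.
  by rewrite -[LHS]mulmx1 -AC mulmxA mulVmx // mul1mx.
rewrite /B mul_mx_diag mxE; apply: eq_bigr => k _; rewrite !mxE.
by rewrite rmorphM mulrAC.
Qed.

(** Every entry of the resolvent is a finite combination of the kernels 1 / (z - f k), so its
    integral is the same combination of winding numbers, each 0 or 1 by [positive_contour]. *)
Lemma riesz_proj_conj_diag n (U : 'M[R]_n) (f : 'I_n -> R) :
  U *m U^T = 1%:M -> U^T *m U = 1%:M ->
  (forall k, ~ on_contour gamma (f k)%:C) ->
  riesz_proj gamma (conj_diag U f) =
  cmx (conj_diag U (fun k => if `[< encloses gamma (f k)%:C >] then 1 else 0)).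
Proof.
move=> UUt UtU foff; rewrite /riesz_proj; case: asboolP.
  (* The default branch of [riesz_proj] is excluded: every complex eigenvalue is some real [f k],
     which avoids the contour. *)
  by move=> [z zon /(eigenvalue_conj_diag UUt UtU)[k zk]]; case: (foff k); rewrite -zk.
move=> _; apply/matrixP => i j; rewrite !mxE.
rewrite (contour_integral_sum (c := fun k => U k i * U k j) foff); last first.
  move=> t t01; rewrite resolvent_conj_diag // => k.
  by apply/eqP => gt; apply: (foff k); exists t.
rewrite mulr_sumr rmorph_sum; apply: eq_bigr => k _.
rewrite mulrCA -/(winding gamma (f k)%:C) mul_mx_diag !mxE.
have [_ _ /(_ _ (foff k)) ef] := hgamma.
case: asboolP => [[_ ->]|ne]; first by rewrite !mulr1.
by case: ef => [//|[_ ->]]; rewrite !mulr0 mul0r.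
Qed.

End RieszProjection.

(** * Second order expansion of the Riesz projection *)

Section SpectralSubspace.
Context {R : realType} {p : nat}.
Implicit Types (A P V : 'M[R]_p) (E : {vspace 'cV[R]_p}).

Lemma mem_colspace A u : A *m u \in colspace A.
Proof.
have -> : A *m u = \sum_j u j ord0 *: col j A.
  apply/colP => i; rewrite mxE summxE; apply: eq_bigr => j _.
  by rewrite !mxE mulrC.
apply: memv_suml => j _; apply/memvZ/memv_span.
by apply/mapP; exists j => //; rewrite mem_enum.
Qed.

Lemma colspaceP A w : w \in colspace A -> exists u, w = A *m u.
Proof.
rewrite /colspace; elim: (enum 'I_p) w => [|j s IH] w /=.
  by rewrite span_nil memv0 => /eqP ->; exists 0; rewrite mulmx0.
rewrite span_cons => /memv_addP[_ /vlineP[c ->] [_ /IH[u ->] ->]].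
by exists (c *: delta_mx j 0 + u); rewrite mulmxDr -scalemxAr colE.
Qed.

(** The difference of the two images of a vector lies in [E] and, as a difference of residuals, is
    orthogonal to [E], hence to itself. *)
Lemma orth_proj_unique E P P' : orth_proj E P -> orth_proj E P' -> P = P'.
Proof.
move=> hP hP'; apply/eqP; rewrite -subr_eq0; apply/eqP/trmx_inj.
apply/row_matrixP => i; rewrite trmx0 row0; apply: row_mul_tr_eq0.
pose v : 'cV[R]_p := delta_mx i 0; pose y := P *m v - P' *m v.
have -> : row i (P - P')^T = y^T by rewrite -tr_col colE /y -mulmxBl.
have [[Pv oPv] [P'v oP'v]] := (hP v, hP' v).
have yE : y \in E by rewrite rpredB.
rewrite trmxK {2}(_ : y = (v - P' *m v) - (v - P *m v)).
  by rewrite mulmxBr oPv // oP'v // subrr.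
by rewrite /y opprB [RHS]addrC addrA subrK.
Qed.

Lemma orth_proj_range V (f : 'I_p -> R) :
  V *m V^T = 1%:M -> V^T *m V = 1%:M ->
  orth_proj (colspace (conj_diag V f))
    (conj_diag V (fun k => if f k == 0 then 0 else 1)).
Proof.
move=> VVt VtV v; set Pf := conj_diag V _.
(* As the inverse of 0 is 0, the product of f and its inverse is the indicator of f <> 0; this
   exhibits [Pf v] as a vector of the column space. *)
have PE : Pf = conj_diag V f *m conj_diag V (fun k => (f k)^-1).
  rewrite conj_diagM // /Pf /conj_diag; congr (_ *m diag_mx _ *m _).
  apply/rowP => k; rewrite !mxE; have [->|f0] := eqVneq (f k) 0.
    by rewrite mul0r.
  by rewrite divff.
have fP : conj_diag V f *m (1%:M - Pf) = 0.
  rewrite -(conj_diag_cst VtV 1) /Pf conj_diagB conj_diagM //.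
  have -> : 0 = conj_diag V (fun=> 0) by rewrite conj_diag_cst // raddf0.
  congr (_ *m diag_mx _ *m _); apply/rowP => k; rewrite !mxE.
  by have [->|f0] := eqVneq (f k) 0; rewrite ?mul0r // subrr mulr0.
split; first by rewrite PE -mulmxA mem_colspace.
move=> w /colspaceP[u ->]; rewrite trmx_mul conj_diag_tr.
by rewrite -{1}[v]mul1mx -mulmxBl -mulmxA [_ *m (_ *m v)]mulmxA fP mul0mx mulmx0.
Qed.

Lemma invmx_conj_diag V (f : 'I_p -> R) :
  V *m V^T = 1%:M -> V^T *m V = 1%:M -> (forall k, f k != 0) ->
  invmx (conj_diag V f) = conj_diag V (fun k => (f k)^-1).
Proof.
move=> VVt VtV f0.
have AC : conj_diag V f *m conj_diag V (fun k => (f k)^-1) = 1%:M.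
  rewrite conj_diagM // -(conj_diag_cst VtV); congr (_ *m diag_mx _ *m _).
  by apply/rowP => k; rewrite !mxE divff.
move: (conj_diag V f) (conj_diag V _) AC => A C AC.
have [Au _] := mulmx1_unit AC.
by rewrite -[LHS]mulmx1 -AC mulmxA mulVmx // mul1mx.
Qed.

End SpectralSubspace.

(** The inverse of a sum of inverses replaces the minimum of the radii: it lies below each of them,
    and the added 1 keeps it positive when [n] is 0. *)
Lemma common_radius (R : realType) n (Q : 'I_n -> R -> Prop) :
  (forall j, exists2 r, 0 < r & forall s, s <= r -> Q j s) ->
  exists2 r, 0 < r & forall j s, s <= r -> Q j s.
Proof.
move=> h; have {h} : forall j, exists r, 0 < r /\ forall s, s <= r -> Q j s.
  by move=> j; have [r r0 hr] := h j; exists r.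
move=> /choice[r hr].
have S0 : 0 <= \sum_j (r j)^-1.
  by apply: sumr_ge0 => j _; rewrite invr_ge0 ltW // (hr j).1.
exists (1 + \sum_j (r j)^-1)^-1; first by rewrite invr_gt0 ltr_wpDr.
move=> j s sr; apply: (hr j).2; apply: (le_trans sr).
have rj := (hr j).1; rewrite -[leRHS]invrK lef_pV2 ?posrE ?invr_gt0 ?ltr_wpDr //.
rewrite (bigD1 j) //= addrCA lerDl addr_ge0 // sumr_ge0 // => i _.
by rewrite invr_ge0 ltW // (hr i).1.
Qed.

Section RieszExpansion.
Context {R : realType} {p : nat}.
Variables (gamma : R -> R[i]) (M Pc : 'M[R]_p) (lam : R).
Hypothesis hgamma : positive_contour gamma.
Hypothesis hin : forall z : R[i], eigenvalue (cmx M) z -> z != lam%:C ->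
  encloses gamma z.
Hypothesis hout : leaves_outside gamma lam%:C.
Hypothesis Msym : M^T = M.
Hypothesis hPc : orth_proj (colspace (M - lam%:M)) Pc.
Let Qc := 1%:M - Pc.
Let A := Pc *m M - lam%:M.
Let Ainv := if lam == 0 then inv_on Pc A else invmx A.

(** [G] is the pseudo-inverse of [M - lam]. On the range of [Pc] both forms of [Ainv] invert
    [M - lam]; on its orthogonal [A] is [- lam], whose inverse, or the value 0 when [lam = 0], is
    erased by the factor [Pc]. So [G *m G] covers both cases. *)
Lemma riesz_proj_expansion : exists G : 'M[R]_p,
  [/\ G^T = G, Pc *m (Ainv *m Ainv) = G *m G, Qc *m (M - lam%:M) = 0 /\ Qc *m G = 0,
    Qc^T = Qc &
  forall eta, 0 < eta -> exists delta, 0 < delta /\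
  forall M' : 'M[R]_p, M'^T = M' -> norm1 (M' - M) <= delta ->
    `| complex.Re (\tr (cmx Qc *m riesz_proj gamma M'))
       - \tr (Qc *m (M' - M) *m (G *m G) *m ((M' - M) *m Qc)) |
    <= eta * norm1 (Qc *m (M' - M)) ^+ 2].
Proof.
have [V [mu [VVt VtV ME]]] := symmetric_spectral Msym.
have eqC (f g : 'I_p -> R) : f =1 g -> conj_diag V f = conj_diag V g.
  by move=> fg; rewrite /conj_diag; congr (_ *m diag_mx _ *m _);
     apply/rowP => k; rewrite !mxE fg.
pose nu k := mu 0 k - lam; pose chi k : R := if nu k == 0 then 0 else 1.
have MC : M = conj_diag V (fun k => mu 0 k).
  by rewrite ME; congr (_ *m diag_mx _ *m _); apply/rowP => k; rewrite mxE.
have NE : M - lam%:M = conj_diag V nu.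
  by rewrite -(conj_diagB V) conj_diag_cst // -MC.
have PE : Pc = conj_diag V chi.
  by apply: orth_proj_unique hPc _; rewrite NE; exact: orth_proj_range.
have QE : Qc = conj_diag V (fun k => 1 - chi k).
  by rewrite -(conj_diagB V) conj_diag_cst // -PE.
pose G := conj_diag V (fun k => (nu k)^-1).
have chi01 k : chi k = 0 /\ mu 0 k = lam \/ chi k = 1 /\ nu k != 0.
  rewrite /chi; have [n0|n0] := eqVneq (nu k) 0; [left|right] => //.
  by split=> //; apply/eqP; rewrite -subr_eq0 -/(nu k) n0.
have zeroC : conj_diag V (fun=> 0) = 0 by rewrite conj_diag_cst // raddf0.
have QN : Qc *m (M - lam%:M) = 0.
  rewrite QE NE conj_diagM // -zeroC; apply: eqC => k.
  case: (chi01 k) => -[ck nk]; first by rewrite /nu nk subrr mulr0.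
  by rewrite ck subrr mul0r.
have Qsym : Qc^T = Qc by rewrite QE conj_diag_tr.
have QG : Qc *m G = 0.
  rewrite QE conj_diagM // -zeroC; apply: eqC => k.
  case: (chi01 k) => -[ck nk]; last by rewrite ck subrr mul0r.
  by rewrite /nu nk subrr invr0 mulr0.
exists G; split => //; first exact: conj_diag_tr.
  have AE : A = conj_diag V (fun k => chi k * mu 0 k - lam).
    by rewrite -(conj_diagB V) conj_diag_cst // /A PE {1}MC conj_diagM.
  have -> : Ainv = conj_diag V (fun k => if lam == 0 then (chi k) * (nu k)^-1
                                    else (chi k * mu 0 k - lam)^-1).
    rewrite /Ainv; have [l0|l0] := eqVneq lam 0; last first.
      rewrite AE invmx_conj_diag // => k; case: (chi01 k) => -[-> nk].
        by rewrite mul0r sub0r oppr_eq0.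
      by rewrite mul1r.
    rewrite /inv_on -/Qc QE AE PE !conj_diagM //.
    have -> (U1 : 'M[R]_p) f g : conj_diag U1 f + conj_diag U1 g =
        conj_diag U1 (fun k => f k + g k).
      rewrite /conj_diag -mulmxDl -mulmxDr -raddfD /=.
      by congr (_ *m diag_mx _ *m _); apply/rowP => k; rewrite !mxE.
    rewrite invmx_conj_diag // ?conj_diagM //.
      apply: eqC => k; rewrite l0 /nu; case: (chi01 k) => -[-> nk]; rewrite ?mul0r //.
      by rewrite !mul1r !mulr1 subrr addr0 l0.
    move=> k; case: (chi01 k) => -[-> nk].
      by rewrite mulr0 subr0 add0r oner_eq0.
    by rewrite !mul1r mulr1 subrr addr0.
  rewrite PE !conj_diagM //; apply: eqC => k.
  case: (chi01 k) => -[-> nk]; first by rewrite mul0r /nu nk subrr invr0 mul0r.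
  by rewrite !mul1r; case: ifP; rewrite ?mul1r.
have QQ : Qc *m Qc = Qc.
  rewrite QE conj_diagM //; apply: eqC => k.
  by case: (chi01 k) => -[-> _]; rewrite ?subr0 ?subrr ?mulr1 ?mulr0.
have GN : G *m (M - lam%:M) = Pc.
  rewrite NE PE conj_diagM //; apply: eqC => k; rewrite /chi.
  by have [->|n0] := eqVneq (nu k) 0; rewrite ?mulr0 ?mulVf.
have GP : G *m Pc = G.
  rewrite PE conj_diagM //; apply: eqC => k.
  case: (chi01 k) => -[-> nk]; last by rewrite mulr1.
  by rewrite mulr0 /nu nk subrr invr0.
have [rl rl0 hrl] := leaves_outside_open hgamma hout.
(* One radius for all indices; those with [mu_j = lam] impose nothing and get the dummy radius 1. *)
have /common_radius[r0 r00 hr0] : forall j : 'I_p, exists2 r, 0 < r &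
    forall s, s <= r -> mu 0 j != lam -> forall y : R, `|y - mu 0 j| <= s ->
    encloses gamma y%:C.
  move=> j; have [->|mj] := eqVneq (mu 0 j) lam; first by exists 1.
  have [|r r0 hr] := @encloses_open _ _ hgamma (mu 0 j).
    apply: hin; last by apply: contra mj => /eqP[->].
    rewrite cmx_eigenvalue; apply/eigenvalueP; exists (row j V).
      rewrite ME !mulmxA -row_mul VVt -row_mul mul1mx.
      by rewrite row_diag_mx -scalemxAl -rowE.
    apply/eqP => v0; have /rowP /(_ j) : row j 1%:M = 0 :> 'rV[R]_p.
      by rewrite -VVt row_mul v0 mul0mx.
    by rewrite !mxE eqxx => /eqP; rewrite oner_eq0.
  by exists r => // s sr _ y ys; apply: hr; rewrite (le_trans ys).
pose r := Num.min r0 rl.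
have r_gt0 : 0 < r by rewrite lt_min r00.
have ins j x : mu 0 j != lam -> `|x - mu 0 j| <= r -> encloses gamma x%:C.
  by move=> mj xr; apply: (hr0 j r) => //; rewrite ge_min lexx.
have outs x : `|x - lam| <= r -> leaves_outside gamma x%:C.
  by move=> xr; apply: hrl; rewrite (le_trans xr) // ge_min lexx orbT.
have nins x : `|x - lam| <= r -> ~ encloses gamma x%:C.
  move=> /outs[_ w0] [_ w1]; move/eqP: w1; rewrite w0 eq_sym.
  by rewrite oner_eq0.
move=> eta eta0.
have [delta [delta0 hd]] := @spectral_projection_expansion _ _ M V Pc G mu lam r
  (fun x => encloses gamma x%:C) VVt VtV ME (conj_diag_tr _ _) Qsym QQ GN GP QN
  r_gt0 ins nins eta eta0.
exists delta; split => // M' M'sym M'd.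
have [U [m [UUt UtU M'E loc bnd]]] := hd M' M'sym M'd.
have M'C : M' = conj_diag U (fun k => m 0 k).
  by rewrite M'E; congr (_ *m diag_mx _ *m _); apply/rowP => k; rewrite mxE.
(* The localization keeps all eigenvalues of [M'] off the contour, so the integral is a genuine sum
   of spectral projections. *)
rewrite {1}M'C riesz_proj_conj_diag //; last first.
  move=> k; have [j jk] := loc k; have [mj|mj] := eqVneq (mu 0 j) lam.
    by apply: (outs _ _).1; rewrite -mj.
  exact: (ins j _ mj jk).1.
rewrite -map_mxM.
have -> (B : 'M[R]_p) : \tr (map_mx (real_complex R) B) = (\tr B)%:C.
  by rewrite /mxtrace rmorph_sum; apply: eq_bigr => i _; rewrite mxE.
exact: bnd.
Qed.

End RieszExpansion.

(** * Independent copies *)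

Section WeightedPushforward.
Context {d d'} {T : measurableType d} {U : measurableType d'} {R : realType}.
Variables (P : {measure set T -> \bar R}) (nu : {measure set U -> \bar R}).
Variables (H : T -> R) (Phi : T -> U) (c : R).
Hypotheses (mH : measurable_fun setT H) (H0 : forall w, 0 <= H w).
Hypotheses (mPhi : measurable_fun setT Phi).
Hypothesis HPhi : forall B, measurable B ->
  (\int[P]_w (H w * \1_B (Phi w))%:E = c%:E * nu B)%E.

Import HBNNSimple.

(** The hypothesis [HPhi] says that the image under [Phi] of the measure with density [H] is [c]
    times [nu]; indicators extend to simple functions, then to monotone limits. With [H] a product
    over other indices, this exchanges one indicator for a function. *)
Lemma ge0_integral_weighted_pushforward (g : U -> R) :
  measurable_fun setT g -> (forall u, 0 <= g u) ->
  (\int[P]_w (H w * g (Phi w))%:E = c%:E * \int[nu]_u (g u)%:E)%E.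
Proof.
move=> mg g0.
have mEg : measurable_fun setT (EFin \o g) by exact/measurable_EFinP.
pose h := nnsfun_approx measurableT mEg.
have key n : (\int[P]_w (H w * h n (Phi w))%:E = c%:E * \int[nu]_u (h n u)%:E)%E.
  have -> : (\int[nu]_u (h n u)%:E)%E =
      (\sum_(r \in range (h n)) r%:E * nu (h n @^-1` [set r]))%E.
    by rewrite integral_nnsfun // -sintegralE patch_setT.
  have mfib r : measurable (h n @^-1` [set r]) by exact: measurable_sfunP.
  transitivity (\int[P]_w (\sum_(r \in range (h n))
      (r * (H w * \1_(h n @^-1` [set r]) (Phi w)))%:E))%E.
    apply: eq_integral => w _; rewrite {1}fimfunE.
    rewrite fsumEFin //; congr (_%:E).
    rewrite !fsbig_finite //= mulr_sumr; apply: eq_bigr => r _.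
    by rewrite mulrCA.
  have r0 r : range (h n) r -> 0 <= r by move=> [u _ <-].
  rewrite ge0_integral_fsum //; first last.
  - move=> r w _; rewrite lee_fin.
    have [/r0 r00|rn] := pselect (range (h n) r); first by rewrite !mulr_ge0.
    rewrite indicE memNset ?mulr0 // => /= hr; apply: rn.
    by exists (Phi w).
  - move=> r; apply/measurable_EFinP; apply: measurable_funM => //.
    apply: measurable_funM => //; apply: measurableT_comp mPhi => //.
  rewrite ge0_mule_fsumr; last first.
    move=> r; have [/r0 r00|rn] := pselect (range (h n) r).
      by rewrite mule_ge0 ?lee_fin.
    by rewrite (_ : _ @^-1` _ = set0) ?measure0 ?mule0 // -subset0 => u /= hr;
       apply: rn; exists u.
  apply: eq_fsbigr => r /set_mem /r0 r00.
  under eq_integral do rewrite EFinM.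
  rewrite ge0_integralZl //.
  - by rewrite HPhi // muleCA.
  - apply/measurable_EFinP; apply: measurable_funM => //.
    exact: measurableT_comp mPhi.
  - by move=> w _; rewrite lee_fin mulr_ge0.
have hcvg u : (h n u)%:E @[n --> \oo] --> (g u)%:E.
  by apply: (cvg_nnsfun_approx measurableT mEg) => // v _; rewrite lee_fin.
have hnd u : {homo (fun n => h n u) : m n / (m <= n)%N >-> m <= n}.
  by move=> m n mn; exact/lefP/nd_nnsfun_approx.
have L : (\int[P]_w (H w * h n (Phi w))%:E @[n --> \oo] -->
          \int[P]_w (H w * g (Phi w))%:E)%E.
  have := @cvg_monotone_convergence _ _ _ P setT measurableT
    (fun n w => (H w * h n (Phi w))%:E).
  move/(_ _ _ _)/cvg_trans; apply.
  - move=> n; apply/measurable_EFinP; apply: measurable_funM => //.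
    exact: measurableT_comp mPhi.
  - by move=> n w _; rewrite lee_fin mulr_ge0.
  - by move=> w _ m n mn; rewrite lee_fin ler_wpM2l // hnd.
  rewrite (_ : (\int[P]_w (H w * g (Phi w))%:E)%E = (\int[P]_w limn
     (fun n => (H w * h n (Phi w))%:E))%E) //.
  apply: eq_integral => w _; apply/esym/cvg_lim => //.
  under eq_fun do rewrite EFinM.
  by rewrite EFinM; apply: cvgeZl.
have L' : (c%:E * \int[nu]_u (h n u)%:E @[n --> \oo] -->
          c%:E * \int[nu]_u (g u)%:E)%E.
  apply: cvgeZl => //.
  have := @cvg_monotone_convergence _ _ _ nu setT measurableT
    (fun n u => (h n u)%:E).
  move/(_ _ _ _)/cvg_trans; apply.
  - by move=> n; exact/measurable_EFinP.
  - by move=> n u _; rewrite lee_fin.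
  - by move=> u _ m n mn; rewrite lee_fin hnd.
  rewrite (_ : (\int[nu]_u (g u)%:E)%E = (\int[nu]_u limn
     (fun n => (h n u)%:E))%E) //.
  by apply: eq_integral => u _; apply/esym/cvg_lim.
move: L; rewrite (funext key) => L.
exact: cvg_unique L L'.
Qed.

End WeightedPushforward.

Section IID.
Context {d d'} {T : measurableType d} {U : measurableType d'} {R : realType}.
Variables (P : probability T R) (V : T -> U) (Vs : nat -> T -> U).
Hypotheses (mV : measurable_fun setT V) (hiid : iid_copies P V Vs).

Lemma iid_measurable i : measurable_fun setT (Vs i).
Proof. by case: hiid. Qed.

Lemma iid_ge0_integral i (g : U -> \bar R) :
  measurable_fun setT g -> (forall u, 0 <= g u)%E ->
  (\int[P]_w g (Vs i w) = \int[P]_w g (V w))%E.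
Proof.
move=> mg g0; have [mVs law _] := hiid.
have H W (mW : measurable_fun setT W) :
    (\int[P]_w g (W w) = \int[pushforward P W]_u g u)%E.
  by rewrite ge0_integral_pushforward.
rewrite (H _ (mVs i)) (H _ mV); apply: eq_measure_integral => A mA _.
exact: law.
Qed.

Lemma iid_integrable i (g : U -> R) : measurable_fun setT g ->
  P.-integrable setT (EFin \o (g \o V)) ->
  P.-integrable setT (EFin \o (g \o Vs i)).
Proof.
move=> mg /integrableP[_ fin]; apply/integrableP; split.
  apply/measurable_EFinP; apply: measurableT_comp => //; exact: iid_measurable.
rewrite /= (iid_ge0_integral i (g := fun u => (`|g u|)%:E)) //.
by apply/measurable_EFinP; exact: measurableT_comp.
Qed.

Lemma iid_Rintegral i (g : U -> R) : measurable_fun setT g ->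
  \int[P]_w g (Vs i w) = \int[P]_w g (V w).
Proof.
move=> mg; rewrite /Rintegral integralE [in RHS]integralE.
have mEg : measurable_fun setT (EFin \o g) by exact/measurable_EFinP.
have mp := measurable_funepos mEg; have mn := measurable_funeneg mEg.
have Hp := iid_ge0_integral i mp (fun u => funepos_ge0 _ u).
have Hn := iid_ge0_integral i mn (fun u => funeneg_ge0 _ u).
by move: Hp Hn; rewrite !unlock => -> ->.
Qed.

Section Product.
Variables (g : nat -> U -> R).
Hypotheses (mg : forall i, measurable_fun setT (g i)).
Hypotheses (g0 : forall i u, 0 <= g i u).
Hypotheses (ig : forall i, P.-integrable setT (EFin \o (g i \o V))).

Let prod_measurable (s : seq nat) (h : nat -> U -> R) :
  (forall i, measurable_fun setT (h i)) ->
  measurable_fun setT (fun w => \prod_(i <- s) h i (Vs i w)).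
Proof.
move=> mh; apply: measurable_prod => i _.
by apply: measurableT_comp => //; exact: iid_measurable.
Qed.

(* The factors of the product rule for events are turned into functions one at
   a time. *)
Lemma iid_prod_indic (s1 s2 : seq nat) (A : nat -> set U) :
  uniq (s1 ++ s2) -> (forall i, measurable (A i)) ->
  (\int[P]_w (\prod_(i <- s1) g i (Vs i w) *
              \prod_(i <- s2) \1_(A i) (Vs i w))%:E =
   (\prod_(i <- s1) (\int[P]_w g i (V w)) *
    \prod_(i <- s2) fine (P (V @^-1` A i)))%:E)%E.
Proof.
have [mVs law indep] := hiid.
have mVA A' : measurable A' -> measurable (V @^-1` A').
  by move=> mA'; rewrite -[_ @^-1` _]setTI; exact: mV.
elim: s1 s2 A => [|j s1 IH] s2 A.
  move=> us2 mA; rewrite big_nil mul1r.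
  transitivity (\int[P]_w (\1_(\bigcap_(i in [set` s2]) Vs i @^-1` A i) w)%:E)%E.
    apply: eq_integral => w _; rewrite big_nil mul1r; congr (_%:E).
    rewrite indicE; have [wA|wA] := boolP (w \in _).
      rewrite big_seq big1 // => i is2; rewrite indicE mem_set //.
      by move/set_mem: wA; apply.
    have [i is2 wi] : exists2 i, i \in s2 & ~ A i (Vs i w).
      apply: contrapT => /forall2NP h; move/negP: wA; apply; apply/mem_set => i /= is2.
      by have [//|/contrapT] := h i.
    by rewrite (big_rem i) //= indicE memNset // mul0r.
  rewrite integral_indic //; last first.
    apply: bigcap_measurableType => i _; rewrite -[_ @^-1` _]setTI; exact: mVs.
  rewrite setIT; apply: (etrans (indep s2 A us2 mA)).
  rewrite -prodEFin; apply: eq_bigr => i _.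
  by rewrite law // fineK //; apply: fin_num_measure; exact: mVA.
move=> us mA.
(* All factors but the one of index [j]. Testing this weight against the indicator of a set [B] is
   the induction hypothesis with [B] placed at index [j]. *)
pose H w := \prod_(i <- s1) g i (Vs i w) * \prod_(i <- s2) \1_(A i) (Vs i w).
pose c := \prod_(i <- s1) (\int[P]_w g i (V w)) *
    \prod_(i <- s2) fine (P (V @^-1` A i)).
have mH : measurable_fun setT H.
  apply: measurable_funM; first exact: prod_measurable.
  by apply: (prod_measurable s2 (h := fun i => \1_(A i))) => i; exact: measurable_indic.
have H0 w : 0 <= H w by rewrite mulr_ge0 // prodr_ge0.
have HB B : measurable B ->
    (\int[P]_w (H w * \1_B (Vs j w))%:E = c%:E * pushforward P V B)%E.
  move=> mB; pose A' i := if i == j then B else A i.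
  have jn : (j \notin s2) by move: us; rewrite /= mem_cat negb_or => /andP[/andP[]].
  have A's2 i : i \in s2 -> A' i = A i.
    by rewrite /A'; case: eqP => // -> js2; rewrite js2 in jn.
  have us' : uniq (s1 ++ j :: s2).
    by rewrite -[j :: s2]cat1s uniq_catCA.
  have mA' i : measurable (A' i) by rewrite /A'; case: eqP.
  have := IH (j :: s2) A' us' mA'.
  have A'j : A' j = B by rewrite /A' eqxx.
  have A's2P : \prod_(i <- s2) fine (P (V @^-1` A' i)) =
               \prod_(i <- s2) fine (P (V @^-1` A i)).
    by apply: eq_big_seq => i is2; rewrite A's2.
  rewrite big_cons A'j A's2P.
  have -> : (\prod_(i <- s1) (\int[P]_w g i (V w)) * (fine (P (V @^-1` B)) *
     \prod_(i <- s2) fine (P (V @^-1` A i))))%:E = (c%:E * pushforward P V B)%E.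
    rewrite mulrCA mulrC -/c EFinM fineK // ?fin_num_measure //; exact: mVA.
  move=> <-; apply: eq_integral => w _; congr (_%:E).
  rewrite big_cons A'j /H -!mulrA; congr (_ * _); rewrite mulrC; congr (_ * _).
  by apply: eq_big_seq => i is2; rewrite A's2.
pose nu := measure_function_pushforward__canonical__measure_function_Measure P mV.
have := @ge0_integral_weighted_pushforward _ _ _ _ _ P nu H (Vs j) c mH H0
  (mVs j) HB (g j) (mg j) (g0 j).
rewrite ge0_integral_pushforward //=; last 2 first.
- exact/measurable_EFinP.
- by move=> u _; rewrite lee_fin.
rewrite !big_cons => Hj.
transitivity (\int[P]_w (H w * g j (Vs j w))%:E)%E.
  apply: eq_integral => w _; rewrite big_cons /H; congr (_%:E).
  by rewrite [RHS]mulrC mulrA.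
have gj : (\int[P]_w (g j (V w))%:E)%E = (\int[P]_w g j (V w))%:E.
  by rewrite fineK //; exact: integrable_fin_num (ig j).
by rewrite Hj gj -EFinM /c; congr (_%:E); ring.
Qed.

Lemma iid_prod (s : seq nat) : uniq s ->
  (\int[P]_w (\prod_(i <- s) g i (Vs i w))%:E =
   (\prod_(i <- s) \int[P]_w g i (V w))%:E)%E.
Proof.
move=> us; have := @iid_prod_indic s [::] (fun=> setT).
rewrite cats0 big_nil mulr1 => <- //.
by apply: eq_integral => w _; rewrite big_nil mulr1.
Qed.

End Product.

End IID.

(** * Integrability and truncation of real random variables *)

Section Expectation.
Context {d} {T : measurableType d} {R : realType} (P : probability T R).
Implicit Types f g : T -> R.

Lemma integrable_le f g : measurable_fun setT f -> (forall w, `|f w| <= g w) ->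
  P.-integrable setT (EFin \o g) -> P.-integrable setT (EFin \o f).
Proof.
move=> mf fg; apply: le_integrable => //; first exact/measurable_EFinP.
by move=> w _; rewrite /= lee_fin (le_trans (fg w)) // ler_norm.
Qed.

Lemma integrable_cst k : P.-integrable setT (EFin \o (fun=> k)).
Proof. exact: finite_measure_integrable_cst. Qed.

Lemma integrable_add f g : P.-integrable setT (EFin \o f) ->
  P.-integrable setT (EFin \o g) -> P.-integrable setT (EFin \o (fun w => f w + g w)).
Proof. by move=> hf hg; have := integrableD measurableT hf hg. Qed.

Lemma integrable_scale k f : P.-integrable setT (EFin \o f) ->
  P.-integrable setT (EFin \o (fun w => k * f w)).
Proof. by move=> hf; have := integrableZl measurableT k hf. Qed.

Lemma integrable_opp f : P.-integrable setT (EFin \o f) ->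
  P.-integrable setT (EFin \o (fun w => - f w)).
Proof. by move=> hf; have := integrableN hf. Qed.

Lemma integrable_sub f g : P.-integrable setT (EFin \o f) ->
  P.-integrable setT (EFin \o g) -> P.-integrable setT (EFin \o (fun w => f w - g w)).
Proof. by move=> hf hg; apply: integrable_add => //; exact: integrable_opp. Qed.

Lemma integrable_abs f : P.-integrable setT (EFin \o f) ->
  P.-integrable setT (EFin \o (fun w => `|f w|)).
Proof. exact: integrable_norm. Qed.

Lemma integrable_measurable f : P.-integrable setT (EFin \o f) -> measurable_fun setT f.
Proof. by move=> /measurable_int /measurable_EFinP. Qed.

Lemma integrable_sqr f : measurable_fun setT f ->
  P.-integrable setT (EFin \o (fun w => f w ^+ 2)) -> P.-integrable setT (EFin \o f).
Proof.
move=> mf f2; apply: (integrable_le mf _ (integrable_add (integrable_cst 1) f2)).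
by move=> w; have := sqr_ge0 (`|f w| - 1); rewrite -(real_normK (num_real (f w))); nra.
Qed.

Lemma ge0_integrable f (c : R) : measurable_fun setT f -> (forall w, 0 <= f w) ->
  (\int[P]_w (f w)%:E <= c%:E)%E -> P.-integrable setT (EFin \o f).
Proof.
move=> mf f0 fc; apply/integrableP; split; first exact/measurable_EFinP.
apply: (@le_lt_trans _ _ c%:E); last exact: ltry.
rewrite (le_trans _ fc) //; apply: ge0_le_integral => //.
- by apply/measurable_EFinP; exact: measurableT_comp.
- exact/measurable_EFinP.
- by move=> w _; rewrite /= lee_fin ger0_norm.
Qed.

Lemma EFin_Rintegral f : P.-integrable setT (EFin \o f) ->
  (\int[P]_w (f w)%:E = (\int[P]_w f w)%:E)%E.
Proof. by move=> hf; rewrite /Rintegral fineK //; exact: integrable_fin_num hf. Qed.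

Lemma Rintegral_prob_cst (k : R) : \int[P]_w k = k.
Proof. by rewrite Rintegral_cst // [X in fine X](probability_setT P) mulr1. Qed.

Lemma RintegralN f : P.-integrable setT (EFin \o f) ->
  \int[P]_w (- f w) = - \int[P]_w f w.
Proof.
move=> hf; rewrite -[RHS]mulN1r -RintegralZl //.
by apply: eq_Rintegral => w _; rewrite mulN1r.
Qed.

Lemma measurable_truncation f g (K : R) : measurable_fun setT f ->
  measurable_fun setT g -> measurable_fun setT (fun w => if K < `|g w| then f w else 0).
Proof.
move=> mf mg; apply: measurable_fun_ifT => //.
by apply: measurable_fun_ltr => //; exact: measurableT_comp.
Qed.

(** Dominated convergence. The cut is on [g] while [f] is integrated, so that one statement serves
    both f = g^2 and f = |g|. *)
Lemma integral_tail f g : measurable_fun setT g -> (forall w, 0 <= f w) ->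
  P.-integrable setT (EFin \o f) -> forall e, 0 < e ->
  exists K : R, 0 < K /\ \int[P]_w (if K < `|g w| then f w else 0) <= e.
Proof.
move=> mg f0 hf e e0; have mf := integrable_measurable hf.
have cv : (\int[P]_w (if n%:R < `|g w| then f w else 0)%:E @[n --> \oo] --> 0%:E)%E.
  have := @dominated_convergence _ _ _ P setT measurableT
    (fun n w => (if n%:R < `|g w| then f w else 0)%:E) (fun=> 0%E) (EFin \o f).
  case.
  - by move=> n; apply/measurable_EFinP; exact: measurable_truncation.
  - exact: measurable_cst.
  - apply: aeW => w _; apply: cvg_near_cst.
    exists (Num.truncn `|g w|).+1 => // n /= gn.
    rewrite ltNge (le_trans (ltW (truncnS_gt _))) ?ler_nat //.
  - exact: hf.
  - apply: aeW => w n _; rewrite lee_fin /=; case: ifP => _; last by rewrite normr0.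
    by rewrite ger0_norm.
  by move=> _ _; rewrite integral0.
have /fine_cvgP[_ /cvgrPdist_le /(_ e e0)[N _ hN]] := cv.
(* The successor makes [K] positive. *)
pose K : R := N.+1%:R; exists K; split => //.
have := hN N.+1 (leqnSn N); rewrite /= sub0r normrN.
by apply: le_trans; exact: ler_norm.
Qed.

End Expectation.

(** * Moments of sums of independent copies *)

Section IIDMoments.
Context {d d'} {T : measurableType d} {U : measurableType d'} {R : realType}.
Variables (P : probability T R) (V : T -> U) (Vs : nat -> T -> U).
Hypotheses (mV : measurable_fun setT V) (hiid : iid_copies P V Vs).
Implicit Types f g : U -> R.

Let mVs i : measurable_fun setT (Vs i) := iid_measurable hiid i.

Let ge0_pair f g i j : i != j ->
  measurable_fun setT f -> measurable_fun setT g ->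
  (forall u, 0 <= f u) -> (forall u, 0 <= g u) ->
  P.-integrable setT (EFin \o (f \o V)) -> P.-integrable setT (EFin \o (g \o V)) ->
  P.-integrable setT (EFin \o (fun w => f (Vs i w) * g (Vs j w))) /\
  \int[P]_w (f (Vs i w) * g (Vs j w)) = (\int[P]_w f (V w)) * (\int[P]_w g (V w)).
Proof.
move=> ij mf mg f0 g0 hf hg; pose h k := if k == i then f else g.
have ji : (j == i) = false by rewrite eq_sym; apply: negbTE.
have prodE (F : nat -> R) : \prod_(k <- [:: i; j]) F k = F i * F j.
  by rewrite !big_cons big_nil mulr1.
have mh k : measurable_fun setT (h k) by rewrite /h; case: eqP.
have h0 k u : 0 <= h k u by rewrite /h; case: eqP.
have hh k : P.-integrable setT (EFin \o (h k \o V)) by rewrite /h; case: eqP.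
have us : uniq [:: i; j] by rewrite /= inE ij.
have hi : h i = f by rewrite /h eqxx.
have hj : h j = g by rewrite /h ji.
have := iid_prod mV hiid mh h0 hh us.
rewrite prodE hi hj; under eq_integral do rewrite prodE hi hj.
move=> E; split; last by rewrite /Rintegral E.
apply: (@ge0_integrable _ _ _ P _
  ((\int[P]_w f (V w)) * (\int[P]_w g (V w)))); last by rewrite E.
- by apply: measurable_funM; apply: measurableT_comp.
- by move=> w; rewrite mulr_ge0.
Qed.

(** [iid_prod] concerns nonnegative functions; signed ones are expanded into the four products of
    positive and negative parts. *)
Lemma iid_pair f g i j : i != j ->
  measurable_fun setT f -> measurable_fun setT g ->
  P.-integrable setT (EFin \o (f \o V)) -> P.-integrable setT (EFin \o (g \o V)) ->
  P.-integrable setT (EFin \o (fun w => f (Vs i w) * g (Vs j w))) /\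
  \int[P]_w (f (Vs i w) * g (Vs j w)) = (\int[P]_w f (V w)) * (\int[P]_w g (V w)).
Proof.
move=> ij mf mg hf hg.
pose pos (h : U -> R) u := Num.max (h u) 0; pose neg (h : U -> R) u := Num.max (- h u) 0.
have mpos h : measurable_fun setT h -> measurable_fun setT (pos h).
  by move=> mh; apply: measurable_maxr.
have mneg h : measurable_fun setT h -> measurable_fun setT (neg h).
  by move=> mh; apply: measurable_maxr => //; exact: measurableT_comp.
have pos0 h u : 0 <= pos h u by rewrite /pos le_max lexx orbT.
have neg0 h u : 0 <= neg h u by rewrite /neg le_max lexx orbT.
have pnE h u : h u = pos h u - neg h u.
  by rewrite /pos /neg; case: (leP (h u) 0); case: (leP (- h u) 0); lra.
have ipos h : measurable_fun setT h -> P.-integrable setT (EFin \o (h \o V)) ->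
    P.-integrable setT (EFin \o (pos h \o V)).
  move=> mh; move/integrable_abs; apply: integrable_le.
    by apply: measurableT_comp => //; exact: mpos.
  by move=> w; rewrite /= ger0_norm ?pos0 // /pos ge_max ler_norm normr_ge0.
have ineg h : measurable_fun setT h -> P.-integrable setT (EFin \o (h \o V)) ->
    P.-integrable setT (EFin \o (neg h \o V)).
  move=> mh; move/integrable_abs; apply: integrable_le.
    by apply: measurableT_comp => //; exact: mneg.
  by move=> w; rewrite /= ger0_norm ?neg0 // /neg ge_max -normrN ler_norm normr_ge0.
have EpnE h : measurable_fun setT h -> P.-integrable setT (EFin \o (h \o V)) ->
    \int[P]_w h (V w) = \int[P]_w pos h (V w) - \int[P]_w neg h (V w).
  move=> mh hh; rewrite -RintegralB //; [|exact: ipos|exact: ineg].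
  by apply: eq_Rintegral => w _; exact: pnE.
have [pp Epp] := ge0_pair ij (mpos f mf) (mpos g mg) (pos0 f) (pos0 g)
  (ipos f mf hf) (ipos g mg hg).
have [pn Epn] := ge0_pair ij (mpos f mf) (mneg g mg) (pos0 f) (neg0 g)
  (ipos f mf hf) (ineg g mg hg).
have [np Enp] := ge0_pair ij (mneg f mf) (mpos g mg) (neg0 f) (pos0 g)
  (ineg f mf hf) (ipos g mg hg).
have [nn Enn] := ge0_pair ij (mneg f mf) (mneg g mg) (neg0 f) (neg0 g)
  (ineg f mf hf) (ineg g mg hg).
pose A w := pos f (Vs i w) * pos g (Vs j w) - pos f (Vs i w) * neg g (Vs j w).
pose B w := neg f (Vs i w) * pos g (Vs j w) - neg f (Vs i w) * neg g (Vs j w).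
have iA := integrable_sub pp pn; have iB := integrable_sub np nn.
have fgE : (fun w => f (Vs i w) * g (Vs j w)) = (fun w => A w - B w).
  by apply/funext => w; rewrite (pnE f) (pnE g) /A /B; ring.
rewrite fgE; split; first exact: integrable_sub.
rewrite RintegralB // RintegralB // RintegralB // Epp Epn Enp Enn.
by rewrite (EpnE f) // (EpnE g) //; ring.
Qed.

Definition partial_sum g n w : R := \sum_(k < n) g (Vs k w).

Lemma measurable_partial_sum g n : measurable_fun setT g ->
  measurable_fun setT (partial_sum g n).
Proof. by move=> mg; apply: measurable_sum => k; exact: measurableT_comp. Qed.

(** Independence and centering remove the off-diagonal products, so only the [n] squares remain. *)
Lemma partial_sum_sqr g n : measurable_fun setT g ->
  P.-integrable setT (EFin \o (fun w => g (V w) ^+ 2)) -> \int[P]_w g (V w) = 0 ->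
  P.-integrable setT (EFin \o (fun w => partial_sum g n w ^+ 2)) /\
  \int[P]_w (partial_sum g n w ^+ 2) = n%:R * \int[P]_w (g (V w) ^+ 2).
Proof.
move=> mg g2 g0; have mgV : measurable_fun setT (g \o V) by exact: measurableT_comp.
have ig := integrable_sqr mgV g2.
have mg2 : measurable_fun setT (fun u => g u ^+ 2) by exact: measurable_funX.
have pairs (i j : 'I_n) :
    P.-integrable setT (EFin \o (fun w => g (Vs i w) * g (Vs j w))) /\
    \int[P]_w (g (Vs i w) * g (Vs j w)) =
    (if i == j then \int[P]_w (g (V w) ^+ 2) else 0).
  have [<-|ij] := eqVneq i j; last first.
    have [ii ->] := @iid_pair g g i j ij mg mg ig ig.
    by rewrite g0 mulr0.
  split; last by rewrite -(iid_Rintegral mV hiid i mg2).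
  by have := iid_integrable mV hiid i mg2 g2; apply: eq_integrable => // w _.
have SE w : partial_sum g n w ^+ 2 =
    \sum_(i < n) \sum_(j < n) g (Vs i w) * g (Vs j w).
  by rewrite expr2 /partial_sum mulr_suml; apply: eq_bigr => i _; rewrite mulr_sumr.
rewrite (funext SE); split.
  apply: integrable_fin_sum => // i; apply: integrable_fin_sum => // j.
  exact: (pairs i j).1.
rewrite Rintegral_sum //; last first.
  by move=> i; apply: integrable_fin_sum => // j; exact: (pairs i j).1.
transitivity (\sum_(i < n) \int[P]_w (g (V w) ^+ 2)); last first.
  by rewrite sumr_const card_ord mulr_natl.
apply: eq_bigr => i _; rewrite Rintegral_sum //; last by move=> j; exact: (pairs i j).1.
rewrite (bigD1 i) //= (pairs i i).2 eqxx big1 ?addr0 // => j ji.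
by rewrite (pairs i j).2 eq_sym (negbTE ji).
Qed.

(** exp x <= 1 / (1 - x) follows from exp (- x) >= 1 - x, and (1 - x) (1 + x + 2 x^2) = 1 + x^2 (1 -
    2 x) is at least 1 for x <= 1/2. *)
Lemma expR_le_quadratic (x : R) : `|x| <= 2^-1 -> expR x <= 1 + x + 2 * x ^+ 2.
Proof.
rewrite ler_norml => /andP[x1 x2]; have h := expR_ge1Dx (- x).
have x0 : 0 < 1 - x by lra.
rewrite -[x in expR x]opprK expRN.
apply: (@le_trans _ _ (1 - x)^-1); first by rewrite lef_pV2 ?posrE ?expR_gt0.
by rewrite -[leLHS]mul1r ler_pdivrMr //; nra.
Qed.

(** For y >= 0, exp y is the fourth power of exp (y / 4) >= y / 4, whence the constant; adding the
    two exponentials covers both signs. *)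
Lemma pow4_le_expR (x : R) : x ^+ 4 <= 4 ^+ 4 * (expR x + expR (- x)).
Proof.
have c0 : (0 : R) < 4 ^+ 4 by apply: exprn_gt0.
move: {+}c0; set c := 4 ^+ 4 => c_gt0.
have key (y : R) : 0 <= y -> y ^+ 4 <= c * expR y.
  move=> y0; have h := expR_ge1Dx (y / 4).
  have yE : y = 4%:R * (y / 4) by rewrite mulrC divfK.
  rewrite [y in expR y]yE expRM_natl -exprMn ler_pXn2r //.
  - by rewrite {1}yE ler_pM2l // (le_trans _ h) // lerDr.
  - by rewrite nnegrE mulr_ge0 ?expR_ge0.
have [x0|x0] := leP 0 x.
  by apply: (le_trans (key _ x0)); rewrite ler_pM2l // lerDl expR_ge0.
have -> : x ^+ 4 = (- x) ^+ 4 by ring.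
by apply: (le_trans (key _ _)); rewrite ?oppr_ge0 ?(ltW x0) // ler_pM2l // lerDr expR_ge0.
Qed.

(** By independence the exponential factorizes. The condition [4 * K ^+ 2 <= n%:R] puts each
    exponent in [-1/2, 1/2], where the quadratic bound and centering give a factor at most 1 + 2 K^2
    / n; its n-th power is at most exp (2 K^2), whatever n. *)
Lemma exp_moment g n (K : R) : measurable_fun setT g ->
  0 <= K -> (forall u, `|g u| <= K) ->
  \int[P]_w g (V w) = 0 -> (0 < n)%N -> 4 * K ^+ 2 <= n%:R ->
  (\int[P]_w (expR ((Num.sqrt n%:R)^-1 * partial_sum g n w))%:E <=
   (expR (2 * K ^+ 2))%:E)%E.
Proof.
move=> mg K0 gK g0 n0 Kn; set s := (Num.sqrt n%:R)^-1.
have s0 : 0 < s by rewrite invr_gt0 sqrtr_gt0 ltr0n.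
have s2 : s ^+ 2 = n%:R^-1 by rewrite /s exprVn sqr_sqrtr.
have sg u : `|s * g u| <= 2^-1.
  rewrite -(ler_pXn2r (n := 2)) ?nnegrE ?invr_ge0 // real_normK ?num_real //.
  rewrite exprMn s2 mulrC ler_pdivrMr ?ltr0n //.
  have : g u ^+ 2 <= K ^+ 2.
    by rewrite -(real_normK (num_real (g u))) ler_pXn2r ?nnegrE ?K0.
  by rewrite exprVn; lra.
pose h (k : nat) u := expR (s * g u).
have msg : measurable_fun setT (fun u => s * g u) by exact: measurable_funM.
have mh k : measurable_fun setT (h k) by exact: measurableT_comp.
have h0 k u : 0 <= h k u by exact: expR_ge0.
have hq k u : h k u <= 1 + s * g u + 2 * (s * g u) ^+ 2 := expR_le_quadratic (sg u).
have bounded_int (f : U -> R) c : measurable_fun setT f -> (forall u, `|f u| <= c) ->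
    P.-integrable setT (EFin \o (f \o V)).
  move=> mf fc; apply: (integrable_le _ _ (integrable_cst P c)).
    exact: measurableT_comp.
  by move=> w; exact: fc.
have ih k : P.-integrable setT (EFin \o (h k \o V)).
  apply: (bounded_int _ 2) => // u; rewrite ger0_norm // (le_trans (hq k u)) //.
  have := sg u; have := ler_norm (s * g u); rewrite -(real_normK (num_real (s * g u))).
  have := normr_ge0 (s * g u); nra.
have iotaE (F : nat -> R) : \prod_(i <- iota 0 n) F i = \prod_(i < n) F i.
  by rewrite -(big_mkord xpredT) /index_iota subn0.
have us := iota_uniq 0 n.
have := iid_prod mV hiid mh h0 ih us.
have -> : (\int[P]_w (\prod_(i <- iota 0 n) h i (Vs i w))%:E =
    \int[P]_w (expR (s * partial_sum g n w))%:E)%E.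
  apply: eq_integral => w _; congr (_%:E).
  by rewrite iotaE /partial_sum mulr_sumr expR_sum.
move=> ->; rewrite lee_fin iotaE.
have Eh k : \int[P]_w h k (V w) <= 1 + 2 * K ^+ 2 / n%:R.
  have ig : P.-integrable setT (EFin \o (g \o V)) := bounded_int _ _ mg gK.
  apply: (@le_trans _ _ (\int[P]_w (1 + 2 * K ^+ 2 / n%:R + s * g (V w)))).
    apply: le_Rintegral => //; first exact: (ih k).
      by apply: integrable_add; [exact: integrable_cst|exact: integrable_scale].
    move=> w _; rewrite (le_trans (hq k _)) // addrAC lerD2r // lerD2l.
    rewrite -mulrA ler_pM2l // exprMn s2 mulrC ler_wpM2r ?invr_ge0 //.
    by rewrite -(real_normK (num_real (g _))) ler_pXn2r ?nnegrE ?K0.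
  rewrite RintegralD //; [|exact: integrable_cst|exact: integrable_scale].
  by rewrite Rintegral_prob_cst RintegralZl // g0 mulr0 addr0.
have Eh0 k : 0 <= \int[P]_w h k (V w) by apply: Rintegral_ge0.
apply: (@le_trans _ _ (\prod_(i < n) (1 + 2 * K ^+ 2 / n%:R))).
  by apply: ler_prod => i _; rewrite Eh0 Eh.
rewrite prodr_const card_ord.
have KE : n%:R * (2 * K ^+ 2 / n%:R) = 2 * K ^+ 2.
  by rewrite mulrC divfK // pnatr_eq0 -lt0n.
rewrite -[X in expR X]KE expRM_natl lerXn2r ?nnegrE ?expR_ge0 ?expR_ge1Dx //.
by rewrite addr_ge0 // divr_ge0 // mulr_ge0 // sqr_ge0.
Qed.

End IIDMoments.

(** * Truncation: uniform integrability and the law of large numbers *)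

Section UniformIntegrability.
Context {d d'} {T : measurableType d} {U : measurableType d'} {R : realType}.
Variables (P : probability T R) (V : T -> U) (Vs : nat -> T -> U).
Hypotheses (mV : measurable_fun setT V) (hiid : iid_copies P V Vs).
Implicit Types f g : U -> R.

Let S g n w := partial_sum Vs g n w.
Let N g n w := (Num.sqrt n%:R)^-1 * S g n w.

Lemma partial_sumD f g n w :
  partial_sum Vs (fun u => f u + g u) n w = partial_sum Vs f n w + partial_sum Vs g n w.
Proof. by rewrite /partial_sum -big_split. Qed.

Lemma partial_sumN g n w :
  partial_sum Vs (fun u => - g u) n w = - partial_sum Vs g n w.
Proof. by rewrite /partial_sum sumrN. Qed.

Lemma expr4E (x : R) : x ^+ 4 = (x ^+ 2) ^+ 2.
Proof. by rewrite -exprM. Qed.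

(** Instead of an expansion over quadruples of indices, the fourth power is dominated by two
    exponentials, bounded by [exp_moment] for [g] and for [- g]. *)
Lemma partial_sum_pow4 g n (K : R) : measurable_fun setT g ->
  0 <= K -> (forall u, `|g u| <= K) ->
  \int[P]_w g (V w) = 0 -> (0 < n)%N -> 4 * K ^+ 2 <= n%:R ->
  P.-integrable setT
    (EFin \o (fun w => ((Num.sqrt n%:R)^-1 * partial_sum Vs g n w) ^+ 4)) /\
  \int[P]_w (((Num.sqrt n%:R)^-1 * partial_sum Vs g n w) ^+ 4) <=
    4 ^+ 4 * (expR (2 * K ^+ 2) + expR (2 * K ^+ 2)).
Proof.
move=> mg K0 gK g0 n0 Kn; rewrite -/(S _ _ _).
under eq_fun do rewrite -/(S _ _ _) -/(N _ _ _).
have ig : P.-integrable setT (EFin \o (g \o V)).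
  apply: (integrable_le _ _ (integrable_cst P K)); first exact: measurableT_comp.
  by move=> w; exact: gK.
have h1 := exp_moment mV hiid mg K0 gK g0 n0 Kn.
have h2 := @exp_moment _ _ _ _ _ P V Vs mV hiid (fun u => - g u) n K.
have {}h2 : (\int[P]_w (expR (- N g n w))%:E <= (expR (2 * K ^+ 2))%:E)%E.
  have -> : (fun w => (expR (- N g n w))%:E) = (fun w => (expR ((Num.sqrt n%:R)^-1 *
      partial_sum Vs (fun u => - g u) n w))%:E).
    by apply/funext => w; rewrite partial_sumN mulrN.
  apply: h2 => //.
  - exact: measurableT_comp.
  - by move=> u; rewrite normrN.
  - by rewrite RintegralN // g0 oppr0.
have mN : measurable_fun setT (N g n).
  by apply: measurable_funM => //; exact: (measurable_partial_sum hiid).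
have m1 : measurable_fun setT (fun w => expR (N g n w)) by exact: measurableT_comp.
have m2 : measurable_fun setT (fun w => expR (- N g n w)).
  by apply: measurableT_comp => //; exact: measurableT_comp.
have i1 := ge0_integrable m1 (fun w => expR_ge0 _) h1.
have i2 := ge0_integrable m2 (fun w => expR_ge0 _) h2.
have i12 := integrable_scale (4 ^+ 4) (integrable_add i1 i2).
have i4 : P.-integrable setT (EFin \o (fun w => N g n w ^+ 4)).
  apply: integrable_le i12; first exact: measurable_funX.
  move=> w; rewrite ger0_norm ?pow4_le_expR //.
  by rewrite expr4E sqr_ge0.
split=> //; rewrite EFin_Rintegral // lee_fin in h1.
rewrite EFin_Rintegral // lee_fin in h2.
apply: (@le_trans _ _ (\int[P]_w (4 ^+ 4 * (expR (N g n w) + expR (- N g n w))))).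
  by apply: le_Rintegral => // w _; exact: pow4_le_expR.
rewrite RintegralZl //; last exact: integrable_add.
by rewrite ler_wpM2l ?exprn_ge0 // RintegralD // lerD.
Qed.

Lemma nat_ge_eventually (x : R) : exists m : nat, forall n, (m <= n)%N ->
  (0 < n)%N /\ x <= n%:R.
Proof.
exists (Num.truncn `|x|).+1 => n mn; split; first exact: leq_trans mn.
by rewrite (le_trans (ler_norm x)) // (le_trans (ltW (truncnS_gt _))) // ler_nat.
Qed.

(** Second moments alone do not bound the tails uniformly, so [g] is cut at a level [K]: the bounded
    part [a] has normalized sums with fourth moments at most [C] for large [n], and those of the
    tail part [b] have variance at most [e / 4]. *)
Lemma partial_sum_ui g : measurable_fun setT g ->
  P.-integrable setT (EFin \o (fun w => g (V w) ^+ 2)) -> \int[P]_w g (V w) = 0 ->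
  forall e, 0 < e -> exists (L : R) (m : nat), 0 < L /\ forall n, (m <= n)%N ->
    \int[P]_w Num.max (((Num.sqrt n%:R)^-1 * partial_sum Vs g n w) ^+ 2 - L) 0 <= e.
Proof.
move=> mg g2 g0 e e0.
have mgV : measurable_fun setT (g \o V) by exact: measurableT_comp.
have ig := integrable_sqr mgV g2.
have e40 : 0 < e / 4 by rewrite divr_gt0.
have [K [K0 hK]] := integral_tail mgV (fun w => sqr_ge0 (g (V w))) g2 e40.
pose h u := if K < `|g u| then g u else 0.
have mh : measurable_fun setT h by exact: measurable_truncation.
have mhV : measurable_fun setT (h \o V) by exact: measurableT_comp.
have hg u : `|h u| <= `|g u| by rewrite /h; case: ifP => // _; rewrite normr0.
have ih : P.-integrable setT (EFin \o (h \o V)).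
  by apply: integrable_le (integrable_abs ig) => // w; exact: hg.
have ih2 : P.-integrable setT (EFin \o (fun w => h (V w) ^+ 2)).
  apply: integrable_le g2; first exact: measurable_funX.
  move=> w; rewrite ger0_norm ?sqr_ge0 // -real_normK ?num_real //.
  by rewrite -[leRHS]real_normK ?num_real // ler_pXn2r ?nnegrE //; exact: hg.
have Eh2 : \int[P]_w (h (V w) ^+ 2) <= e / 4.
  apply: le_trans hK; rewrite le_eqVlt; apply/orP; left; apply/eqP.
  by apply: eq_Rintegral => w _; rewrite /h; case: ifP => // _; rewrite expr0n.
pose m := \int[P]_w h (V w).
(* Both parts are recentered: as [g] has mean 0, the bounded part [g - h] has mean [- m]. *)
pose a u := g u - h u + m; pose b u := h u - m.
have ma : measurable_fun setT a.
  by apply: measurable_funD => //; exact: measurable_funB.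
have mb : measurable_fun setT b by exact: measurable_funB.
have aK u : `|a u| <= K + `|m|.
  rewrite /a (le_trans (ler_normD _ _)) // lerD2r /h.
  by case: ltP => [_|//]; rewrite ?subrr ?subr0 ?normr0 ?(ltW K0).
have iconst := integrable_cst P m.
have Ea : \int[P]_w a (V w) = 0.
  rewrite /a RintegralD //; last exact: integrable_sub.
  by rewrite RintegralB // g0 sub0r Rintegral_prob_cst addrC subrr.
have Eb : \int[P]_w b (V w) = 0.
  by rewrite /b RintegralB // Rintegral_prob_cst subrr.
have ib2 : P.-integrable setT (EFin \o (fun w => b (V w) ^+ 2)).
  have := integrable_add (integrable_sub ih2 (integrable_scale (2 * m) ih))
    (integrable_cst P (m ^+ 2)).
  by apply: eq_integrable => // w _; rewrite /= /b; congr (_%:E); ring.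
have Eb2 : \int[P]_w (b (V w) ^+ 2) <= e / 4.
  apply: le_trans Eh2.
  have -> : \int[P]_w (b (V w) ^+ 2) =
      \int[P]_w (h (V w) ^+ 2 - (2 * m) * h (V w) + m ^+ 2).
    by apply: eq_Rintegral => w _; rewrite /b; ring.
  rewrite RintegralD //; last 2 first.
  - by apply: integrable_sub => //; exact: integrable_scale.
  - exact: integrable_cst.
  rewrite RintegralB //; last exact: integrable_scale.
  rewrite RintegralZl // Rintegral_prob_cst -/m.
  by have := sqr_ge0 m; nra.
set Ka := K + `|m| in aK; have Ka0 : 0 <= Ka by rewrite addr_ge0 // ltW.
pose C := 4 ^+ 4 * (expR (2 * Ka ^+ 2) + expR (2 * Ka ^+ 2)) : R.
have C0 : 0 <= C by rewrite mulr_ge0 ?addr_ge0 ?expR_ge0 // exprn_ge0.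
have [n1 hn1] := nat_ge_eventually (4 * Ka ^+ 2).
(* Makes the fourth moment term [C / L] at most [e / 2]; the variance term contributes
   [2 * (e / 4)]. *)
pose L := 2 * C / e + 1.
have L0 : 0 < L by rewrite ltr_wpDl // divr_ge0 ?mulr_ge0 ?(ltW e0).
exists L, n1; split => // n /hn1[n0 Kn].
have [iA4 EA4] := partial_sum_pow4 ma Ka0 aK Ea n0 Kn.
have [iB2 EB2] := partial_sum_sqr mV hiid n mb ib2 Eb.
rewrite -/C in EA4.
have n00 : (0 : R) < n%:R by rewrite ltr0n.
have s2 : (Num.sqrt n%:R)^-1 ^+ 2 = n%:R^-1 :> R by rewrite exprVn sqr_sqrtr.
have gab w : N g n w = N a n w + N b n w.
  rewrite /N -mulrDr /S -partial_sumD; congr (_ * _).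
  by apply: eq_bigr => k _; rewrite /a /b; ring.
have iN2 : P.-integrable setT (EFin \o (fun w => N b n w ^+ 2)).
  have := integrable_scale n%:R^-1 iB2; apply: eq_integrable => // w _.
  by rewrite /= /N exprMn s2.
have EN2 : \int[P]_w (N b n w ^+ 2) <= e / 4.
  have -> : \int[P]_w (N b n w ^+ 2) = \int[P]_w (n%:R^-1 * S b n w ^+ 2).
    by apply: eq_Rintegral => w _; rewrite /N exprMn s2.
  by rewrite RintegralZl // EB2 mulrA mulVf ?mul1r // gt_eqF.
apply: (@le_trans _ _ (\int[P]_w (L^-1 * N a n w ^+ 4 + 2 * N b n w ^+ 2))).
  have iR := integrable_add (integrable_scale L^-1 iA4) (integrable_scale 2 iN2).
  (* (2 x^2 - L)^+ <= x^4 / L, where x is the bounded part of the sum. *)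
  have pw w : Num.max (N g n w ^+ 2 - L) 0 <= L^-1 * N a n w ^+ 4 + 2 * N b n w ^+ 2.
    rewrite ge_max; apply/andP; split; last first.
      by rewrite expr4E addr_ge0 // mulr_ge0 ?sqr_ge0 // invr_ge0 ltW.
    rewrite gab; move: (N a n w) (N b n w) => x y.
    have h1 : 2 * x ^+ 2 - L <= L^-1 * x ^+ 4.
      rewrite ler_pdivlMl //; move: (L) => L'.
      by have := sqr_ge0 (x ^+ 2 - L'); rewrite expr4E; nra.
    by have := sqr_ge0 (x - y); nra.
  have iM : P.-integrable setT (EFin \o (fun w => Num.max (N g n w ^+ 2 - L) 0)).
    apply: integrable_le iR.
      apply: measurable_maxr => //; apply: measurable_funB => //.
      apply: measurable_funX; apply: measurable_funM => //.
      exact: (measurable_partial_sum hiid).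
    by move=> w; rewrite ger0_norm ?pw // le_max lexx orbT.
  by apply: le_Rintegral => // w _; exact: pw.
rewrite RintegralD //; [|exact: integrable_scale..].
rewrite !RintegralZl //.
have : L^-1 * C <= e / 2.
  rewrite mulrC ler_pdivrMr // /L mulrDr mulr1.
  have -> : e / 2 * (2 * C / e) = C by field; rewrite gt_eqF.
  by rewrite lerDl divr_ge0 // ltW.
have : L^-1 * \int[P]_w (N a n w ^+ 4) <= L^-1 * C.
  by rewrite ler_wpM2l // invr_ge0 ltW.
by move: EN2; rewrite /N /S; lra.
Qed.

(** With only a first moment, the truncated part is controlled by its variance and the tail [h] by
    its small absolute moment, uniformly in [n]. *)
Lemma partial_sum_lln g : measurable_fun setT g ->
  P.-integrable setT (EFin \o (g \o V)) ->
  forall e, 0 < e -> exists m : nat, forall n, (m <= n)%N ->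
    P.-integrable setT
      (EFin \o (fun w => `|n%:R^-1 * partial_sum Vs g n w - \int[P]_w g (V w)|)) /\
    \int[P]_w `|n%:R^-1 * partial_sum Vs g n w - \int[P]_w g (V w)| <= e.
Proof.
move=> mg ig e e0.
have mgV : measurable_fun setT (g \o V) by exact: measurableT_comp.
have e40 : 0 < e / 4 by rewrite divr_gt0.
have [K [K0 hK]] := integral_tail mgV (fun w => normr_ge0 (g (V w)))
  (integrable_abs ig) e40.
pose h u := if K < `|g u| then g u else 0.
have mh : measurable_fun setT h by exact: measurable_truncation.
have mhV : measurable_fun setT (h \o V) by exact: measurableT_comp.
have hg u : `|h u| <= `|g u| by rewrite /h; case: ifP => // _; rewrite normr0.
have ih : P.-integrable setT (EFin \o (h \o V)).
  by apply: integrable_le (integrable_abs ig) => // w; exact: hg.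
have Eh : \int[P]_w `|h (V w)| <= e / 4.
  apply: le_trans hK; rewrite le_eqVlt; apply/orP; left; apply/eqP.
  by apply: eq_Rintegral => w _; rewrite /h; case: ifP => // _; rewrite normr0.
pose m := \int[P]_w (g (V w) - h (V w)).
pose a u := g u - h u - m.
have igh := integrable_sub ig ih.
have ma : measurable_fun setT a.
  by apply: measurable_funB => //; exact: measurable_funB.
have aK u : `|a u| <= K + `|m|.
  rewrite /a (le_trans (ler_normB _ _)) // lerD2r /h.
  by case: ltP => [_|//]; rewrite ?subrr ?subr0 ?normr0 ?(ltW K0).
have Ea : \int[P]_w a (V w) = 0.
  by rewrite /a RintegralB // ?Rintegral_prob_cst ?subrr //; exact: integrable_cst.
have ia2 : P.-integrable setT (EFin \o (fun w => a (V w) ^+ 2)).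
  apply: (integrable_le _ _ (integrable_cst P ((K + `|m|) ^+ 2))).
    by apply: measurable_funX; exact: measurableT_comp.
  move=> w; rewrite [leLHS]ger0_norm ?sqr_ge0 // -[leLHS]real_normK ?num_real //.
  by rewrite ler_pXn2r ?nnegrE ?addr_ge0 ?(ltW K0) //; exact: aK.
pose va := \int[P]_w (a (V w) ^+ 2).
have va0 : 0 <= va by apply: Rintegral_ge0 => w _; exact: sqr_ge0.
(* From this size on, the variance term [va / (e * n)] is at most [e / 4]. *)
have [n1 hn1] := nat_ge_eventually (4 * va / e ^+ 2).
exists n1 => n /hn1[n0 nva].
have n00 : (0 : R) < n%:R by rewrite ltr0n.
have [iA2 EA2] := partial_sum_sqr mV hiid n ma ia2 Ea.
have mabsh : measurable_fun setT (fun u => `|h u|) by exact: measurableT_comp.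
have iabsh : P.-integrable setT (EFin \o (fun w => `|h (V w)|)) by exact: integrable_abs.
have ihk (k : 'I_n) : P.-integrable setT (EFin \o (fun w => `|h (Vs k w)|)).
  exact: (iid_integrable mV hiid k mabsh iabsh).
have iSh : P.-integrable setT (EFin \o (S (fun u => `|h u|) n)).
  exact: integrable_fin_sum.
have ESh : \int[P]_w S (fun u => `|h u|) n w = n%:R * \int[P]_w `|h (V w)|.
  rewrite /S /partial_sum Rintegral_sum // mulr_natl -[in RHS](card_ord n) -sumr_const.
  by apply: eq_bigr => k _; rewrite (iid_Rintegral mV hiid k mabsh).
(* The first two terms are |x| <= e / 4 + x^2 / e for the sample mean x of the centered truncation
   [a]; the last two bound the tail and its expectation. Each of the four integrates to at most
   [e / 4]. *)
pose F w := e / 4 + e^-1 * ((n%:R^-1) ^+ 2 * S a n w ^+ 2) +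
  n%:R^-1 * S (fun u => `|h u|) n w + \int[P]_w `|h (V w)|.
have iF1 : P.-integrable setT (EFin \o (fun w => e / 4 +
    e^-1 * ((n%:R^-1) ^+ 2 * S a n w ^+ 2))).
  apply: integrable_add; first exact: integrable_cst.
  by apply: integrable_scale; exact: integrable_scale.
have iF2 := integrable_add iF1 (integrable_scale n%:R^-1 iSh).
have iF : P.-integrable setT (EFin \o F).
  by apply: integrable_add iF2 _; exact: integrable_cst.
have pw w : `|n%:R^-1 * S g n w - \int[P]_w g (V w)| <= F w.
  have gE : \int[P]_w g (V w) = m + \int[P]_w h (V w) by rewrite /m RintegralB // subrK.
  have SgE : n%:R^-1 * S g n w - \int[P]_w g (V w) =
      n%:R^-1 * S a n w + n%:R^-1 * S h n w - \int[P]_w h (V w).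
    have -> : S g n w = S a n w + S h n w + n%:R * m.
      rewrite /S -partial_sumD mulr_natl -[in X in _ + X](card_ord n) -sumr_const.
      by rewrite -big_split; apply: eq_bigr => k _ /=; rewrite /a; ring.
    by rewrite gE !mulrDr [n%:R^-1 * (n%:R * m)]mulrA mulVf ?gt_eqF // mul1r; ring.
  rewrite SgE (le_trans (ler_normB _ _)) // /F; apply: lerD; last first.
    exact: le_normr_Rintegral.
  rewrite (le_trans (ler_normD _ _)) //; apply: lerD; last first.
    rewrite normrM ger0_norm ?invr_ge0 ?ler0n // ler_wpM2l ?invr_ge0 ?ler0n //.
    exact: ler_norm_sum.
  rewrite -exprMn; move: (_ * S a n w) => x.
  have := sqr_ge0 (`|x| - e / 2); rewrite -[x ^+ 2]real_normK ?num_real // => q.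
  by rewrite -lerBlDl ler_pdivlMl //; nra.
have iabs : P.-integrable setT
    (EFin \o (fun w => `|n%:R^-1 * S g n w - \int[P]_w g (V w)|)).
  apply: integrable_le iF; last by move=> w; rewrite normr_id pw.
  apply: measurableT_comp => //; apply: measurable_funB => //.
  by apply: measurable_funM => //; exact: (measurable_partial_sum hiid).
split=> //; apply: (@le_trans _ _ (\int[P]_w F w)); first exact: le_Rintegral.
rewrite /F RintegralD //; last exact: integrable_cst.
rewrite RintegralD //; last exact: integrable_scale.
rewrite RintegralD //; last 2 first.
- exact: integrable_cst.
- by apply: integrable_scale; exact: integrable_scale.
rewrite !Rintegral_prob_cst RintegralZl //; last exact: integrable_scale.
rewrite RintegralZl // RintegralZl // ESh EA2 -/va.
have -> : n%:R^-1 ^+ 2 * (n%:R * va) = va / n%:R by field; rewrite gt_eqF.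
have -> : n%:R^-1 * (n%:R * \int[P]_w `|h (V w)|) = \int[P]_w `|h (V w)|.
  by rewrite mulrA mulVf ?mul1r // gt_eqF.
have : e^-1 * (va / n%:R) <= e / 4.
  rewrite mulrA ler_pdivrMr // mulrC ler_pdivrMr //.
  by move: nva; rewrite ler_pdivrMr ?exprn_gt0 //; nra.
by move: Eh; lra.
Qed.

End UniformIntegrability.

(** * Expectation of a limit in law *)

(* No measurability is required: the integral of a nonnegative function is its
   lower integral. *)
Lemma ge0_le_integral_nonmeasurable d (T : measurableType d) (R : realType)
    (P : {measure set T -> \bar R}) (f g : T -> \bar R) :
  (forall x, 0 <= f x)%E -> (forall x, f x <= g x)%E ->
  (\int[P]_x f x <= \int[P]_x g x)%E.
Proof.
move=> f0 fg; rewrite !ge0_integralTE //; last by move=> x; exact: le_trans (fg x).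
apply: ereal_sup_le => _ [h hf <-]; exists h => // x.
exact: le_trans (fg x).
Qed.

Section LimitExpectation.
Context {d} {T : measurableType d} {R : realType}.

Variable P : probability T R.
Context {d'} {T' : measurableType d'} (P' : probability T' R) (W : T' -> R).
Hypothesis mW : measurable_fun setT W.
Variables (Un Vn : nat -> T -> R) (C : R).
Hypothesis UW : cvg_in_law P Un P' W.
Hypothesis mVn : forall n, measurable_fun setT (Vn n).
Hypothesis Vn0 : forall n w, 0 <= Vn n w.
Hypothesis close : forall K e, 0 < K -> 0 < e -> exists N, forall n, (N <= n)%N ->
  exists Rn : T -> R, [/\ P.-integrable setT (EFin \o Rn), \int[P]_w Rn w <= e,
    forall w, 0 <= Rn w & forall w, Num.min `|Un n w - Vn n w| K <= Rn w].

(** [Un] carries no measurability, so the integral of [f (Un n w)] is squeezed between those of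
    functions built from [Vn] and [Rn]. A 1-Lipschitz [f] with values in [0, K] moves by at most min
    (|x - y|, K), exactly what [close] controls. *)
Lemma law_limit_bounds (f : R -> R) (K A B : R) : 0 < K ->
  (forall x, 0 <= f x <= K) -> (forall x y, `|f x - f y| <= `|x - y|) ->
  (exists N, forall n, (N <= n)%N -> A <= \int[P]_w f (Vn n w) <= B) ->
  A <= \int[P']_w f (W w) <= B.
Proof.
move=> K0 fK flip [N0 hN0].
have cf : continuous f.
  move=> x; apply/cvgrPdist_lt => e e0; exists e => //= y.
  exact: le_lt_trans (flip _ _).
have f0 x : 0 <= f x by case/andP: (fK x).
have fleK x : f x <= K by case/andP: (fK x).
have mf : measurable_fun setT f by exact: continuous_measurable_fun.
have fbd : exists M, forall x, `|f x| <= M.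
  by exists K => x; rewrite ger0_norm.
have iW : P'.-integrable setT (EFin \o (fun w => f (W w))).
  apply: (integrable_le _ _ (integrable_cst P' K)); first exact: measurableT_comp.
  by move=> w; rewrite ger0_norm.
have iV n : P.-integrable setT (EFin \o (fun w => f (Vn n w))).
  apply: (integrable_le _ _ (integrable_cst P K)); first exact: measurableT_comp.
  by move=> w; rewrite ger0_norm.
have := UW cf fbd; rewrite unlock /= EFin_Rintegral // => cv.
have key e : 0 < e -> \forall n \near \oo,
    ((A - e)%:E <= \int[P]_w (f (Un n w))%:E <= (B + e)%:E)%E.
  move=> e0; have [N hN] := close K0 e0.
  exists (maxn N N0) => // n /=; rewrite geq_max.
  move=> /andP[/hN[Rn [iR ER R0 hR]] /hN0 /andP[An Bn]].
  have fR w : `|f (Un n w) - f (Vn n w)| <= Rn w.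
    apply: le_trans (hR w); rewrite le_min flip /= ler_norml.
    by have := f0 (Un n w); have := f0 (Vn n w); have := fleK (Un n w);
       have := fleK (Vn n w); lra.
  apply/andP; split.
    (* Cut at 0, because the comparison with the possibly nonmeasurable [f (Un n w)] is between
       nonnegative functions. *)
    pose h w := Num.max (f (Vn n w) - Rn w) 0.
    have iVR := integrable_sub (iV n) iR.
    have ih : P.-integrable setT (EFin \o h).
      apply: integrable_le (integrable_abs iVR).
        by apply: measurable_maxr => //; exact: integrable_measurable iVR.
      move=> w; rewrite ger0_norm ?le_max ?lexx ?orbT //.
      by rewrite ge_max ler_norm normr_ge0.
    apply: (@le_trans _ _ (\int[P]_w (h w)%:E)%E).
      rewrite EFin_Rintegral // lee_fin.
      apply: (@le_trans _ _ (\int[P]_w (f (Vn n w) - Rn w))).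
        by rewrite RintegralB // lerB.
      by apply: le_Rintegral => // w _; rewrite le_max lexx.
    apply: ge0_le_integral_nonmeasurable => w.
      by rewrite lee_fin le_max lexx orbT.
    rewrite lee_fin ge_max f0 andbT; have := fR w; rewrite ler_norml; lra.
  apply: (@le_trans _ _ (\int[P]_w (f (Vn n w) + Rn w)%:E)%E).
    apply: ge0_le_integral_nonmeasurable => w; rewrite lee_fin //.
    by have := fR w; rewrite ler_norml; lra.
  rewrite EFin_Rintegral; last exact: integrable_add.
  by rewrite lee_fin RintegralD // lerD.
apply/andP; split; apply/ler_addgt0Pr => e e0.
  rewrite -lerBlDr -lee_fin -(cvg_lim _ cv) //.
  apply: lime_ge; first by apply/cvg_ex; exists (\int[P']_w f (W w))%:E.
  by apply: filterS (key e e0) => n /andP[].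
rewrite -lee_fin -(cvg_lim _ cv) //.
apply: lime_le; first by apply/cvg_ex; exists (\int[P']_w f (W w))%:E.
by apply: filterS (key e e0) => n /andP[].
Qed.

Hypothesis iVn : forall n, P.-integrable setT (EFin \o Vn n).
Hypothesis EVn : forall n, (0 < n)%N -> \int[P]_w Vn n w = C.
Hypothesis uiVn : forall e, 0 < e -> exists (L : R) (m : nat), 0 < L /\
  forall n, (m <= n)%N -> \int[P]_w Num.max (Vn n w - L) 0 <= e.

(** The test function for [law_limit_bounds]: bounded, 1-Lipschitz, and increasing to the positive
    part as [K] grows. *)
Let clip (K x : R) := Num.min (Num.max x 0) K.

Let clip_range K x : 0 < K -> 0 <= clip K x <= K.
Proof.
by move=> K0; rewrite /clip le_min le_max lexx orbT /= ltW // ge_min lexx orbT.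
Qed.

Let clip_lip K x y : `|clip K x - clip K y| <= `|x - y|.
Proof.
have max_lip (u v : R) : `|Num.max u 0 - Num.max v 0| <= `|u - v|.
  have h1 := ler_norm (u - v); have h2 := ler_norm (v - u); rewrite distrC in h2.
  rewrite ler_norml; apply/andP.
  by case: (leP u 0) => hu; case: (leP v 0) => hv; split; lra.
have min_lip (u v : R) : `|Num.min u K - Num.min v K| <= `|u - v|.
  have h1 := ler_norm (u - v); have h2 := ler_norm (v - u); rewrite distrC in h2.
  rewrite ler_norml; apply/andP.
  by case: (leP u K) => hu; case: (leP v K) => hv; split; lra.
exact: le_trans (min_lip _ _) (max_lip _ _).
Qed.

(** The clipped expectation is at most [C] at every level, and uniform integrability makes it at
    least [C - e] at some level [L]; monotone convergence concludes. Since the clip ignores negative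
    values, [W >= 0] almost surely is settled beforehand by testing [- W]. *)
Lemma limit_expectation : ('E_P'[W] = C%:E)%E.
Proof.
have mclip K : measurable_fun setT (fun w => clip K (W w)).
  by apply: measurable_minr => //; exact: measurable_maxr.
have mclipV K n : measurable_fun setT (fun w => clip K (Vn n w)).
  by apply: measurable_minr => //; exact: measurable_maxr.
have Wneg : \int[P']_w clip 1 (- W w) = 0.
  apply/eqP; rewrite eq_le andbC.
  apply: (@law_limit_bounds (fun x => clip 1 (- x)) 1) => //.
  - by move=> x; exact: clip_range.
  - by move=> x y; rewrite (le_trans (clip_lip _ _ _)) // -opprD normrN.
  exists 0%N => n _; rewrite (_ : \int[P]_w _ = 0) ?lexx //.
  rewrite -[RHS](Rintegral_prob_cst P 0); apply: eq_Rintegral => w _.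
  by rewrite /clip max_r ?oppr_le0 // min_l.
have Wge0 : {ae P', forall w, 0 <= W w}.
  have mneg : measurable_fun setT (fun w => clip 1 (- W w)).
    apply: measurable_minr => //; apply: measurable_maxr => //.
    exact: measurableT_comp.
  have : (\int[P']_w `|(clip 1 (- W w))%:E| = 0)%E.
    rewrite -[RHS]/(0%R%:E) -Wneg -EFin_Rintegral.
      apply: eq_integral => w _; rewrite gee0_abs // lee_fin.
      by case/andP: (clip_range (- W w) ltr01).
    apply: (integrable_le mneg _ (integrable_cst P' 1)) => w.
    by case/andP: (clip_range (- W w) ltr01) => ? ?; rewrite ger0_norm.
  move/(ae_eq_integral_abs P' measurableT ((measurable_EFinP _ _).2 mneg)).
  apply: filterS => w /(_ I) [] /eqP.
  rewrite /clip; case: (leP (- W w) 0); rewrite ?oppr_le0 // => Wl.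
  by rewrite gt_eqF // lt_min Wl ltr01.
have clip_le K v : 0 < K -> 0 <= v -> `|clip K v| <= v.
  move=> K0 v0; case/andP: (clip_range v K0) => c0 _.
  by rewrite ger0_norm // /clip ge_min ge_max lexx v0.
have upper K : 0 < K -> \int[P']_w clip K (W w) <= C.
  (* The lower bound, equal to -1, is a dummy: [law_limit_bounds] is two-sided and only its upper
     half is kept. *)
  move=> K0; have /andP[] // : C - (C + 1) <= \int[P']_w clip K (W w) <= C.
  apply: (@law_limit_bounds (clip K) K) => //; first by move=> x; exact: clip_range.
  exists 1%N => n n0; rewrite -(EVn n0); apply/andP; split.
    rewrite opprD addNKr (@le_trans _ _ 0) ?oppr_le0 //.
    by apply: Rintegral_ge0 => w _; case/andP: (clip_range (Vn n w) K0).
  apply: le_Rintegral => // [|w _].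
    apply: integrable_le (iVn n) => // w.
    exact: clip_le.
  by rewrite /clip ge_min ge_max lexx Vn0.
have lower e : 0 < e -> exists2 L, 0 < L & C - e <= \int[P']_w clip L (W w).
  move=> e0; have [L [m [L0 hL]]] := uiVn e0; exists L => //.
  have /andP[] // : C - e <= \int[P']_w clip L (W w) <= C.
  apply: (@law_limit_bounds (clip L) L) => //; first by move=> x; exact: clip_range.
  exists m.+1 => n mn; have n0 : (0 < n)%N by exact: leq_trans mn.
  have iclip : P.-integrable setT (EFin \o (fun w => clip L (Vn n w))).
    apply: integrable_le (iVn n) => // w.
    exact: clip_le.
  have clipE w : clip L (Vn n w) = Vn n w - Num.max (Vn n w - L) 0.
    by rewrite /clip max_l //; do 2 case: leP => ?; lra.
  rewrite -(EVn n0); apply/andP; split; last first.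
    apply: le_Rintegral => // w _; by rewrite /clip ge_min ge_max lexx Vn0.
  rewrite (eq_Rintegral _ (fun w _ => clipE w)) RintegralB //.
    by rewrite lerD2l lerN2; apply: hL; exact: ltnW.
  apply: integrable_le (iVn n).
    by apply: measurable_maxr => //; exact: measurable_funB.
  move=> w; rewrite ger0_norm ?le_max ?lexx ?orbT // ge_max Vn0 andbT.
  by rewrite gerBl ltW.
have iclipW K : 0 < K -> P'.-integrable setT (EFin \o (fun w => clip K (W w))).
  move=> K0; apply: (integrable_le (mclip K) _ (integrable_cst P' K)) => w.
  by case/andP: (clip_range (W w) K0) => ? ?; rewrite ger0_norm.
rewrite unlock.
transitivity (\int[P']_w (Num.max (W w) 0)%:E)%E.
  apply: ae_eq_integral => //.
  - exact/measurable_EFinP.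
  - by apply/measurable_EFinP; exact: measurable_maxr.
  - by apply: filterS Wge0 => w W0 _ /=; rewrite max_l.
have cv : (\int[P']_w (clip n.+1%:R (W w))%:E @[n --> \oo] -->
           \int[P']_w (Num.max (W w) 0)%:E)%E.
  have := @cvg_monotone_convergence _ _ _ P' setT measurableT
    (fun n w => (clip n.+1%:R (W w))%:E).
  move/(_ _ _ _)/cvg_trans; apply.
  - by move=> n; exact/measurable_EFinP.
  - by move=> n w _; rewrite lee_fin; case/andP: (clip_range (W w) (ltr0Sn R n)).
  - move=> w _ m n mn; rewrite lee_fin /clip le_min ge_min lexx /=.
    by rewrite ge_min ler_nat ltnS mn orbT.
  rewrite (_ : (\int[P']_w (Num.max (W w) 0)%:E)%E = (\int[P']_w limn
     (fun n => (clip n.+1%:R (W w))%:E))%E) //.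
  apply: eq_integral => w _; apply/esym/cvg_lim => //.
  apply: cvg_near_cst; exists (Num.truncn (Num.max (W w) 0)) => // n /= wn.
  congr (_%:E); rewrite /clip min_l // (le_trans (ltW (truncnS_gt _))) // ler_nat.
  by rewrite ltnS.
have EclipE n : (\int[P']_w (clip n.+1%:R (W w))%:E =
    (\int[P']_w clip n.+1%:R (W w))%:E)%E.
  by rewrite EFin_Rintegral //; exact: iclipW.
have icv : cvgn (fun n => \int[P']_w (clip n.+1%:R (W w))%:E)%E.
  by apply/cvg_ex; eexists; exact: cv.
apply/eqP; rewrite eq_le; apply/andP; split.
  rewrite -(cvg_lim _ cv) //; apply: lime_le => //; apply: nearW => n.
  by rewrite EclipE lee_fin upper.
apply/lee_addgt0Pr => e e0; have [L L0 hL] := lower e e0.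
rewrite -leeBlDr // -EFinB; apply: (@le_trans _ _ (\int[P']_w (clip L (W w))%:E)%E).
  by rewrite EFin_Rintegral ?lee_fin //; exact: iclipW.
apply: ge0_le_integral_nonmeasurable => w; rewrite lee_fin.
  by case/andP: (clip_range (W w) L0).
by rewrite /clip ge_min lexx.
Qed.

End LimitExpectation.

(** * Sample moments *)

Section Families.
Context {d d'} {T : measurableType d} {U : measurableType d'} {R : realType}.
Variables (P : probability T R) (V : T -> U) (Vs : nat -> T -> U).
Hypotheses (mV : measurable_fun setT V) (hiid : iid_copies P V Vs).
Variables (I : finType) (g : I -> U -> R).
Hypothesis mg : forall i, measurable_fun setT (g i).
Hypothesis g2 : forall i, P.-integrable setT (EFin \o (fun w => g i (V w) ^+ 2)).
Hypothesis g0 : forall i, \int[P]_w g i (V w) = 0.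

Let N i n w := (Num.sqrt n%:R)^-1 * partial_sum Vs (g i) n w.

(** With one index per matrix entry, this is the squared Frobenius norm of a normalized sum of
    centered random matrices. *)
Definition sum_sqr_normalized n w : R := \sum_i N i n w ^+ 2.
Local Notation Q := sum_sqr_normalized.

Lemma sqr_invsqrt n : (Num.sqrt n%:R)^-1 ^+ 2 = n%:R^-1 :> R.
Proof. by rewrite exprVn sqr_sqrtr. Qed.

Let mN i n : measurable_fun setT (N i n).
Proof. by apply: measurable_funM => //; exact: (measurable_partial_sum hiid). Qed.

Let iN i n : P.-integrable setT (EFin \o (fun w => N i n w ^+ 2)).
Proof.
have [iS _] := partial_sum_sqr mV hiid n (mg i) (g2 i) (g0 i).
have := integrable_scale n%:R^-1 iS; apply: eq_integrable => // w _.
by rewrite /= /N exprMn sqr_invsqrt.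
Qed.

Lemma sum_sqr_normalized_ge0 n w : 0 <= Q n w.
Proof. by apply: sumr_ge0 => i _; exact: sqr_ge0. Qed.

Lemma integrable_sum_sqr_normalized n : P.-integrable setT (EFin \o Q n).
Proof. exact: integrable_fin_sum. Qed.

Lemma Rintegral_sum_sqr_normalized n : (0 < n)%N ->
  \int[P]_w Q n w = \sum_i \int[P]_w (g i (V w) ^+ 2).
Proof.
move=> n0; rewrite /Q Rintegral_sum //; apply: eq_bigr => i _.
have [iS ES] := partial_sum_sqr mV hiid n (mg i) (g2 i) (g0 i).
have -> : \int[P]_w (N i n w ^+ 2) = \int[P]_w (n%:R^-1 * partial_sum Vs (g i) n w ^+ 2).
  by apply: eq_Rintegral => w _; rewrite /N exprMn sqr_invsqrt.
by rewrite RintegralZl // ES mulrA mulVf ?mul1r // pnatr_eq0 -lt0n.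
Qed.

(** The positive part of a sum is at most the sum of the positive parts, so thresholds and
    tolerances add up; the added ones cover an empty [I]. *)
Lemma sum_sqr_normalized_ui e : 0 < e -> exists (L : R) (m : nat), 0 < L /\
  forall n, (m <= n)%N -> \int[P]_w Num.max (Q n w - L) 0 <= e.
Proof.
move=> e0; pose e' := e / (#|I|%:R + 1).
have c0 : (0 : R) < #|I|%:R + 1 by rewrite ltr_wpDl.
have e'0 : 0 < e' by rewrite divr_gt0.
have ui i : exists Lm : R * nat, 0 < Lm.1 /\ forall n, (Lm.2 <= n)%N ->
    \int[P]_w Num.max (N i n w ^+ 2 - Lm.1) 0 <= e'.
  have [L [m hL]] := partial_sum_ui mV hiid (mg i) (g2 i) (g0 i) e'0.
  by exists (L, m).
have [Lm hLm] := choice ui.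
have S0 : 0 <= \sum_i (Lm i).1 by apply: sumr_ge0 => i _; exact: ltW (hLm i).1.
exists (\sum_i (Lm i).1 + 1), (\sum_i (Lm i).2)%N; split; first by rewrite ltr_wpDl.
move=> n mn; pose h i w := Num.max (N i n w ^+ 2 - (Lm i).1) 0.
have h0 i w : 0 <= h i w by rewrite le_max lexx orbT.
have ih i : P.-integrable setT (EFin \o h i).
  apply: integrable_le (iN i n).
    by apply: measurable_maxr => //; apply: measurable_funB => //; exact: measurable_funX.
  move=> w; rewrite ger0_norm // ge_max sqr_ge0 andbT gerBl ltW //.
  exact: (hLm i).1.
have pw w : Num.max (Q n w - (\sum_i (Lm i).1 + 1)) 0 <= \sum_i h i w.
  rewrite ge_max sumr_ge0 // andbT opprD addrA.
  rewrite (@le_trans _ _ (Q n w - \sum_i (Lm i).1)) //.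
    by rewrite gerBl.
  by rewrite /Q -sumrB; apply: ler_sum => i _; rewrite le_max lexx.
have iS := integrable_fin_sum measurableT (index_enum I) ih.
have mQ := integrable_measurable (integrable_sum_sqr_normalized n).
have iQ : P.-integrable setT (EFin \o (fun w =>
    Num.max (Q n w - (\sum_i (Lm i).1 + 1)) 0)).
  apply: integrable_le iS; first by apply: measurable_maxr => //; exact: measurable_funB.
  by move=> w; rewrite ger0_norm // le_max lexx orbT.
apply: (@le_trans _ _ (\int[P]_w \sum_i h i w)); first exact: le_Rintegral.
rewrite Rintegral_sum //; apply: (@le_trans _ _ (\sum_(i : I) e')).
  apply: ler_sum => i _; apply: (hLm i).2; apply: leq_trans mn.
  by rewrite (bigD1 i) //= leq_addr.
rewrite sumr_const -mulr_natl /e' mulrA ler_pdivrMr // mulrC ler_pM2l //.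
by rewrite lerDl.
Qed.

End Families.

(** Cauchy-Schwarz against constants, by x_i x_j <= x_i^2 / 2 + x_j^2 / 2. *)
Lemma sqr_sum_le (R : realType) (I : finType) (x : I -> R) :
  (\sum_i x i) ^+ 2 <= #|I|%:R * \sum_i x i ^+ 2.
Proof.
rewrite expr2 mulr_suml.
apply: (@le_trans _ _ (\sum_i \sum_j (x i ^+ 2 / 2 + x j ^+ 2 / 2))).
  apply: ler_sum => i _; rewrite mulr_sumr; apply: ler_sum => j _.
  by have := sqr_ge0 (x i - x j); nra.
have E i : \sum_j (x i ^+ 2 / 2 + x j ^+ 2 / 2) =
    #|I|%:R * (x i ^+ 2 / 2) + (\sum_j x j ^+ 2) / 2.
  by rewrite big_split /= sumr_const mulr_natl -mulr_suml.
rewrite (eq_bigr _ (fun i _ => E i)) big_split /= -mulr_sumr -mulr_suml sumr_const.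
by rewrite -[X in _ + X]mulr_natl -mulrDr -splitr.
Qed.

(** * Expectations of random matrices *)

Section MatrixExpectation.
Context {d} {T : measurableType d} {R : realType} (P : probability T R).

Lemma mean_mxE m n (H : T -> 'M[R]_(m, n)) i j :
  mean_mx P H i j = \int[P]_w H w i j.
Proof. by rewrite mxE unlock. Qed.

Lemma integrable_mulmx m n k (A : 'M[R]_(m, n)) (H : T -> 'M[R]_(n, k)) :
  integrable_mx P H -> integrable_mx P (fun w => A *m H w).
Proof.
move=> iH i j; have := integrable_fin_sum measurableT (index_enum 'I_n)
  (fun l => integrable_scale (A i l) (iH l j)).
by apply: eq_integrable => // w _; rewrite /= mxE.
Qed.

Lemma mean_mulmx m n k (A : 'M[R]_(m, n)) (H : T -> 'M[R]_(n, k)) :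
  integrable_mx P H -> mean_mx P (fun w => A *m H w) = A *m mean_mx P H.
Proof.
move=> iH; apply/matrixP => i j; rewrite mean_mxE mxE.
have -> : \int[P]_w (A *m H w) i j = \int[P]_w \sum_l A i l * H w l j.
  by apply: eq_Rintegral => w _; rewrite mxE.
rewrite Rintegral_sum //; last by move=> l; apply: integrable_scale; exact: iH.
by apply: eq_bigr => l _; rewrite RintegralZl ?mean_mxE //; exact: iH.
Qed.

Lemma integrable_trmx m n (H : T -> 'M[R]_(m, n)) :
  integrable_mx P H -> integrable_mx P (fun w => (H w)^T).
Proof.
move=> iH i j; have := iH j i.
by apply: eq_integrable => // w _; rewrite /= mxE.
Qed.

Lemma mean_trmx m n (H : T -> 'M[R]_(m, n)) :
  mean_mx P (fun w => (H w)^T) = (mean_mx P H)^T.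
Proof.
apply/matrixP => i j; rewrite [RHS]mxE !mean_mxE.
by apply: eq_Rintegral => w _; rewrite mxE.
Qed.

Lemma integrable_mulmxr m n k (H : T -> 'M[R]_(m, n)) (B : 'M[R]_(n, k)) :
  integrable_mx P H -> integrable_mx P (fun w => H w *m B).
Proof.
move=> /integrable_trmx /(integrable_mulmx B^T) /integrable_trmx iH i j.
have := iH i j; apply: eq_integrable => // w _ /=.
by rewrite trmx_mul !trmxK.
Qed.

Lemma mean_mulmxr m n k (H : T -> 'M[R]_(m, n)) (B : 'M[R]_(n, k)) :
  integrable_mx P H -> mean_mx P (fun w => H w *m B) = mean_mx P H *m B.
Proof.
move=> /integrable_trmx iH; apply: trmx_inj.
rewrite trmx_mul -!mean_trmx -mean_mulmx //; congr mean_mx.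
by apply/funext => w; rewrite trmx_mul.
Qed.

Lemma Rintegral_mxtrace n (H : T -> 'M[R]_n) : integrable_mx P H ->
  P.-integrable setT (EFin \o (fun w => \tr (H w))) /\
  \int[P]_w \tr (H w) = \tr (mean_mx P H).
Proof.
move=> iH; split; first by apply: integrable_fin_sum => // i; exact: iH.
rewrite /mxtrace Rintegral_sum //; last by move=> i; exact: iH.
by apply: eq_bigr => i _; rewrite mean_mxE.
Qed.

End MatrixExpectation.

Section RandomVectors.
Context {R : realType} {p : nat}.

Lemma continuous_measurable_rvec (f : 'cV[R]_p -> R) :
  continuous f -> measurable_fun setT (f : rvec R p -> R).
Proof.
move=> /continuousP cf; apply: (measurability _ (RGenOpens.measurableE R)).
move=> _ [_ [x [y ->]] <-]; rewrite setTI.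
by apply: sub_sigma_algebra; exact/cf/interval_open.
Qed.

Lemma continuous_affine (S : 'M[R]_p) (m : 'cV[R]_p) :
  continuous (fun z : 'cV[R]_p => S *m (z - m)).
Proof.
move=> x A /nbhs_ballP[e /= e0 eA]; apply/nbhs_ballP.
have c0 : 0 < norm1 S * p%:R + 1 by rewrite ltr_wpDl // mulr_ge0 ?norm1_ge0.
exists (e / (norm1 S * p%:R + 1)); first by rewrite /= divr_gt0.
move=> y [d0 hy]; apply: eA; split => // i j.
rewrite /ball /=; have -> : (S *m (x - m)) i j - (S *m (y - m)) i j = (S *m (x - y)) i j.
  by rewrite -[RHS]/((S *m (x - y)) i j) -{1}[x](subrK y) -[x - y + y - m]addrA mulmxDr
     mxE addrK.
apply: (le_lt_trans (norm1_entry _ _ _)); apply: (le_lt_trans (norm1M _ _)).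
have xy : norm1 (x - y) <= p%:R * (e / (norm1 S * p%:R + 1)).
  rewrite /norm1 mulr_natl -[X in _ *+ X]card_ord -sumr_const; apply: ler_sum => k _.
  by rewrite big_ord1 !mxE; exact: ltW (hy k 0).
apply: (@le_lt_trans _ _ (norm1 S * (p%:R * (e / (norm1 S * p%:R + 1))))).
  by rewrite ler_wpM2l ?norm1_ge0.
by rewrite !mulrA ltr_pdivrMr // [ltLHS]mulrC ltr_pM2l // ltrDl.
Qed.

Lemma measurable_affine d (T : measurableType d) (X : T -> 'cV[R]_p) S m :
  measurable_fun setT (X : T -> rvec R p) ->
  measurable_fun setT ((fun w => S *m (X w - m)) : T -> rvec R p).
Proof.
move=> mX; have : measurable_fun setT
    ((fun z => S *m (z - m)) : rvec R p -> rvec R p).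
  apply: (@measurability _ _ (rvec R p) (rvec R p) setT _ (@open 'cV[R]_p)) => //.
  move=> _ [B oB <-]; rewrite setTI.
  apply: sub_sigma_algebra.
  by have /continuousP := @continuous_affine S m; apply.
by move=> mS; exact: (measurableT_comp mS mX).
Qed.

End RandomVectors.

(** * Second moments of the sample matrix *)

Section SampleMoments.
Context {d} {T : measurableType d} {R : realType} {p : nat}.
Variables (P : probability T R) (Y : T -> R) (Z : T -> 'cV[R]_p).
Variables (Ys : nat -> T -> R) (Zs : nat -> T -> 'cV[R]_p) (psi : R -> R).
Hypothesis mpsi : measurable_fun setT psi.

Let V (w : T) : rvec R p * R := (Z w, Y w).
Let Vs k (w : T) : rvec R p * R := (Zs k w, Ys k w).
Hypotheses (mV : measurable_fun setT V) (hiid : iid_copies P V Vs).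

Definition weighted_square (u : rvec R p * R) : 'M[R]_p :=
  psi u.2 *: ((u.1 : 'cV[R]_p) *m (u.1 : 'cV[R]_p)^T).
Local Notation F := weighted_square.
Hypothesis iF : integrable_mx P (F \o V).
Variable M : 'M[R]_p.
Hypothesis ME : M = mean_mx P (F \o V).
Variable Mhat : nat -> T -> 'M[R]_p.
Hypothesis hMhat : forall n w,
  Mhat n w = n%:R^-1 *: \sum_(k < n) psi (Ys k w) *: (Zs k w *m (Zs k w)^T).

(** With [A = Qc], the choices [B = G] and [B = 1%:M] give the summands of the entries of [Qc D G]
    and of [Qc D], where D is [Mhat - M]. *)
Definition centered_entry (A B : 'M[R]_p) (ab : 'I_p * 'I_p) (u : rvec R p * R) : R :=
  (A *m (F u - M) *m B) ab.1 ab.2.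

Lemma measurable_weighted_square i j : measurable_fun setT (fun u => F u i j).
Proof.
have mcoord k : measurable_fun setT (fun u : rvec R p * R => (u.1 : 'cV[R]_p) k 0).
  apply: (measurableT_comp (f := fun z : rvec R p => (z : 'cV[R]_p) k 0)) => //.
  apply: continuous_measurable_rvec; exact: coord_continuous.
have -> : (fun u => F u i j) =
    (fun u => psi u.2 * ((u.1 : 'cV[R]_p) i 0 * (u.1 : 'cV[R]_p) j 0)).
  by apply/funext => u; rewrite !mxE big_ord1 !mxE.
apply: measurable_funM; last exact: measurable_funM.
exact: measurableT_comp.
Qed.

Lemma measurable_centered_entry A B ab : measurable_fun setT (centered_entry A B ab).
Proof.
have -> : centered_entry A B ab =
    (fun u => \sum_j (\sum_i A ab.1 i * (F u i j - M i j)) * B j ab.2).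
  apply/funext => u; rewrite /centered_entry !mxE; apply: eq_bigr => j _.
  by rewrite !mxE; congr (_ * _); apply: eq_bigr => i _; rewrite !mxE.
apply: measurable_sum => j; apply: measurable_funM => //.
apply: measurable_sum => i; apply: measurable_funM => //.
by apply: measurable_funB => //; exact: measurable_weighted_square.
Qed.

Lemma mean_centered_entry A B ab : \int[P]_w centered_entry A B ab (V w) = 0.
Proof.
rewrite -(mean_mxE P (fun w => A *m (F (V w) - M) *m B)).
have iFM : integrable_mx P (fun w => F (V w) - M).
  move=> i j; have := integrable_sub (iF i j) (integrable_cst P (M i j)).
  by apply: eq_integrable => // w _; rewrite /= !mxE.
rewrite mean_mulmxr; last exact: integrable_mulmx.
rewrite mean_mulmx // (_ : mean_mx P _ = 0) ?mulmx0 ?mul0mx ?mxE //.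
apply/matrixP => i j; rewrite mean_mxE mxE.
have -> : \int[P]_w (F (V w) - M) i j = \int[P]_w (F (V w) i j - M i j).
  by apply: eq_Rintegral => w _; rewrite !mxE.
rewrite RintegralB //; [|exact: iF|exact: integrable_cst].
by rewrite Rintegral_prob_cst ME mean_mxE subrr.
Qed.

Lemma sample_centered_entry (A B : 'M[R]_p) (ab : 'I_p * 'I_p) n w : (0 < n)%N ->
  (A *m (Mhat n w - M) *m B) ab.1 ab.2 =
  n%:R^-1 * partial_sum Vs (centered_entry A B ab) n w.
Proof.
move=> n0; have nn0 : n%:R != 0 :> R by rewrite pnatr_eq0 -lt0n.
have -> : Mhat n w - M = n%:R^-1 *: \sum_(k < n) (F (Vs k w) - M).
  rewrite hMhat big_split /= sumr_const card_ord scalerDr; congr (_ + _).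
  by rewrite mulNrn -[M *+ n]scaler_nat scalerN scalerA mulVf // scale1r.
rewrite -scalemxAr -scalemxAl mxE mulmx_sumr mulmx_suml summxE.
by [].
Qed.

Variables (Qc : 'M[R]_p).
Let H w : 'M[R]_p := (normsq (Qc *m Z w) * psi (Y w) ^+ 2) *: (Z w *m (Z w)^T).
Hypothesis iH : integrable_mx P H.

Lemma weighted_square_entry (B : 'M[R]_p) a b w : (Qc *m F (V w) *m B) a b =
  psi (Y w) * ((Qc *m Z w) a 0 * (B^T *m Z w) b 0).
Proof.
rewrite /F /V /= -scalemxAr -scalemxAl mxE mulmxA -[_ *m _ *m B]mulmxA; congr (_ * _).
have -> : (Z w)^T *m B = (B^T *m Z w)^T by rewrite trmx_mul trmxK.
by rewrite mxE big_ord1; congr (_ * _); rewrite [LHS]mxE.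
Qed.

(** The matrix [Qc F B] is psi times the rank one product of [Qc Z] and [(B^T Z)^T], so its squared
    Frobenius norm is psi^2 |Qc Z|^2 |B^T Z|^2: this is the origin of the weight in [H]. *)
Lemma sum_sqr_weighted_square_entry (B : 'M[R]_p) w :
  \sum_(ab : 'I_p * 'I_p) (Qc *m F (V w) *m B) ab.1 ab.2 ^+ 2 = \tr (B^T *m H w *m B).
Proof.
rewrite -(pair_bigA _ (fun a b => (Qc *m F (V w) *m B) a b ^+ 2)) /=.
rewrite exchange_big /=; apply: eq_bigr => b _.
have -> : B^T *m H w *m B = (normsq (Qc *m Z w) * psi (Y w) ^+ 2) *:
    ((B^T *m Z w) *m (B^T *m Z w)^T).
  by rewrite /H -scalemxAr -scalemxAl trmx_mul trmxK !mulmxA.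
rewrite mxE [X in _ = _ * X]mxE big_ord1 [X in _ = _ * (_ * X)]mxE.
rewrite /normsq mulr_suml mulr_suml.
by apply: eq_bigr => a _; rewrite weighted_square_entry; ring.
Qed.

(** By (x - c)^2 <= 2 x^2 + 2 c^2, where the square of one entry is at most the preceding trace.
    Integrability of that trace is [iH], whose factor |Qc Z|^2 is why [Qc] stands on the left. *)
Lemma integrable_sqr_centered_entry B ab :
  P.-integrable setT (EFin \o (fun w => centered_entry Qc B ab (V w) ^+ 2)).
Proof.
have [iT _] := Rintegral_mxtrace (integrable_mulmxr B (integrable_mulmx B^T iH)).
pose c := (Qc *m M *m B) ab.1 ab.2.
have i2 := integrable_add (integrable_scale 2 iT) (integrable_cst P (2 * c ^+ 2)).
apply: integrable_le i2.
  apply: measurable_funX; apply: measurableT_comp => //.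
  exact: measurable_centered_entry.
move=> w; rewrite ger0_norm ?sqr_ge0 // -sum_sqr_weighted_square_entry.
rewrite (bigD1 ab) //=; set r := \sum_(_ | _) _.
have r0 : 0 <= r by apply: sumr_ge0 => ? _; exact: sqr_ge0.
have -> : centered_entry Qc B ab (V w) = (Qc *m F (V w) *m B) ab.1 ab.2 - c.
  by rewrite /centered_entry /c mulmxBr mulmxBl mxE [X in _ + X]mxE.
by move: (_ ab.1 ab.2) => x; have := sqr_ge0 (x + c); nra.
Qed.

(** When [Qc M B = 0] the entries of [Qc F B] are already centered, so variances are plain second
    moments and no correction to [mean_mx P H] appears. *)
Lemma sum_second_moments (B : 'M[R]_p) : Qc *m M *m B = 0 ->
  \sum_ab \int[P]_w (centered_entry Qc B ab (V w) ^+ 2) =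
  \tr (B^T *m mean_mx P H *m B).
Proof.
move=> QMB; have iB := integrable_mulmxr B (integrable_mulmx B^T iH).
have [_] := Rintegral_mxtrace iB.
rewrite mean_mulmxr; last exact: integrable_mulmx.
rewrite mean_mulmx // => <-; rewrite -Rintegral_sum //; last first.
  by move=> ab; exact: integrable_sqr_centered_entry.
apply: eq_Rintegral => w _; rewrite -sum_sqr_weighted_square_entry.
apply: eq_bigr => ab _; congr (_ ^+ 2).
by rewrite /centered_entry mulmxBr mulmxBl QMB subr0.
Qed.

Lemma sample_sum_sqr (B : 'M[R]_p) n w : (0 < n)%N ->
  sum_sqr_normalized Vs (centered_entry Qc B) n w =
  n%:R * \sum_(ab : 'I_p * 'I_p) (Qc *m (Mhat n w - M) *m B) ab.1 ab.2 ^+ 2.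
Proof.
move=> n0; have nn0 : n%:R != 0 :> R by rewrite pnatr_eq0 -lt0n.
rewrite /sum_sqr_normalized mulr_sumr; apply: eq_bigr => ab _.
by rewrite sample_centered_entry // !exprMn sqr_invsqrt; field.
Qed.

End SampleMoments.

Lemma norm1_sqr_le (R : realType) m n (A : 'M[R]_(m, n)) :
  norm1 A ^+ 2 <= (m * n)%:R * \sum_(ab : 'I_m * 'I_n) A ab.1 ab.2 ^+ 2.
Proof.
have := sqr_sum_le (fun ab : 'I_m * 'I_n => `|A ab.1 ab.2|).
rewrite card_prod !card_ord -(pair_bigA _ (fun a b => `|A a b|)) /= => /le_trans; apply.
rewrite le_eqVlt; apply/orP; left; apply/eqP; congr (_ * _); apply: eq_bigr => ab _.
by rewrite real_normK ?num_real.
Qed.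

Lemma mxtrace_mul_tr (R : realType) m n (A : 'M[R]_(m, n)) :
  \tr (A *m A^T) = \sum_(ab : 'I_m * 'I_n) A ab.1 ab.2 ^+ 2.
Proof.
rewrite -(pair_bigA _ (fun a b => A a b ^+ 2)) /=; apply: eq_bigr => a _.
by rewrite mxE; apply: eq_bigr => b _; rewrite mxE expr2.
Qed.

(** * Expansion, moments and limit in law combined *)

Theorem proposition5p2
  (d : measure_display) (T : measurableType d) (R : realType)
  (P : probability T R) (p : nat)
  (Y : T -> R) (X : T -> 'cV[R]_p)
  (mY : measurable_fun setT Y)
  (mX : measurable_fun setT (X : T -> rvec R p))
  (X2 : forall i, P.-integrable setT (fun w => (X w i ord0 ^+ 2)%:E))
  (Sigma_inv : cov_mx P X \in unitmx)
  (S : 'M[R]_p) (hS : inv_sqrtmx (cov_mx P X) S)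
  (Z : T -> 'cV[R]_p) (hZ : Z = fun w => S *m (X w - mean_mx P X))
  (Zs : nat -> T -> 'cV[R]_p) (Ys : nat -> T -> R)
  (hiid : iid_copies P (fun w => (Z w, Y w) : rvec R p * R)
            (fun k w => (Zs k w, Ys k w) : rvec R p * R))
  (hdens : density_null_boundary P X)
  (Ec : {vspace 'cV[R]_p}) (hEc : is_central_subspace P Y Z Ec)
  (dim_Ec : (\dim Ec < p)%N)
  (Pc : 'M[R]_p) (hPc : orth_proj Ec Pc)
  (Qc : 'M[R]_p) (hQc : Qc = 1%:M - Pc)
  (hlin : linearity_condition P Pc Z)
  (hdcv : diagonal_cond_var P Pc Z)
  (psi : R -> R) (mpsi : measurable_fun setT psi)
  (int_M : integrable_mx P (fun w => psi (Y w) *: (Z w *m (Z w)^T)))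
  (int_lam : P.-integrable setT
     (fun w => (normsq (Qc *m Z w) * psi (Y w))%:E))
  (int_W : integrable_mx P
     (fun w => (normsq (Qc *m Z w) * psi (Y w) ^+ 2) *: (Z w *m (Z w)^T)))
  (M : 'M[R]_p)
  (hM : M = mean_mx P (fun w => psi (Y w) *: (Z w *m (Z w)^T)))
  (lam : R)
  (hlam : lam = (p - \dim Ec)%:R^-1 *
     fine 'E_P[fun w => (normsq (Qc *m Z w) * psi (Y w))%R]%E)
  (hEpsi : colspace (M - lam%:M) = Ec)
  (gamma : R -> R[i]) (hgamma : positive_contour gamma)
  (hin : forall z : R[i], eigenvalue (cmx M) z -> z != lam%:C ->
     encloses gamma z)
  (hout : leaves_outside gamma lam%:C)
  (Mhat : nat -> T -> 'M[R]_p)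
  (hMhat : forall n w, Mhat n w =
     n%:R^-1 *: \sum_(k < n) psi (Ys k w) *: (Zs k w *m (Zs k w)^T))
  (Phat : nat -> T -> 'M[R[i]]_p)
  (hPhat : forall n w, Phat n w = riesz_proj gamma (Mhat n w))
  (d' : measure_display) (T' : measurableType d') (P' : probability T' R)
  (W : {RV P' >-> R})
  (hW : cvg_in_law P
     (fun n w => n%:R * complex.Re (\tr (cmx Qc *m Phat n w))) P' W) :
  let A := Pc *m M - lam%:M in
  let Ainv := if lam == 0 then inv_on Pc A else invmx A in
  'E_P'[W]%E =
    (\tr (mean_mx P (fun w => (normsq (Qc *m Z w) * psi (Y w) ^+ 2)
                                *: (Z w *m (Z w)^T))
          *m Pc *m (Ainv *m Ainv)))%:E.
Proof.
move=> A Ainv.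
pose V (w : T) : rvec R p * R := (Z w, Y w).
pose Vs k (w : T) : rvec R p * R := (Zs k w, Ys k w).
have mV : measurable_fun setT V.
  apply: measurable_fun_pair => //.
  by rewrite hZ; exact: measurable_affine.
have ME : M = mean_mx P (weighted_square psi \o V) by rewrite hM.
have Msym : M^T = M.
  rewrite ME -mean_trmx; congr mean_mx; apply/funext => w.
  by rewrite /weighted_square /= linearZ /= trmx_mul trmxK.
have Mhatsym n w : (Mhat n w)^T = Mhat n w.
  rewrite hMhat linearZ linear_sum /=; congr (_ *: _); apply: eq_bigr => k _.
  by rewrite linearZ /= trmx_mul trmxK.
have hPc' : orth_proj (colspace (M - lam%:M)) Pc by rewrite hEpsi.
have [G [Gsym GA [QN QG] Qsym expand]] := riesz_proj_expansion hgamma hin hout Msym hPc'.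
rewrite -hQc in QN QG Qsym expand; rewrite -/A -/Ainv in GA.
pose H w : 'M[R]_p := (normsq (Qc *m Z w) * psi (Y w) ^+ 2) *: (Z w *m (Z w)^T).
have iH : integrable_mx P H := int_W.
(* [Qc] commutes past [M] as the scalar [lam] and is killed by [G]; this is the centering required
   by [sum_second_moments]. *)
have QMG : Qc *m M *m G = 0.
  have -> : Qc *m M = lam *: Qc.
    by apply/eqP; rewrite -subr_eq0 -mul_mx_scalar -mulmxBr QN.
  by rewrite -scalemxAl QG scaler0.
pose g B := centered_entry psi M Qc B.
have mg B ab : measurable_fun setT (g B ab) by exact: measurable_centered_entry.
have g2 B ab : P.-integrable setT (EFin \o (fun w => g B ab (V w) ^+ 2)).
  exact: (integrable_sqr_centered_entry mpsi mV M iH).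
have g0 B ab : \int[P]_w g B ab (V w) = 0.
  exact: (mean_centered_entry int_M ME).
pose C := \tr (mean_mx P H *m (G *m G)).
have EC : \sum_ab \int[P]_w (g G ab (V w) ^+ 2) = C.
  rewrite (sum_second_moments mpsi mV iH QMG) Gsym -mulmxA mxtrace_mulC.
  by rewrite -!mulmxA.
pose Vn n w := sum_sqr_normalized Vs (g G) n w.
have VnE n w : (0 < n)%N -> Vn n w =
    n%:R * \tr (Qc *m (Mhat n w - M) *m (G *m G) *m ((Mhat n w - M) *m Qc)).
  move=> n0; rewrite /Vn (sample_sum_sqr M hMhat) //; congr (_ * _).
  rewrite -mxtrace_mul_tr !trmx_mul Gsym Qsym [(_ - _)^T]linearB /= Mhatsym Msym.
  by rewrite !mulmxA.
(* For every positive [n], the expectation of n times the squared Frobenius norm of [Qc (Mhat - M)],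
   which carries the error of the expansion. *)
pose D := \sum_ab \int[P]_w (g 1%:M ab (V w) ^+ 2).
have D0 : 0 <= D.
  by apply: sumr_ge0 => ab _; apply: Rintegral_ge0 => w _; exact: sqr_ge0.
rewrite (_ : \tr _ = C); last by rewrite /C -mulmxA GA.
apply: (limit_expectation (Vn := Vn) _ hW).
- by [].
- move=> n; apply: integrable_measurable.
  exact: (integrable_sum_sqr_normalized mV hiid (mg G) (g2 G) (g0 G)).
- by move=> n w; exact: sum_sqr_normalized_ge0.
- move=> K e K0 e0.
  (* [eta] is chosen so that the expansion error costs at most [e / 2] in mean, [p * p] being the
     price of bounding the square of [norm1] by a sum of squares. *)
  pose c := (p * p)%:R * D + 1.
  have c0 : 0 < c by rewrite ltr_wpDl // mulr_ge0.
  pose eta := e / 2 / c; have eta0 : 0 < eta by rewrite !divr_gt0.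
  have [delta [delta0 hdelta]] := expand eta eta0.
  (* Makes the samples with [Mhat] farther than [delta] from [M] cost at most [e / 2], after
     summation over the [p * p] entries. *)
  pose e' := e / 2 / (K / delta * (p * p)%:R + 1).
  have c'0 : 0 < K / delta * (p * p)%:R + 1.
    by rewrite ltr_wpDl // mulr_ge0 // divr_ge0 // ltW.
  have e'0 : 0 < e' by rewrite !divr_gt0.
  pose f (ij : 'I_p * 'I_p) u := weighted_square psi u ij.1 ij.2.
  have lln ij : exists m : nat, forall n, (m <= n)%N ->
      P.-integrable setT (EFin \o (fun w =>
        `|n%:R^-1 * partial_sum Vs (f ij) n w - \int[P]_w f ij (V w)|)) /\
      \int[P]_w `|n%:R^-1 * partial_sum Vs (f ij) n w - \int[P]_w f ij (V w)| <= e'.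
    have mf : measurable_fun setT (f ij) by exact: measurable_weighted_square.
    exact: (partial_sum_lln mV hiid mf (int_M ij.1 ij.2)).
  have [N hN] := choice lln.
  (* The sum dominates every threshold; the successor makes [n] positive, as [VnE] requires. *)
  exists ((\sum_ij N ij).+1)%N => n Nn.
  have n0 : (0 < n)%N by exact: leq_trans Nn.
  have NN ij : (N ij <= n)%N.
    apply: leq_trans (ltnW Nn); by rewrite (bigD1 ij) //= leq_addr.
  pose a ij w := `|n%:R^-1 * partial_sum Vs (f ij) n w - \int[P]_w f ij (V w)|.
  have aE w : norm1 (Mhat n w - M) = \sum_ij a ij w.
    rewrite /norm1 pair_bigA /=; apply: eq_bigr => ij _; rewrite /a.
    by rewrite mxE [(- M) _ _]mxE hMhat [X in X - _]mxE summxE ME mean_mxE.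
  have ia ij : P.-integrable setT (EFin \o a ij) := (hN ij n (NN ij)).1.
  (* The first term covers the samples where the expansion applies. The second is a pointwise Markov
     inequality: once [norm1 (Mhat n w - M)] exceeds [delta], it is at least [K], hence above the
     truncated difference. *)
  pose Rn w := eta * ((p * p)%:R * sum_sqr_normalized Vs (g 1%:M) n w) +
               K / delta * \sum_ij a ij w.
  have iQ := integrable_sum_sqr_normalized mV hiid (mg 1%:M) (g2 1%:M) (g0 1%:M) n.
  have iS := integrable_fin_sum measurableT (index_enum ('I_p * 'I_p)%type) ia.
  have iR1 := integrable_scale eta (integrable_scale (p * p)%:R iQ).
  have iR2 := integrable_scale (K / delta) iS.
  have Sa0 w : 0 <= \sum_ij a ij w by apply: sumr_ge0 => ij _; exact: normr_ge0.
  have Q0 w := sum_sqr_normalized_ge0 Vs (g 1%:M) n w.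
  exists Rn; split.
  + exact: integrable_add.
  + rewrite /Rn RintegralD // RintegralZl //; last exact: integrable_scale.
    rewrite RintegralZl // RintegralZl //.
    rewrite (Rintegral_sum_sqr_normalized mV hiid (mg 1%:M) (g2 1%:M) (g0 1%:M)) // -/D.
    rewrite Rintegral_sum //.
    have h1 : eta * ((p * p)%:R * D) <= e / 2.
      rewrite /eta -mulrA ler_piMr //; first by rewrite divr_ge0 // ltW.
      by rewrite mulrC ler_pdivrMr // mul1r /c lerDl.
    have h2 : \sum_ij \int[P]_w a ij w <= (p * p)%:R * e'.
      apply: (@le_trans _ _ (\sum_(ij : 'I_p * 'I_p) e')).
        by apply: ler_sum => ij _; exact: (hN ij n (NN ij)).2.
      by rewrite sumr_const card_prod !card_ord mulr_natl.
    have h3 : K / delta * ((p * p)%:R * e') <= e / 2.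
      rewrite mulrA /e' mulrCA ler_piMr //; first by rewrite divr_ge0 // ltW.
      by rewrite ler_pdivrMr // mul1r lerDl.
    have h4 : K / delta * \sum_ij \int[P]_w a ij w <= K / delta * ((p * p)%:R * e').
      by rewrite ler_wpM2l // divr_ge0 // ltW.
    rewrite [leRHS]splitr; apply: lerD => //; exact: le_trans h4 h3.
  + move=> w; apply: addr_ge0.
      by apply: mulr_ge0; [exact: ltW|exact: mulr_ge0].
    by apply: mulr_ge0 => //; rewrite divr_ge0 // ltW.
  + move=> w; rewrite hPhat.
    have [small|large] := leP (norm1 (Mhat n w - M)) delta; last first.
      rewrite ge_min; apply/orP; right; rewrite /Rn -aE.
      apply: (@le_trans _ _ (K / delta * norm1 (Mhat n w - M))).
        by rewrite -mulrA ler_peMr ?(ltW K0) // mulrC ler_pdivlMr // mul1r ltW.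
      by rewrite lerDr mulr_ge0 ?(ltW eta0) // mulr_ge0.
    rewrite ge_min; apply/orP; left; rewrite VnE // -mulrBr normrM.
    rewrite (ger0_norm (ler0n R n)).
    have := hdelta (Mhat n w) (Mhatsym n w) small.
    move/(ler_wpM2l (ler0n R n)) => /le_trans; apply.
    rewrite mulrCA.
    rewrite (@le_trans _ _ (eta * ((p * p)%:R * sum_sqr_normalized Vs (g 1%:M) n w))) //.
      rewrite ler_pM2l // (sample_sum_sqr M hMhat) // [leRHS]mulrCA ler_wpM2l //.
      by rewrite mulmx1 norm1_sqr_le.
    by rewrite /Rn lerDl mulr_ge0 // divr_ge0 // ltW.
- by move=> n; exact: (integrable_sum_sqr_normalized mV hiid (mg G) (g2 G) (g0 G)).
- move=> n n0.
  by rewrite -EC (Rintegral_sum_sqr_normalized mV hiid (mg G) (g2 G) (g0 G)).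
- by move=> e e0; exact: (sum_sqr_normalized_ui mV hiid (mg G) (g2 G) (g0 G)).
Qed.
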